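(* Let $\mathfrak g$ be simple with Coxeter number $h$, short dominant root $\theta_s$ and $l=\#(\Pi\cap\Delta_s)$. Then $\frac{\mathfrak m_{\theta_s}^0(q)}{q^{h-\mathrm{ht}(\theta_s)}}$ is a polynomial in $q$, and $$\sum_{\mu}\mathfrak m_{\theta_s}^\mu(q)=\mathfrak m_{\theta_s}^0(q)\bigl(\mathfrak m_{\theta_s}^0(q)-l+1\bigr)+\frac{\mathfrak m_{\theta_s}^0(q)}{q^{h-\mathrm{ht}(\theta_s)}}\cdot\frac{1-q^h}{1-q},$$ where the sum is over the distinct weights $\mu\in\Delta_s\cup\{0\}$ of $V_{\theta_s}$; equivalently, $$\sum_{\mu} m_{\theta_s}^\mu\,\mathfrak m_{\theta_s}^\mu(q)=\mathfrak m_{\theta_s}^0(q)^2+\frac{\mathfrak m_{\theta_s}^0(q)}{q^{h-\mathrm{ht}(\theta_s)}}\cdot\frac{1-q^h}{1-q}.$$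
   Context: Let $\mathfrak g$ be a semisimple Lie algebra over an algebraically closed field of characteristic zero, with Cartan subalgebra $\mathfrak t$, root system $\Delta$, positive roots $\Delta^+$, simple roots $\Pi=\{\alpha_1,\dots,\alpha_r\}$, $\rho=\frac12\sum_{\gamma\in\Delta^+}\gamma$, integral weight lattice $\mathfrak X$, dominant weights $\mathfrak X_+$, root lattice $Q$, and $Q_+$ the monoid generated by $\Pi$. The Weyl group is $W$, with length function $\ell$ and sign $\varepsilon(w)=(-1)^{\ell(w)}$. For $\gamma=\sum_i c_i\alpha_i\in Q$, $\mathrm{ht}(\gamma)=\sum_i c_i$. Define polynomials $\mathcal P_q(\mu)\in\mathbb Z[q]$ by $\prod_{\alpha\in\Delta^+}(1-qe^{\alpha})^{-1}=\sum_{\mu\in Q_+}\mathcal P_q(\mu)e^\mu$, and $\mathcal P_q(\mu)=0$ for $\mu\notin Q_+$. For $\lambda\in\mathfrak X_+$ and any $\mu\in\mathfrak X$, Lusztig's $q$-analogue of weight multiplicity is $\mathfrak m_\lambda^\mu(q)=\sum_{w\in W}\varepsilon(w)\mathcal P_q(w(\lambda+\rho)-(\mu+\rho))$; $m_\lambda^\mu$ is the dimension of the $\mu$-weight space of the simple module $V_\lambda$. $\Delta_s$ is the set of short roots (all roots if $\mathfrak g$ is simply-laced), $\theta_s$ the unique dominant short root. The weights of $V_{\theta_s}$ are $\Delta_s\cup\{0\}$, with $m_{\theta_s}^\mu=1$ for $\mu\in\Delta_s$ and $m_{\theta_s}^0=l$. *)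

(* Defs.v *)
(* Root-system data of a simple Lie algebra, encoded through its
   Cartan matrix, in simple-root coordinates over rat. *)
From HB Require Import structures.
From mathcomp Require Import all_boot all_order all_algebra.
From Stdlib Require Import ClassicalEpsilon.
Set Implicit Arguments. Unset Strict Implicit. Unset Printing Implicit Defensive.
Import Order.TTheory GRing.Theory Num.Theory.
Local Open Scope ring_scope.

Definition least (P : pred nat) : nat :=
  match excluded_middle_informative (exists n, P n) with
  | left H => ex_minn H
  | right _ => 0%N
  end.

Section RootData.
Variables (r : nat) (A : 'M[int]_r).

(* Cartan matrix axioms, with the convention a_ij = <alpha_j, alpha_i^vee> *)
Definition is_cartan_matrix : Prop :=
  (forall i, A i i = 2) /\
  (forall i j, i != j -> A i j <= 0) /\
  (forall i j, (A i j == 0) = (A j i == 0)).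

(* indecomposable (<-> the Lie algebra is simple) *)
Definition indecomposable : Prop :=
  forall S : {set 'I_r}, S != set0 -> S != setT ->
    exists i j, [/\ i \in S, j \notin S & A i j != 0].

(* d symmetrizes A: (alpha_i, alpha_j) := d_i a_ij is symmetric *)
Definition symmetrizes (d : 'I_r -> rat) : Prop :=
  (forall i, 0 < d i) /\ (forall i j, d i * (A i j)%:~R = d j * (A j i)%:~R).

Definition form (d : 'I_r -> rat) (x y : 'rV[rat]_r) : rat :=
  \sum_(i < r) \sum_(j < r) x 0 i * d i * (A i j)%:~R * y 0 j.

(* finite type: the symmetrized Cartan matrix is positive definite *)
Definition pos_def_form (d : 'I_r -> rat) : Prop :=
  forall x : 'rV[rat]_r, x != 0 -> 0 < form d x x.

(* simple reflection s_i acting on row vectors (simple-root coordinates):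
   x *m refl i = x - <x, alpha_i^vee> alpha_i *)
Definition refl (i : 'I_r) : 'M[rat]_r :=
  \matrix_(j, k) ((j == k)%:R - (k == i)%:R * (A i j)%:~R).

Definition word_mx (s : seq 'I_r) : 'M[rat]_r :=
  foldr (fun i M => refl i *m M) 1%:M s.

Definition enumerates_weyl (Wl : seq 'M[rat]_r) : Prop :=
  uniq Wl /\ forall M, M \in Wl <-> exists s : seq 'I_r, M = word_mx s.

Definition wlength (w : 'M[rat]_r) : nat :=
  least (fun n => [exists t : n.-tuple 'I_r, word_mx t == w]).
Definition sgn (w : 'M[rat]_r) : {poly int} := (-1) ^+ wlength w.

Definition coxeter_number : nat :=
  least (fun k => (0 < k)%N && (iter k (mulmx (word_mx (enum 'I_r))) 1%:M == 1%:M)).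

Definition simple_root (i : 'I_r) : 'rV[rat]_r := \row_j (j == i)%:R.

Variable Wl : seq 'M[rat]_r.

Definition roots : seq 'rV[rat]_r :=
  undup [seq simple_root i *m w | i <- enum 'I_r, w <- Wl].
Definition pos_roots : seq 'rV[rat]_r :=
  [seq x : 'rV[rat]_r <- roots | [forall j, 0 <= x 0 j]].

Definition rho : 'rV[rat]_r := 2^-1 *: \sum_(g <- pos_roots) g.

Definition ht (x : 'rV[rat]_r) : rat := \sum_(j < r) x 0 j.

Definition in_Qplus (x : 'rV[rat]_r) : bool := [forall j, x 0 j \is a Num.nat].

(* P_q(mu): coefficient of e^mu in prod_{a>0} (1 - q e^a)^{-1}; a multiplicity
   k_a of a positive root a in a decomposition of mu is at most ht(mu). *)
Definition Pq (mu : 'rV[rat]_r) : {poly int} :=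
  if in_Qplus mu then
    \sum_(k : {ffun 'I_(size pos_roots) -> 'I_(Num.truncn (ht mu)).+1}
           | \sum_(i < size pos_roots) (pos_roots`_i *+ k i) == mu)
      'X^(\sum_(i < size pos_roots) (k i : nat))
  else 0.

Definition mq (lam mu : 'rV[rat]_r) : {poly int} :=
  \sum_(w <- Wl) sgn w * Pq ((lam + rho) *m w - (mu + rho)).

Variable d : 'I_r -> rat.

Definition short_roots : seq 'rV[rat]_r :=
  [seq x : 'rV[rat]_r <- roots | all (fun y => form d x x <= form d y y) roots].

Definition dominant (x : 'rV[rat]_r) : bool :=
  [forall i, 0 <= \sum_(j < r) (A i j)%:~R * x 0 j].

Definition n_short_simple : nat :=
  #|[set i : 'I_r | simple_root i \in short_roots]|.

End RootData.

(* Main.v *)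
(* Write [S(q)] for the sum of [q^ht b] over the positive short roots [b], and
   [H = ht theta_s].

   Weights.  Removing the factor of a simple root [a] from the partition function
   leaves an [s_a]-invariant function, so
   [m^mu + m^(s_a mu - a) = q (m^(mu+a) + m^(s_a mu))]; along the short roots this
   gives [m^b = q^(H - ht b)] and [m^(-b) = q^(ht b - 1) ((q - 1) m^0 + q^H)].
   Expanding the numerator of the Weyl character formula over the weights of
   [V_theta_s] gives [m^0 = l + (q - 1) S(q) / q].  After this the theorem amounts
   to [m^0(q) = q^h m^0(1/q)].

   Duality.  Let [g = 1 + (rho, theta_s^vee)].  The Weyl denominator formula of the
   dual root system computes [l + S(q) + S(1/q)], the principal specialization of
   the character, as a product over the positive roots; Macdonald's identity for
   the orbit of [theta_s] computes [S(q)/q + S(1/q)] (up to a power of [q]) as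
   almost the same product.  The quotient is [(1 - q^(g+1)) / (1 - q^g)], and this
   is the duality with [g] in place of [h].

   Coxeter number.  At [q = 1] the duality counts [l g] short roots.  Every orbit of
   a Coxeter element on them goes from positive to negative at least once, and only
   [l] positive short roots become negative in one step, so [h >= g].  Conversely
   the Coxeter element is conjugate to a product [u v], where [u] and [v]
   are products of mutually commuting simple reflections (the graph is a forest); a Perron-Frobenius eigenvector of the
   Cartan matrix gives a [u, v]-stable plane that makes all the simple roots of one
   colour change sign together, hence the longest element is an alternating product
   of [u] and [v] whose length is known from the count, and [(u v)^g = 1]. *)

(* The product formulas involve half-integral powers of $q$. They are therefore proved for an
   arbitrary injective homomorphism [e] from the rationals to the positive elements of an ordered
   field, and come back to integer polynomials by taking [e] to be $a\mapsto\exp(ca)$ for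
   $c=1,2,\dots$. Macdonald's sum has one free parameter per positive root; taking it nontrivial
   exactly on the roots not orthogonal to $\theta_s$ collapses the sum from $W$ to the orbit of
   $\theta_s$.

   The obstacle is $h$: it is defined as the order of one particular product of reflections, which
   says nothing about heights, and no classification is used to relate the two. The Perron-Frobenius
   vector is irrational in general, hence the passage to an algebraically closed field there.

   Divisibility of $m^0$ by $q^{h-H}$, and $h\ge H$ itself, come from the duality, because the
   reversed polynomial $q^Hm^0(1/q)$ has a nonzero constant term. *)
From Stdlib Require Import Reals.
From HB Require Import structures.
From mathcomp Require Import all_boot all_order all_algebra all_field.
From mathcomp Require Import Rstruct.
From mathcomp Require Import ring lra zify.
Require Import Defs.
Set Implicit Arguments. Unset Strict Implicit. Unset Printing Implicit Defensive.
Import Order.TTheory GRing.Theory Num.Theory.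
Local Open Scope ring_scope.

Record cartan_datum (r : nat) (A : 'M[int]_r) (d : 'I_r -> rat)
    (Wl : seq 'M[rat]_r) : Prop := CartanDatum {
  datum_cartan : is_cartan_matrix A;
  datum_indec : indecomposable A;
  datum_sym : symmetrizes A d;
  datum_pos : pos_def_form A d;
  datum_weyl : enumerates_weyl A Wl }.

(** The value $\langle x,\alpha_i^\vee\rangle$ of a simple coroot. *)
Definition pair r (A : 'M[int]_r) (i : 'I_r) (x : 'rV[rat]_r) : rat :=
  \sum_(j < r) (A i j)%:~R * x 0 j.

(** * The form and the reflections *)

Section Form.
Variables (r : nat) (A : 'M[int]_r) (d : 'I_r -> rat).
Implicit Types (x y : 'rV[rat]_r) (i j : 'I_r) (s : seq 'I_r).
Local Notation "''[' x , y ]" := (form A d x y).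
Local Notation al := (@simple_root r).
Local Notation word := (word_mx A).

Lemma formE x y : '[x, y] = \sum_i x 0 i * (d i * pair A i y).
Proof.
apply: eq_bigr => i _; rewrite mulrA [RHS]mulr_sumr.
by apply: eq_bigr => j _; rewrite !mulrA.
Qed.

Fact pair_is_linear i : linear (pair A i : 'rV[rat]_r -> rat^o).
Proof.
move=> a x y; rewrite /pair scaler_sumr -big_split; apply: eq_bigr => j _.
by rewrite !mxE mulrDr /= mulrCA.
Qed.
HB.instance Definition _ i :=
  GRing.isLinear.Build rat 'rV[rat]_r rat^o _ (pair A i : 'rV[rat]_r -> rat^o) (pair_is_linear i).

Lemma pairD i x y : pair A i (x + y) = pair A i x + pair A i y.
Proof. exact: (raddfD (pair A i : 'rV[rat]_r -> rat^o)). Qed.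
Lemma pairB i x y : pair A i (x - y) = pair A i x - pair A i y.
Proof. exact: (raddfB (pair A i : 'rV[rat]_r -> rat^o)). Qed.
Lemma pairN i x : pair A i (- x) = - pair A i x.
Proof. exact: (raddfN (pair A i : 'rV[rat]_r -> rat^o)). Qed.
Lemma pair0 i : pair A i 0 = 0.
Proof. exact: (raddf0 (pair A i : 'rV[rat]_r -> rat^o)). Qed.
Lemma pairZ i a x : pair A i (a *: x) = a * pair A i x.
Proof. exact: (linearZ_LR (pair A i : 'rV[rat]_r -> rat^o)). Qed.

Lemma alE i j : al i 0 j = (j == i)%:R. Proof. by rewrite mxE. Qed.

Lemma pair_al i j : pair A i (al j) = (A i j)%:~R.
Proof.
rewrite /pair (bigD1 j) //= alE eqxx mulr1 big1 ?addr0 // => k kj.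
by rewrite alE (negPf kj) mulr0.
Qed.

Lemma reflE i x : x *m refl A i = x - pair A i x *: al i.
Proof.
apply/rowP => k; rewrite !mxE (eq_bigr (fun j =>
  x 0 j * (j == k)%:R - ((A i j)%:~R * x 0 j) * (k == i)%:R)); last first.
  by move=> j _; rewrite !mxE mulrBr; congr (_ - _); rewrite mulrCA mulrC [_ * x 0 j]mulrC.
rewrite sumrB -mulr_suml -/(pair A i x); congr (_ - _).
by rewrite (bigD1 k) //= eqxx mulr1 big1 ?addr0 // => j /negPf->; rewrite mulr0.
Qed.

Fact form_is_linear_r x : linear (form A d x : 'rV[rat]_r -> rat^o).
Proof.
move=> a y z; rewrite !formE scaler_sumr -big_split; apply: eq_bigr => i _ /=.
by rewrite pairD pairZ /GRing.scale /=; ring.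
Qed.
HB.instance Definition _ x :=
  GRing.isLinear.Build rat 'rV[rat]_r rat^o _ (form A d x : 'rV[rat]_r -> rat^o) (form_is_linear_r x).

Lemma formDr x y z : '[x, y + z] = '[x, y] + '[x, z].
Proof. exact: (raddfD (form A d x : 'rV[rat]_r -> rat^o)). Qed.
Lemma formBr x y z : '[x, y - z] = '[x, y] - '[x, z].
Proof. exact: (raddfB (form A d x : 'rV[rat]_r -> rat^o)). Qed.
Lemma formNr x y : '[x, - y] = - '[x, y].
Proof. exact: (raddfN (form A d x : 'rV[rat]_r -> rat^o)). Qed.
Lemma form0r x : '[x, 0] = 0.
Proof. exact: (raddf0 (form A d x : 'rV[rat]_r -> rat^o)). Qed.
Lemma formZr x a y : '[x, a *: y] = a * '[x, y].
Proof. exact: (linearZ_LR (form A d x : 'rV[rat]_r -> rat^o)). Qed.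
Lemma form_sumr x (I : Type) (t : seq I) (P : pred I) (F : I -> 'rV[rat]_r) :
  '[x, \sum_(i <- t | P i) F i] = \sum_(i <- t | P i) '[x, F i].
Proof. exact: (raddf_sum (form A d x : 'rV[rat]_r -> rat^o)). Qed.

Lemma form_al i x : '[al i, x] = d i * pair A i x.
Proof.
rewrite formE (bigD1 i) //= alE eqxx mul1r big1 ?addr0 // => j ji.
by rewrite alE (negPf ji) mul0r.
Qed.

Lemma word_cat s1 s2 : word (s1 ++ s2) = word s1 *m word s2.
Proof. by elim: s1 => [|i s1 IH] /=; rewrite ?mul1mx // IH mulmxA. Qed.

End Form.

Section Symmetric.
Variables (r : nat) (A : 'M[int]_r) (d : 'I_r -> rat).
Hypothesis symA : symmetrizes A d.
Hypothesis cartA : is_cartan_matrix A.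
Implicit Types (x y : 'rV[rat]_r) (i j : 'I_r) (s : seq 'I_r).
Local Notation "''[' x , y ]" := (form A d x y).
Local Notation al := (@simple_root r).
Local Notation word := (word_mx A).

Lemma d_gt0 i : 0 < d i. Proof. exact: symA.1. Qed.

Lemma Aii i : (A i i)%:~R = 2 :> rat. Proof. by rewrite cartA.1. Qed.

Lemma formC x y : '[x, y] = '[y, x].
Proof.
rewrite /form exchange_big; apply: eq_bigr => i _; apply: eq_bigr => j _ /=.
by rewrite -[_ * d j * _]mulrA symA.2; ring.
Qed.

Lemma formDl x y z : '[x + y, z] = '[x, z] + '[y, z].
Proof. by rewrite formC formDr !(formC z). Qed.
Lemma formBl x y z : '[x - y, z] = '[x, z] - '[y, z].
Proof. by rewrite formC formBr !(formC z). Qed.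
Lemma formNl x y : '[- x, y] = - '[x, y].
Proof. by rewrite formC formNr formC. Qed.
Lemma formZl a x y : '[a *: x, y] = a * '[x, y].
Proof. by rewrite formC formZr formC. Qed.

Lemma refl_invol i : refl A i *m refl A i = 1%:M.
Proof.
apply/row_matrixP => k; rewrite rowE mulmxA !rowE mulmx1 !reflE pairB pairZ pair_al Aii.
by apply/rowP => j; rewrite !mxE; ring.
Qed.

Lemma form_refl i x y : '[x *m refl A i, y *m refl A i] = '[x, y].
Proof.
rewrite !reflE formBl !formBr !formZl !formZr (formC x (al i)) !form_al pair_al Aii.
by ring.
Qed.

Lemma form_word s x y : '[x *m word s, y *m word s] = '[x, y].
Proof. by elim: s x y => [|i s IH] x y /=; rewrite ?mulmx1 // !mulmxA IH form_refl. Qed.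

Lemma word_rev s : word s *m word (rev s) = 1%:M.
Proof.
elim: s => [|i s IH]; first by rewrite mulmx1.
by rewrite rev_cons -cats1 word_cat mulmxA -[_ *m word (rev s)]mulmxA IH mulmx1 /= mulmx1 refl_invol.
Qed.

End Symmetric.

(** * Weyl group and roots *)

Section WeylGroup.
Variables (r : nat) (A : 'M[int]_r) (d : 'I_r -> rat) (Wl : seq 'M[rat]_r).
Hypothesis H : cartan_datum A d Wl.
Implicit Types (x y : 'rV[rat]_r) (i j : 'I_r) (s : seq 'I_r) (w u v : 'M[rat]_r).
Local Notation "''[' x , y ]" := (form A d x y).
Local Notation al := (@simple_root r).
Local Notation word := (word_mx A).
Local Notation sr := (refl A).
Let symA := datum_sym H.
Let cartA := datum_cartan H.

Lemma weylP w : reflect (exists s, w = word s) (w \in Wl).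
Proof. by apply: (iffP idP) => /(datum_weyl H).2. Qed.

Lemma weyl_uniq : uniq Wl. Proof. exact: (datum_weyl H).1. Qed.

Lemma weyl_word s : word s \in Wl. Proof. by apply/weylP; exists s. Qed.
Lemma weyl1 : 1%:M \in Wl. Proof. exact: (weyl_word [::]). Qed.
Lemma weyl_refl i : sr i \in Wl.
Proof. by have := weyl_word [:: i]; rewrite /= mulmx1. Qed.
Lemma weylM u v : u \in Wl -> v \in Wl -> u *m v \in Wl.
Proof. by move=> /weylP[s ->] /weylP[t ->]; rewrite -word_cat weyl_word. Qed.
Lemma weyl_unit w : w \in Wl -> w \in unitmx.
Proof. by move=> /weylP[s ->]; have /mulmx1_unit[] := word_rev cartA s. Qed.
Lemma weylV w : w \in Wl -> invmx w \in Wl.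
Proof.
move=> wW; have /weylP[s ws] := wW; rewrite (_ : invmx w = word (rev s)) ?weyl_word //.
by rewrite -[RHS]mul1mx -(mulVmx (weyl_unit wW)) -mulmxA ws word_rev // mulmx1.
Qed.

Lemma weyl_ind (P : 'M[rat]_r -> Prop) :
  P 1%:M -> (forall i w, w \in Wl -> P w -> P (sr i *m w)) ->
  forall w, w \in Wl -> P w.
Proof.
move=> P1 Ps w /weylP[s ->]; elim: s => //= i s IH.
by apply: Ps => //; apply: weyl_word.
Qed.

Lemma form_weyl w x y : w \in Wl -> '[x *m w, y *m w] = '[x, y].
Proof. by move=> /weylP[s ->]; apply: form_word. Qed.

Lemma form_weylV w x y : w \in Wl -> '[x *m w, y] = '[x, y *m invmx w].
Proof. by move=> wW; rewrite -(form_weyl _ _ (weylV wW)) mulmxK ?weyl_unit. Qed.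

Lemma perm_map_uniq (T : eqType) (f : T -> T) (l : seq T) :
  uniq l -> {in l &, injective f} -> {in l, forall a, f a \in l} -> perm_eq (map f l) l.
Proof.
move=> ul fi fl; have um: uniq (map f l) by rewrite map_inj_in_uniq.
have sub: {subset map f l <= l} by move=> _ /mapP[a /fl ? ->].
apply: uniq_perm => // a; have [] // := uniq_min_size um sub _.
by rewrite size_map.
Qed.

Lemma perm_weylMr u : u \in Wl -> perm_eq [seq w *m u | w <- Wl] Wl.
Proof.
move=> uW; apply: perm_map_uniq; [exact: weyl_uniq | | by move=> w wW; apply: weylM].
by move=> w v _ _ /(congr1 (mulmx^~ (invmx u))); rewrite !mulmxK ?weyl_unit.
Qed.

Lemma perm_weylMl u : u \in Wl -> perm_eq [seq u *m w | w <- Wl] Wl.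
Proof.
move=> uW; apply: perm_map_uniq; [exact: weyl_uniq | | by move=> w wW; apply: weylM].
by move=> w v _ _ /(congr1 (mulmx (invmx u))); rewrite !mulKmx ?weyl_unit.
Qed.

Lemma rootsP x : reflect (exists i, exists2 w, w \in Wl & x = al i *m w) (x \in roots Wl).
Proof.
rewrite mem_undup; apply: (iffP allpairsP).
  by case=> -[i w] [_ wW ->]; exists i, w.
by case=> i [w wW ->]; exists (i, w); rewrite mem_enum.
Qed.

Lemma roots_uniq : uniq (roots Wl). Proof. exact: undup_uniq. Qed.

Lemma root_al i : al i \in roots Wl.
Proof. by apply/rootsP; exists i, 1%:M; rewrite ?mulmx1 ?weyl1. Qed.

Lemma root_weyl w x : w \in Wl -> x \in roots Wl -> x *m w \in roots Wl.
Proof.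
move=> wW /rootsP[i [u uW ->]]; rewrite -mulmxA; apply/rootsP.
by exists i, (u *m w); rewrite ?weylM.
Qed.

Lemma root_refl i x : x \in roots Wl -> x *m sr i \in roots Wl.
Proof. exact/root_weyl/weyl_refl. Qed.

Lemma al_refl i : al i *m sr i = - al i.
Proof.
by rewrite reflE pair_al (Aii cartA); apply/rowP => j; rewrite !mxE; ring.
Qed.

Lemma rootN x : x \in roots Wl -> - x \in roots Wl.
Proof.
case/rootsP=> i [w wW ->]; rewrite -mulNmx -al_refl -mulmxA; apply/rootsP.
by exists i, (sr i *m w); rewrite ?weylM ?weyl_refl.
Qed.

Lemma perm_roots w : w \in Wl -> perm_eq [seq x *m w | x <- roots Wl] (roots Wl).
Proof.
move=> wW; apply: perm_map_uniq; first exact: roots_uniq.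
  by move=> x y _ _ /(congr1 (mulmx^~ (invmx w))); rewrite !mulmxK ?weyl_unit.
by move=> x; apply: root_weyl.
Qed.

Lemma root_ind (P : 'rV[rat]_r -> Prop) :
  (forall i, P (al i)) ->
  (forall x i, x \in roots Wl -> P x -> P (x *m sr i)) ->
  forall x, x \in roots Wl -> P x.
Proof.
move=> P1 Ps x /rootsP[i [w /weylP[s ->] ->]].
elim/last_ind: s => [|s j IH]; first by rewrite mulmx1.
rewrite -cats1 word_cat mulmxA /= mulmx1; apply: Ps => //.
by rewrite root_weyl ?weyl_word ?root_al.
Qed.

Lemma form_gt0 x : x != 0 -> 0 < '[x, x]. Proof. exact: (datum_pos H). Qed.

Lemma form_alal i : '[al i, al i] = 2 * d i.
Proof. by rewrite form_al pair_al (Aii cartA) mulrC. Qed.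

Lemma root_norm x : x \in roots Wl -> exists i, '[x, x] = 2 * d i.
Proof.
by case/rootsP=> i [w wW ->]; exists i; rewrite form_weyl ?form_alal.
Qed.

Lemma root_norm_gt0 x : x \in roots Wl -> 0 < '[x, x].
Proof. by case/root_norm=> i ->; rewrite mulr_gt0 // (d_gt0 symA). Qed.

Lemma root_neq0 x : x \in roots Wl -> x != 0.
Proof. by move=> /root_norm_gt0; apply: contraTneq => ->; rewrite form0r. Qed.

Lemma pair_int i x : (forall j, x 0 j \is a Num.int) -> pair A i x \is a Num.int.
Proof. by move=> xi; apply: rpred_sum => j _; rewrite rpredM // intr_int. Qed.

Lemma root_int x j : x \in roots Wl -> x 0 j \is a Num.int.
Proof.
move=> xR; move: x xR j; apply: root_ind => [i j|x i _ IH j].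
  by rewrite alE; case: eqP.
by rewrite reflE !mxE rpredB // rpredM ?pair_int // rpred_nat.
Qed.

(* The coordinates of the coroot 2x/(x,x) in the simple coroots are integers. *)
Lemma coroot_int x j : x \in roots Wl -> 2 * d j * x 0 j / '[x, x] \is a Num.int.
Proof.
move=> xR; move: x xR j; apply: root_ind => [i j|x i xR IH j].
  rewrite alE; have [->|] := eqVneq j i; last by rewrite mulr0 mul0r.
  by rewrite form_alal mulr1 divff ?rpred1 // mulf_neq0 ?gt_eqF // (d_gt0 symA).
rewrite form_refl // reflE !mxE.
have [->|] := eqVneq j i; last by rewrite mulr0 subr0 IH.
(* Coroot coordinates change under $s_i$ through the transposed Cartan matrix, so they stay
   integral. *)
have -> : 2 * d i * (x 0 i - pair A i x * 1) / '[x, x] =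
   2 * d i * x 0 i / '[x, x] - \sum_k (A k i)%:~R * (2 * d k * x 0 k / '[x, x]).
  rewrite mulr1 mulrBr mulrBl; congr (_ - _); rewrite mulrAC mulr_sumr.
  apply: eq_bigr => k _; rewrite mulrA (_ : _ * (A i k)%:~R = 2 / '[x,x] * (d k * (A k i)%:~R)) ?(symA.2 k i).2.
    by ring.
  by rewrite -(symA.2 i k); ring.
by rewrite rpredB // rpred_sum // => k _; rewrite rpredM // intr_int.
Qed.

(** In [root_sign] this isolates the diagonal, where [A i i = 2] makes the norms even. *)
Lemma sum_sym_even (F : 'I_r -> 'I_r -> rat) :
  (forall i j, F i j = F j i) ->
  \sum_i \sum_j F i j = \sum_i F i i + 2 * \sum_(i < r) \sum_(j < r | (j < i)%N) F i j.
Proof.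
move=> Fs; rewrite mulr_natl mulr2n.
have E : \sum_(i < r) \sum_(j < r | (j < i)%N) F i j = \sum_(i < r) \sum_(j < r | (i < j)%N) F i j.
  rewrite (exchange_big_dep xpredT) //=; apply: eq_bigr => i _.
  by apply: eq_bigr => j _; rewrite Fs.
rewrite {2}E -!big_split /=; apply: eq_bigr => i _.
rewrite (bigID (fun j : 'I_r => (j < i)%N)) /= [in RHS]addrCA; congr (_ + _).
rewrite (bigD1 i) ?ltnn //=; congr (_ + _).
by apply: eq_bigl => j; rewrite -leqNgt ltn_neqAle andbC eq_sym.
Qed.

(** Disjoint supports leave only off-diagonal Cartan entries, which are at most $0$. *)
Lemma form_disjoint_le0 x y : (forall i, 0 <= x 0 i) -> (forall i, 0 <= y 0 i) ->
  (forall i, x 0 i * y 0 i = 0) -> '[x, y] <= 0.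
Proof.
move=> x0 y0 xy; apply: sumr_le0 => i _; apply: sumr_le0 => j _.
have -> : x 0 i * d i * (A i j)%:~R * y 0 j = d i * (A i j)%:~R * (x 0 i * y 0 j) by ring.
have [->|ij] := eqVneq i j; first by rewrite xy mulr0.
rewrite mulr_le0_ge0 ?mulr_ge0 // pmulr_rle0 ?(d_gt0 symA) //.
by rewrite lerz0 cartA.2.1.
Qed.

(** Write $x=b^+-b^-$ with nonnegative vectors of disjoint supports, and $D=(x,x)/2$. Both parts lie
    in the lattice of $y$ with all $y_j$ and $d_jy_j/D$ integral. There $(y,y)/D$ is even, so
    $y\ne0$ gives $(y,y)\ge2D=(x,x)$. If neither part vanished,
    $(x,x)\ge(b^+,b^+)+(b^-,b^-)\ge2(x,x)$ would follow. *)
Lemma root_sign x : x \in roots Wl ->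
  (forall j, 0 <= x 0 j) \/ (forall j, x 0 j <= 0).
Proof.
move=> xR; pose D := '[x, x] / 2.
have D0 : 0 < D by rewrite divr_gt0 ?root_norm_gt0.
have DE : '[x, x] = 2 * D by rewrite mulrC divfK.
clearbody D.
pose bp : 'rV[rat]_r := \row_j Num.max (x 0 j) 0; pose bm := bp - x.
have bmE j : bm 0 j = Num.max (- x 0 j) 0.
  by rewrite !mxE; case: (lerP (x 0 j) 0); case: (lerP (- x 0 j) 0) => ? ?; lra.
have two (y : 'rV[rat]_r) : (forall j, y 0 j \is a Num.int) ->
    (forall j, d j * y 0 j / D \is a Num.int) -> y != 0 -> 2 * D <= '[y, y].
  move=> yi yD y0.
  suff [n E] : exists n : int, '[y, y] / D = 2 * n%:~R.
    rewrite -ler_pdivlMr // E ler_pMr // ler1z.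
    have : 0 < '[y, y] / D by rewrite divr_gt0 ?form_gt0.
    by rewrite E pmulr_rgt0 // ltr0z.
  suff: '[y, y] / D / 2 \is a Num.int.
    by move=> /intrP[n En]; exists n; rewrite -En mulrCA divff ?mulr1.
  have -> : '[y, y] / D = \sum_i \sum_j y 0 i * (d i * (A i j)%:~R) * y 0 j / D.
    rewrite mulr_suml; apply: eq_bigr => i _; rewrite mulr_suml.
    by apply: eq_bigr => j _; rewrite !mulrA.
  rewrite sum_sym_even => [|i j]; last by rewrite symA.2; ring.
  rewrite mulrDl [2 * _ / 2]mulrAC divff // mul1r.
  rewrite rpredD //; last first.
    apply: rpred_sum => i _; apply: rpred_sum => j _.
    rewrite (_ : _ / D = (A i j)%:~R * (d i * y 0 i / D) * y 0 j); last by ring.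
    by rewrite rpredM // rpredM // intr_int.
  rewrite mulr_suml rpred_sum // => i _.
  rewrite (Aii cartA) (_ : _ / 2 = y 0 i * (d i * y 0 i / D)); last first.
    by field; rewrite gt_eqF.
  by rewrite rpredM.
have [bp0|bpN0] := eqVneq bp 0.
  right=> j; have := congr1 (fun z : 'rV[rat]_r => z 0 j) bp0.
  by rewrite !mxE => <-; rewrite le_max lexx.
have [bm0|bmN0] := eqVneq bm 0.
  left=> j; have := congr1 (fun z : 'rV[rat]_r => z 0 j) bm0.
  by rewrite bmE mxE -[_ <= x 0 j]oppr_le0 => <-; rewrite le_max lexx.
have max_int (a : rat) : a \is a Num.int -> Num.max a 0 \is a Num.int.
  by case: (lerP a 0).
have max_mul (a c : rat) : 0 <= c -> c * Num.max a 0 = Num.max (c * a) 0.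
  by move=> c0; rewrite maxr_pMr // mulr0.
have xD j : d j * x 0 j / D \is a Num.int.
  rewrite (_ : _ / D = 2 * d j * x 0 j / '[x, x]) ?coroot_int // DE.
  by field; rewrite gt_eqF.
have dD j : 0 <= d j / D by rewrite ltW // divr_gt0 // (d_gt0 symA).
have Ep : 2 * D <= '[bp, bp].
  apply: two => // j; rewrite mxE; first by rewrite max_int ?root_int.
  by rewrite mulrAC max_mul // max_int // mulrAC.
have Em : 2 * D <= '[bm, bm].
  apply: two => // j; rewrite bmE; first by rewrite max_int ?rpredN ?root_int.
  by rewrite mulrAC max_mul // max_int // mulrN rpredN mulrAC.
have pm : '[bp, bm] <= 0.
  apply: form_disjoint_le0 => j; rewrite ?bmE ?mxE ?le_max ?lexx ?orbT //.
  by case: (lerP (x 0 j) 0); case: (lerP (- x 0 j) 0) => ? ?; rewrite ?mul0r ?mulr0 //; lra.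
have Ex : x = bp - bm by rewrite opprB addrC subrK.
clearbody bm bp.
have : '[x, x] = '[bp, bp] - 2 * '[bp, bm] + '[bm, bm].
  by rewrite Ex !(formBl symA) !formBr (formC symA bm bp); ring.
rewrite DE; lra.
Qed.

End WeylGroup.

(** * Positive roots *)

Section PositiveRoots.
Variables (r : nat) (A : 'M[int]_r) (d : 'I_r -> rat) (Wl : seq 'M[rat]_r).
Hypothesis H : cartan_datum A d Wl.
Implicit Types (x y : 'rV[rat]_r) (i j : 'I_r) (s : seq 'I_r) (w u v : 'M[rat]_r).
Local Notation "''[' x , y ]" := (form A d x y).
Local Notation al := (@simple_root r).
Local Notation word := (word_mx A).
Local Notation sr := (refl A).
Local Notation P := (pos_roots Wl).
Let symA := datum_sym H.
Let cartA := datum_cartan H.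

Lemma mem_pos x : (x \in P) = (x \in roots Wl) && [forall j, 0 <= x 0 j].
Proof. by rewrite mem_filter andbC. Qed.

Lemma pos_root x : x \in P -> x \in roots Wl.
Proof. by rewrite mem_pos => /andP[]. Qed.

Lemma pos_ge0 x j : x \in P -> 0 <= x 0 j.
Proof. by rewrite mem_pos => /andP[_ /forallP]. Qed.

Lemma pos_uniq : uniq P. Proof. exact/filter_uniq/roots_uniq. Qed.

Lemma pos_al i : al i \in P.
Proof.
rewrite mem_pos (root_al H); apply/forallP => j; rewrite alE; exact: ler0n.
Qed.

Lemma posN_F x : x \in P -> (- x \in P) = false.
Proof.
move=> xP; apply/negP => xN; have /negP[] := root_neq0 H (pos_root xP).
apply/eqP/rowP => j; rewrite !mxE; apply/eqP; rewrite eq_le pos_ge0 // andbT.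
by have := pos_ge0 j xN; rewrite mxE oppr_ge0.
Qed.

Lemma rootNpos x : x \in roots Wl -> (x \notin P) = (- x \in P).
Proof.
move=> xR; apply/idP/idP => [xP|xN]; last by apply: contraTN xN => /posN_F->.
rewrite mem_pos (rootN H) //=; apply/forallP => j; rewrite mxE oppr_ge0.
have [x0|//] := root_sign H xR.
by case/negP: xP; rewrite mem_pos xR; apply/forallP.
Qed.

Lemma coord_pos x j : x \in roots Wl -> 0 < x 0 j -> x \in P.
Proof.
move=> xR xj; apply: contraTT xj; rewrite rootNpos // => xN.
by have := pos_ge0 j xN; rewrite mxE oppr_ge0 -leNgt.
Qed.

Lemma int_inv (c : rat) : c \is a Num.int -> c^-1 \is a Num.int -> c != 0 -> c = 1 \/ c = -1.
Proof.
move=> ci vi c0.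
have ge1 (a : rat) : a \is a Num.int -> a != 0 -> 1 <= `|a|.
  move=> /intrP[m ->]; rewrite -intr_norm intr_eq0 => m0.
  by rewrite ler1z -gtz0_ge1 normr_gt0.
have a1 := ge1 _ ci c0; have a2 : 1 <= `|c^-1| by rewrite ge1 ?invr_eq0.
have : `|c| == 1.
  by rewrite eq_le a1 andbT -[1]divr1 -(@invf_ge1 _ `|c|) ?normr_gt0 // -normfV.
by rewrite eqr_norml => /andP[/orP[] /eqP ->]; [left | right].
Qed.

(** The $i$-th coordinate of $x$ is $c$ and that of its coroot is $c^{-1}$; both are integers. *)
Lemma root_al_mul x i c : x \in roots Wl -> x = c *: al i -> x = al i \/ x = - al i.
Proof.
move=> xR xE; have c0 : c != 0.
  by apply: contraTneq (root_neq0 H xR) => c0; rewrite xE c0 scale0r eqxx.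
have xi : x 0 i = c by rewrite xE mxE alE eqxx mulr1.
have [] // := @int_inv c; first by rewrite -xi (root_int H).
  have := coroot_int H i xR; rewrite xi xE formZr (formZl symA) (form_alal H).
  by rewrite (_ : _ / _ = c^-1) //; field; rewrite c0 gt_eqF // (d_gt0 symA).
- by rewrite xE => ->; left; rewrite scale1r.
- by rewrite xE => ->; right; rewrite scaleN1r.
Qed.

Lemma pos_refl x i : x \in P -> x != al i -> x *m sr i \in P.
Proof.
move=> xP xi; have xR := pos_root xP.
have [/existsP[j /andP[ji xj]]|N] := boolP [exists j, (j != i) && (0 < x 0 j)].
  apply: (@coord_pos _ j); first exact: (root_refl H).
  by rewrite reflE !mxE (negPf ji) mulr0 subr0.
have xE : x = x 0 i *: al i.
  apply/rowP => j; rewrite !mxE; have [->|ji] := eqVneq j i; first by rewrite mulr1.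
  rewrite mulr0; apply/eqP; rewrite eq_le pos_ge0 // andbT leNgt.
  by apply: contra N => xj; apply/existsP; exists j; rewrite ji.
have [E|E] := root_al_mul xR xE; first by rewrite E eqxx in xi.
by have := posN_F xP; rewrite E opprK pos_al.
Qed.

Lemma al_refl_pos i : al i *m sr i \notin P.
Proof. by rewrite (al_refl H) posN_F ?pos_al. Qed.

Lemma pos_big_al (T : Type) (idx : T) (op : Monoid.com_law idx) (F : 'rV_r -> T) i :
  \big[op/idx]_(x <- P) F x = op (F (al i)) (\big[op/idx]_(x <- rem (al i) P) F x).
Proof. by rewrite (perm_big _ (perm_to_rem (pos_al i))) big_cons. Qed.

(** $s_i$ permutes the positive roots other than $\alpha_i$. Sums and products over the positive
    roots ($\rho$, inversion counts, denominators) are transformed by this rule. *)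
Lemma pos_big_refl (T : Type) (idx : T) (op : Monoid.com_law idx) (F : 'rV_r -> T) i :
  \big[op/idx]_(x <- P) F (x *m sr i) =
  op (F (- al i)) (\big[op/idx]_(x <- rem (al i) P) F x).
Proof.
rewrite (pos_big_al _ _ i) (al_refl H); congr (op _ _).
rewrite -(big_map (fun x => x *m sr i) xpredT); apply: perm_big.
have memP x : x \in rem (al i) P = (x != al i) && (x \in P).
  by rewrite mem_rem_uniq ?pos_uniq // inE.
apply: perm_map_uniq; first by rewrite rem_uniq ?pos_uniq.
  by move=> x y _ _ /(congr1 (mulmx^~ (sr i))); rewrite -!mulmxA !(refl_invol cartA) !mulmx1.
move=> x; rewrite !memP => /andP[xi xP]; rewrite pos_refl // andbT.
apply: contraTneq xP => /(congr1 (mulmx^~ (sr i))).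
rewrite -mulmxA (refl_invol cartA) mulmx1 => ->; exact: al_refl_pos.
Qed.

Definition inv_count (B : seq 'rV[rat]_r) w : nat := count (fun x => x *m w \notin P) B.
Local Notation N := (inv_count P).

Lemma inv_countE w : N w = (\sum_(x <- P) (x *m w \notin P))%N.
Proof. by rewrite /inv_count -sum1_count big_mkcond. Qed.

Lemma inv_count_refl i w : w \in Wl ->
  N (sr i *m w) = if al i *m w \in P then (N w).+1 else (N w).-1.
Proof.
move=> wW; rewrite !inv_countE.
have -> : (\sum_(x <- P) (x *m (sr i *m w) \notin P) =
    (- (al i *m w) \notin P) + \sum_(x <- rem (al i) P) (x *m w \notin P))%N.
  rewrite -mulNmx -(pos_big_refl _ (fun x => (x *m w \notin P) : nat)).
  by apply: eq_bigr => x _; rewrite mulmxA.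
rewrite (pos_big_al _ (fun x => (x *m w \notin P) : nat) i) /=.
have R : al i *m w \in roots Wl by rewrite (root_weyl H) ?(root_al H).
rewrite rootNpos ?(rootN H) // opprK; case: ifP => [->//|/negbT E].
by rewrite E.
Qed.

Lemma inv_count1 : N 1%:M = 0%N.
Proof.
rewrite inv_countE big1_seq // => x /andP[_ xP].
by rewrite mulmx1 xP.
Qed.

Lemma odd_inv_refl i w : w \in Wl -> odd (N (sr i *m w)) = ~~ odd (N w).
Proof.
move=> wW; rewrite inv_count_refl //; case: ifP => // E.
suff : (0 < N w)%N by case: (N w) => //= n _; rewrite negbK.
by rewrite -has_count; apply/hasP; exists (al i); rewrite ?pos_al ?E.
Qed.

Lemma odd_inv_word s : odd (N (word s)) = odd (size s).
Proof. by elim: s => [|i s IH] /=; rewrite ?inv_count1 // odd_inv_refl ?(weyl_word H) ?IH. Qed.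

Lemma leastP (Q : pred nat) n : Q n -> Q (least Q).
Proof.
move=> Qn; rewrite /least.
case: ClassicalEpsilon.excluded_middle_informative => [ex|]; last by case; exists n.
by case: ex_minnP.
Qed.

Lemma least_min (Q : pred nat) n : Q n -> (least Q <= n)%N.
Proof.
move=> Qn; rewrite /least.
case: ClassicalEpsilon.excluded_middle_informative => [ex|]; last by case; exists n.
by case: ex_minnP => m _; apply.
Qed.

(** The sign is read off the inversion number, which changes by one under $s_i$; [sgnE] matches it
    with the length by the parity of any word, so no reduced word is needed. *)
Definition eps w : int := (-1) ^+ N w.

Lemma sgnE w : w \in Wl -> sgn A w = (eps w)%:P.
Proof.
move=> /(weylP H)[s ws]; rewrite /sgn /eps rmorphXn rmorphN1.
rewrite -signr_odd -[RHS]signr_odd; congr (_ ^+ nat_of_bool _).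
have : [exists t : (wlength A w).-tuple 'I_r, word t == w].
  apply: (@leastP (fun n => [exists t : n.-tuple 'I_r, word t == w]) (size s)).
  by apply/existsP; exists (in_tuple s); rewrite ws.
by move=> /existsP[t /eqP {2}<-]; rewrite odd_inv_word size_tuple.
Qed.

Lemma eps1 : eps 1%:M = 1. Proof. by rewrite /eps inv_count1. Qed.

Lemma eps_refl i w : w \in Wl -> eps (sr i *m w) = - eps w.
Proof.
by move=> wW; rewrite /eps -signr_odd odd_inv_refl // signrN signr_odd.
Qed.

Lemma epsM u v : u \in Wl -> v \in Wl -> eps (u *m v) = eps u * eps v.
Proof.
move=> uW vW; move: u uW; apply: (weyl_ind H) => [|i u uW IH]; first by rewrite mul1mx eps1 mul1r.
by rewrite -mulmxA !eps_refl ?(weylM H) // IH mulNr.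
Qed.

Lemma eps_sr i : eps (sr i) = -1.
Proof. by rewrite -[sr i]mulmx1 eps_refl ?(weyl1 H) // eps1. Qed.

Lemma eps_reflr i w : w \in Wl -> eps (w *m sr i) = - eps w.
Proof. by move=> wW; rewrite epsM ?(weyl_refl H) // eps_sr mulrN1. Qed.

Lemma eps_sqr w : eps w * eps w = 1.
Proof. by rewrite /eps -expr2 sqrr_sign. Qed.

(** $w^{-1}s_iw$ is the reflection in the root $\alpha_iw$. *)
Lemma refl_conj i w x : w \in Wl ->
  x *m (sr i *m w) =
  x *m w - (2 * '[x *m w, al i *m w] / '[al i *m w, al i *m w]) *: (al i *m w).
Proof.
move=> wW; rewrite !(form_weyl H) // mulmxA reflE mulmxBl -scalemxAl.
congr (_ - _ *: _); rewrite (formC symA) form_al (form_alal H); field.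
by rewrite gt_eqF // (d_gt0 symA).
Qed.

(** Read along [s], the root $\alpha_i$ turns negative at some letter $j$; just before, it equals
    $\alpha_j$, so $s_i$ moves through the prefix as $s_j$ and cancels that letter. *)
Lemma exchange i s : al i *m word s \notin P ->
  exists2 t, (size t <= size s)%N & word (i :: s) = word t.
Proof.
elim/last_ind: s => [|s j IH]; first by rewrite mulmx1 pos_al.
rewrite -cats1 -cat_cons !word_cat /= !mulmx1 mulmxA => N1.
have [aP|/IH[t ts E]] := boolP (al i *m word s \in P); last first.
  exists (t ++ [:: j]); first by rewrite !size_cat leq_add2r.
  by rewrite word_cat -E /= mulmx1.
have E : al i *m word s = al j.
  by apply: contraNeq N1; apply: pos_refl.
exists s; first by rewrite size_cat leq_addr.
have C : sr i *m word s = word s *m sr j.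
  apply/row_matrixP => k; rewrite !rowE refl_conj ?(weyl_word H) // E mulmxA reflE.
  congr (_ - _ *: _); rewrite (formC symA) form_al (form_alal H); field.
  by rewrite gt_eqF // (d_gt0 symA).
by rewrite C -mulmxA (refl_invol cartA) mulmx1.
Qed.

(** In a word with first letter $i$ the other letters make $\alpha_i$ negative, so [exchange]
    shortens the word. *)
Lemma weyl_pos_id w : w \in Wl -> (forall x, x \in P -> x *m w \in P) -> w = 1%:M.
Proof.
move=> /(weylP H)[s]; have [n] := ubnP (size s); elim: n s w => // n IH [|i s] w //= ns -> wP.
have [|t ts E] := @exchange i s.
  have := wP _ (pos_al i); rewrite /= mulmxA (al_refl H) mulNmx.
  by rewrite -rootNpos // (root_weyl H) ?(weyl_word H) ?(root_al H).
by apply: (IH t) => //; apply: leq_ltn_trans ts _.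
Qed.

(** The product keeps positive roots positive. With $u=v$ this says that the longest element is an
    involution; with two expressions, that it is unique. *)
Lemma weyl_neg_uniq u v : u \in Wl -> v \in Wl ->
  (forall x, x \in P -> x *m u \notin P) -> (forall x, x \in P -> x *m v \notin P) ->
  u *m v = 1%:M.
Proof.
move=> uW vW uN vN; apply: weyl_pos_id; first exact: (weylM H).
move=> x xP; have xuR : x *m u \in roots Wl by rewrite (root_weyl H) ?pos_root.
have := uN x xP; rewrite rootNpos // => /vN; rewrite mulNmx.
by rewrite rootNpos ?opprK ?mulmxA // (rootN H) // (root_weyl H).
Qed.

Lemma simple_neg w : w \in Wl -> (forall i, al i *m w \notin P) ->
  forall x, x \in P -> x *m w \notin P.
Proof.
move=> wW wN x xP; have xR := pos_root xP.
rewrite rootNpos ?(root_weyl H) // mem_pos (rootN H) ?(root_weyl H) //=.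
have {1}-> : - (x *m w) = \sum_i x 0 i *: - (al i *m w).
  rewrite {1}(row_sum_delta x) mulmx_suml -sumrN; apply: eq_bigr => i _.
  rewrite -scalemxAl scalerN; congr (- (_ *: (_ *m _))).
  by apply/rowP => j; rewrite !mxE.
apply/forallP => j; rewrite summxE sumr_ge0 // => i _; rewrite mxE mulr_ge0 ?pos_ge0 //.
by rewrite -rootNpos ?(root_weyl H) ?(root_al H).
Qed.

(** An odd equivariant [f] covers both the roots and the coroots. *)
Lemma sum_pos_refl (f : 'rV[rat]_r -> 'rV[rat]_r) i :
  (forall x, x \in roots Wl -> f (x *m sr i) = f x *m sr i) -> (forall x, f (- x) = - f x) ->
  (\sum_(x <- P) f x) *m sr i = \sum_(x <- P) f x - 2 *: f (al i).
Proof.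
move=> fs fN; rewrite mulmx_suml.
rewrite (eq_big_seq (fun x => f (x *m sr i))) => [|x /pos_root/fs//].
rewrite (@pos_big_refl _ _ _ f) [in RHS](pos_big_al _ _ i) /= fN.
by apply/rowP => j; rewrite !mxE; ring.
Qed.

Lemma rho_refl i : rho Wl *m sr i = rho Wl - al i.
Proof.
rewrite /rho -scalemxAl (@sum_pos_refl id) // scalerBr scalerA mulVf //.
by rewrite scale1r.
Qed.

Lemma pair_rho i : pair A i (rho Wl) = 1.
Proof.
have := rho_refl i; rewrite reflE => /addrI/oppr_inj/rowP/(_ i).
by rewrite !mxE eqxx mulr1.
Qed.

Definition coroot x : 'rV[rat]_r := (2 / '[x, x]) *: x.
(** Coroots are identified with vectors through the form, so that pairing with [rhov] is the height
    ([form_rhov]). *)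
Definition rhov : 'rV[rat]_r := 2^-1 *: \sum_(x <- P) coroot x.

Lemma coroot_weyl x w : w \in Wl -> coroot (x *m w) = coroot x *m w.
Proof. by move=> wW; rewrite /coroot (form_weyl H) // scalemxAl. Qed.

Lemma corootN x : coroot (- x) = - coroot x.
Proof. by rewrite /coroot (formNl symA) formNr opprK scalerN. Qed.

Lemma coroot_al i : coroot (al i) = (d i)^-1 *: al i.
Proof.
rewrite /coroot (form_alal H); congr (_ *: _); field.
by rewrite gt_eqF // (d_gt0 symA).
Qed.

Lemma rhov_refl i : rhov *m sr i = rhov - coroot (al i).
Proof.
rewrite /rhov -scalemxAl (@sum_pos_refl coroot); last exact: corootN.
  by rewrite scalerBr scalerA mulVf // scale1r.
by move=> x xR; rewrite coroot_weyl ?(weyl_refl H).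
Qed.

Lemma form_al_rhov i : '[al i, rhov] = 1.
Proof.
have := rhov_refl i; rewrite reflE coroot_al => /addrI/oppr_inj/rowP/(_ i).
rewrite !mxE eqxx !mulr1 form_al => ->; rewrite divff // gt_eqF //; exact: d_gt0 symA i.
Qed.

Lemma vec_al x : x = \sum_i x 0 i *: al i.
Proof.
apply/rowP => j; rewrite summxE (bigD1 j) //= !mxE eqxx mulr1 big1 ?addr0 // => i ij.
by rewrite !mxE eq_sym (negPf ij) mulr0.
Qed.

Lemma form_rhov x : '[rhov, x] = ht x.
Proof.
rewrite {1}(vec_al x) form_sumr; apply: eq_bigr => i _.
by rewrite formZr (formC symA) form_al_rhov mulr1.
Qed.

Lemma form_al_rho i : '[al i, rho Wl] = d i.
Proof. by rewrite form_al pair_rho mulr1. Qed.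

Lemma pos_form_gt0 x y : (forall i, 0 < '[al i, y]) -> x \in P -> 0 < '[x, y].
Proof.
move=> y0 xP; have := root_neq0 H (pos_root xP).
apply: contraR; rewrite -leNgt => xy; apply/eqP/rowP => i; rewrite mxE.
have xyE : '[x, y] = \sum_i x 0 i * '[al i, y].
  by rewrite formE; apply: eq_bigr => k _; rewrite form_al.
move: xy; rewrite xyE => xy.
have ge0 k : 0 <= x 0 k * '[al k, y] by rewrite mulr_ge0 ?pos_ge0 ?ltW.
have /eqP : \sum_i x 0 i * '[al i, y] = 0.
  by apply/eqP; rewrite eq_le xy sumr_ge0.
rewrite psumr_eq0 // => /allP/(_ i (mem_index_enum i))/=.
by rewrite mulf_eq0 (gt_eqF (y0 i)) orbF => /eqP.
Qed.

Lemma rho_pos_gt0 x : x \in P -> 0 < '[x, rho Wl].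
Proof. by apply: pos_form_gt0 => i; rewrite form_al_rho (d_gt0 symA). Qed.

Lemma ht_pos_gt0 x : x \in P -> 0 < ht x.
Proof.
move=> xP; rewrite -form_rhov (formC symA); apply: pos_form_gt0 xP => i.
by rewrite form_al_rhov.
Qed.

Lemma seq_max (T : eqType) (l : seq T) (f : T -> rat) t0 : t0 \in l ->
  exists2 t, t \in l & forall t', t' \in l -> f t' <= f t.
Proof.
elim: l t0 => // a [_|b l IH] t0 tl.
  by exists a; rewrite ?mem_head // => t'; rewrite inE => /eqP->.
have [t tbl tmax] := IH b (mem_head _ _).
have [le|lt] := leP (f a) (f t).
  exists t; first by rewrite inE tbl orbT.
  by move=> t'; rewrite inE => /orP[/eqP->|/tmax].
exists a; first exact: mem_head.
move=> t'; rewrite inE => /orP[/eqP->|/tmax tm] //.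
exact: le_trans tm (ltW lt).
Qed.

(** Take $w$ maximizing the height of $xw$ over the finite list [Wl]: a negative pairing with
    $\alpha_i$ would let $s_i$ raise it. *)
Lemma dominant_conj x : exists2 w, w \in Wl & forall i, 0 <= '[al i, x *m w].
Proof.
have [w wW wmax] := @seq_max _ Wl (fun w => ht (x *m w)) _ (weyl1 H).
exists w => // i; have := wmax _ (weylM H wW (weyl_refl H i)).
rewrite mulmxA reflE -!form_rhov formBr formZr (formC symA rhov (al i)) form_al_rhov.
by rewrite form_al mulr1 gerBl => E; rewrite mulr_ge0 // ltW // (d_gt0 symA).
Qed.

Lemma rho_stab w : w \in Wl -> rho Wl *m w = rho Wl -> w = 1%:M.
Proof.
move=> wW wr; apply: weyl_pos_id => // x xP.
apply: contraTT (rho_pos_gt0 xP).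
have xR : x *m w \in roots Wl by apply: (root_weyl H) => //; apply: pos_root.
rewrite rootNpos //.
move=> /rho_pos_gt0; rewrite -{1}wr (formNl symA) (form_weyl H) // oppr_gt0 => /ltW.
by rewrite leNgt.
Qed.

End PositiveRoots.

(** * Short roots *)

Section ShortRoots.
Variables (r : nat) (A : 'M[int]_r) (d : 'I_r -> rat) (Wl : seq 'M[rat]_r).
Hypothesis H : cartan_datum A d Wl.
Implicit Types (x y : 'rV[rat]_r) (i j : 'I_r) (s : seq 'I_r) (w u v : 'M[rat]_r).
Local Notation "''[' x , y ]" := (form A d x y).
Local Notation al := (@simple_root r).
Local Notation sr := (refl A).
Local Notation P := (pos_roots Wl).
Local Notation SR := (short_roots A Wl d).
Let symA := datum_sym H.
Let cartA := datum_cartan H.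

Lemma shortP x : reflect (x \in roots Wl /\ forall y, y \in roots Wl -> '[x, x] <= '[y, y])
  (x \in SR).
Proof.
rewrite mem_filter; apply: (iffP andP) => [[/allP ? ?]//|[? ?]].
by split=> //; apply/allP.
Qed.

Lemma short_root x : x \in SR -> x \in roots Wl.
Proof. by case/shortP. Qed.

Lemma short_weyl x w : w \in Wl -> x \in SR -> x *m w \in SR.
Proof.
move=> wW /shortP[xR xm]; apply/shortP; split; first exact: (root_weyl H).
by move=> y /xm; rewrite (form_weyl H).
Qed.

Lemma shortN x : x \in SR -> - x \in SR.
Proof.
move=> /shortP[xR xm]; apply/shortP; split; first exact: (rootN H).
by move=> y /xm; rewrite (formNl symA) formNr opprK.
Qed.

Lemma short_uniq : uniq SR. Proof. exact/filter_uniq/roots_uniq. Qed.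

Lemma perm_short w : w \in Wl -> perm_eq [seq x *m w | x <- SR] SR.
Proof.
move=> wW; apply: perm_map_uniq; first exact: short_uniq.
  by move=> x y _ _ /(congr1 (mulmx^~ (invmx w))); rewrite !mulmxK ?(weyl_unit H).
by move=> x; apply: short_weyl.
Qed.

Lemma perm_shortN : perm_eq [seq - x | x <- SR] SR.
Proof.
apply: perm_map_uniq; first exact: short_uniq; last exact: shortN.
by move=> x y _ _; apply: oppr_inj.
Qed.

Lemma short_norm x y : x \in SR -> y \in SR -> '[x, x] = '[y, y].
Proof.
move=> /shortP[xR xm] /shortP[yR ym]; apply/eqP.
by rewrite eq_le xm // ym.
Qed.

Lemma root_pair_int x y : x \in roots Wl -> (forall j, y 0 j \is a Num.int) ->
  2 * '[y, x] / '[x, x] \is a Num.int.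
Proof.
move=> xR yi; rewrite (formC symA) {1}formE mulr_sumr mulr_suml rpred_sum // => i _.
rewrite (_ : _ / _ = (2 * d i * x 0 i / '[x, x]) * pair A i y); last by ring.
by rewrite rpredM ?(coroot_int H) // pair_int.
Qed.

Lemma root_mul x y c : x \in roots Wl -> y \in roots Wl -> x = c *: y -> x = y \/ x = - y.
Proof.
move=> xR /rootsP[i [w wW ->]] E.
have [] := @root_al_mul _ _ _ _ H (x *m invmx w) i c.
- by rewrite (root_weyl H) ?(weylV H).
- by rewrite E -scalemxAl mulmxK ?(weyl_unit H).
- by move=> <-; left; rewrite mulmxKV ?(weyl_unit H).
- by move=> E'; right; rewrite -mulNmx -E' mulmxKV ?(weyl_unit H).
Qed.

Lemma root_reflection x : x \in roots Wl -> exists2 w, w \in Wl &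
  forall y, y *m w = y - (2 * '[y, x] / '[x, x]) *: x.
Proof.
move=> /rootsP[i [u uW ->]]; exists (invmx u *m (sr i *m u)).
  by rewrite !(weylM H) ?(weylV H) ?(weyl_refl H).
by move=> y; rewrite mulmxA (refl_conj H) // mulmxKV ?(weyl_unit H).
Qed.

(** Cauchy-Schwarz is strict because $x$ and $y$ are not proportional, and $(x,x)\le(y,y)$ because
    $x$ is short. *)
Lemma short_pair_lt2 x y : x \in SR -> y \in roots Wl -> x != y -> x != - y ->
  `|2 * '[x, y] / '[y, y]| < 2.
Proof.
move=> xS yR xy xNy; have xR := short_root xS.
have y0 := root_norm_gt0 H yR.
have : 0 < '[x - ('[x, y] / '[y, y]) *: y, x - ('[x, y] / '[y, y]) *: y].
  apply: (form_gt0 H); apply: contraNneq xNy => /subr0_eq/root_mul[]// E.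
    by rewrite E eqxx in xy.
  by rewrite E.
rewrite (formBl symA) !formBr !(formZl symA) !formZr (formC symA y x).
have -> : '[x, x] - '[x, y] / '[y, y] * '[x, y] -
   ('[x, y] / '[y, y] * '[x, y] - '[x, y] / '[y, y] * ('[x, y] / '[y, y] * '[y, y])) =
   '[x, x] - '[x, y] ^+ 2 / '[y, y] by field; rewrite gt_eqF.
rewrite subr_gt0 ltr_pdivrMr // => cs.
have xyn : '[x, x] <= '[y, y] by case/shortP: xS => _; apply.
have : '[x, y] ^+ 2 < '[y, y] ^+ 2.
  by apply: lt_le_trans cs _; rewrite expr2 ler_pM2r.
rewrite normrM normfV (gtr0_norm y0) ltr_pdivrMr // normrM normr_nat ltr_pM2l //.
rewrite -real_normK ?num_real // ltr_pXn2r // nnegrE ?normr_ge0 //; exact: ltW.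
Qed.

Lemma pairE i x : pair A i x = 2 * '[x, al i] / '[al i, al i].
Proof.
rewrite (formC symA) form_al (form_alal H); field.
by rewrite gt_eqF // (d_gt0 symA).
Qed.

Lemma int_lt2 (a : rat) : a \is a Num.int -> `|a| < 2 -> [\/ a = 0, a = 1 | a = -1].
Proof.
move=> /intrP[m ->]; rewrite -intr_norm (ltr_int _ _ 2) => m2.
have : m = 0 \/ m = 1 \/ m = -1 by lia.
by case=> [->|[->|->]]; [constructor 1 | constructor 2 | constructor 3].
Qed.

Lemma form_al_lt0 i x : ('[al i, x] < 0) = (pair A i x < 0).
Proof. by rewrite form_al pmulr_rlt0 // (d_gt0 symA). Qed.

Lemma short_step x i : x \in SR -> pair A i x < 0 -> x != - al i ->
  pair A i x = -1 /\ x *m sr i = x + al i.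
Proof.
move=> xS x0 xi; have xR := short_root xS.
have xi' : x != al i by apply: contraTneq x0 => ->; rewrite pair_al (Aii cartA).
have := short_pair_lt2 xS (root_al H i) xi' xi; rewrite -pairE => /int_lt2[].
- by apply: pair_int => j; apply: (root_int H).
- by move=> E; rewrite E in x0.
- by move=> E; rewrite E in x0.
- by move=> E; rewrite reflE E scaleN1r opprK.
Qed.

Lemma step_pos x i : x \in roots Wl -> x != al i -> x != - al i ->
  (x *m sr i \in P) = (x \in P).
Proof.
move=> xR xi xNi; apply/idP/idP => xP; last exact: (pos_refl H).
rewrite -[x]mulmx1 -(refl_invol cartA i) mulmxA (pos_refl H) //.
apply: contra_neq xNi => /(congr1 (mulmx^~ (sr i))).
by rewrite -mulmxA (refl_invol cartA) mulmx1 (al_refl H).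
Qed.

Lemma dom_form_ge0 x y : (forall i, 0 <= pair A i y) -> (forall j, 0 <= x 0 j) -> 0 <= '[x, y].
Proof.
move=> y0 x0; rewrite formE sumr_ge0 // => i _.
by rewrite !mulr_ge0 // ltW // (d_gt0 symA).
Qed.

Lemma dom_root_pos x : x \in roots Wl -> (forall i, 0 <= pair A i x) -> x \in P.
Proof.
move=> xR x0; apply: contraTT (root_norm_gt0 H xR); rewrite (rootNpos H) // => xP.
rewrite -leNgt -oppr_ge0 -(formNl symA); apply: dom_form_ge0 => // j; exact: (pos_ge0 j xP).
Qed.

(** If the support were a proper subset, indecomposability would give an edge from it to some $k$
    outside, and the pairing with $\alpha_k^\vee$ would be negative. *)
Lemma dom_root_coord x j : x \in roots Wl -> (forall i, 0 <= pair A i x) -> 0 < x 0 j.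
Proof.
move=> xR x0; have xP := dom_root_pos xR x0.
pose S := [set k | 0 < x 0 k].
have S0 : S != set0.
  apply: contraTneq (root_neq0 H xR) => E; rewrite negbK; apply/eqP/rowP => k.
  apply/eqP; rewrite mxE eq_le (pos_ge0 _ xP) andbT leNgt.
  by have := in_set0 k; rewrite -E inE => ->.
have [ST|ST] := eqVneq S setT.
  by have := in_setT j; rewrite -ST inE.
have [i [k [iS kS ik]]] := datum_indec H S0 ST.
have : pair A k x < 0.
  rewrite /pair (bigD1 i) //= ltr_wnDr //.
    apply: sumr_le0 => m mi; have [->|mk] := eqVneq m k.
      by move: kS; rewrite inE -leNgt => k0; rewrite (Aii cartA) pmulr_rle0.
    by rewrite mulr_le0_ge0 ?(pos_ge0 _ xP) // lerz0 cartA.2.1 // eq_sym.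
  rewrite nmulr_rlt0; first by move: iS; rewrite inE.
  rewrite ltrz0 lt_neqAle -cartA.2.2 ik cartA.2.1 //.
  by apply: contraNneq kS => ->.
by rewrite ltNge x0.
Qed.

Lemma dom_short_form x y : x \in roots Wl -> y \in roots Wl ->
  (forall i, 0 <= pair A i x) -> (forall i, 0 <= pair A i y) -> 0 < '[x, y].
Proof.
move=> xR yR x0 y0; rewrite lt_neqAle dom_form_ge0 // ?andbT => [|j]; last first.
  by rewrite ltW // dom_root_coord.
rewrite eq_sym formE psumr_eq0 => [|i _]; last first.
  by rewrite !mulr_ge0 // ltW ?(d_gt0 symA) // dom_root_coord.
apply/negP => /allP Z; have := root_norm_gt0 H yR; rewrite formE big1 ?ltxx // => i _.
have /(_ i (mem_index_enum i)) := Z; rewrite /= !mulf_eq0.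
rewrite (gt_eqF (dom_root_coord i xR x0)) (gt_eqF (d_gt0 symA i)) /= => /eqP->.
by rewrite !mulr0.
Qed.

Section Theta.
Variable th : 'rV[rat]_r.
Hypothesis thS : th \in SR.
Hypothesis thd : dominant A th.

Lemma th_dom i : 0 <= pair A i th. Proof. exact: (forallP thd). Qed.

Lemma th_pos : th \in P.
Proof. exact/(dom_root_pos (short_root thS))/th_dom. Qed.

(** Two dominant roots are never orthogonal, so distinct dominant short roots would have Cartan
    integer $1$ and $x-\theta_s$ would be a root. Were it positive, its product with $\theta_s$
    would be at least $0$, yet it is $-(\theta_s,\theta_s)/2$; its negative fails against $x$ in the
    same way. *)
Lemma dom_short_th x : x \in SR -> (forall i, 0 <= pair A i x) -> x = th.
Proof.
move=> xS x0; apply/eqP; apply/negPn/negP => xth.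
have [xR thR] := (short_root xS, short_root thS).
have xt := dom_short_form xR thR x0 th_dom.
have nn := short_norm xS thS; have n0 := root_norm_gt0 H thR.
have xNth : x != - th.
  by apply: contraTneq xt => ->; rewrite (formNl symA) oppr_gt0 -leNgt ltW.
have := short_pair_lt2 xS thR xth xNth => /int_lt2[].
- by apply: root_pair_int => // j; apply: (root_int H).
- by move=> /eqP; rewrite !mulf_eq0 invr_eq0 (gt_eqF xt) (gt_eqF n0).
- move=> E; have [w wW wE] := root_reflection thR.
  have : x - th \in roots Wl by rewrite -[th in _ - th]scale1r -E -wE (root_weyl H).
  have half : '[x, th] = '[th, th] / 2.
    rewrite -[RHS]mul1r -[X in X * _]E; field.
    by rewrite gt_eqF.
  move=> R; have [Q|] := boolP (x - th \in P).
    have := dom_form_ge0 th_dom (fun j => pos_ge0 j Q); rewrite (formBl symA) half; lra.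
  rewrite (rootNpos H) // opprB => Q.
  have := dom_form_ge0 x0 (fun j => pos_ge0 j Q); rewrite (formBl symA) (formC symA th) half nn; lra.
- have : 0 < 2 * '[x, th] / '[th, th] by rewrite divr_gt0 // mulr_gt0.
  by move=> + E; rewrite E.
Qed.

Lemma short_le_th x : x \in SR -> (forall j, 0 <= (x - th) 0 j) -> x = th.
Proof.
move=> xS /(dom_form_ge0 th_dom); rewrite (formBl symA) => E.
apply/eqP; rewrite -subr_eq0; apply: contraTT E => /(form_gt0 H).
rewrite (formBl symA) !formBr (short_norm xS thS) (formC symA th x); lra.
Qed.

(** Each reflection at a negative pairing lowers it by one ([depth_refl]), so it counts the steps
    from $x$ up to the dominant short root. *)
Definition depth x : nat := count (fun y => '[y, x] < 0) P.

Lemma depth_refl x i : pair A i x < 0 -> depth x = (depth (x *m sr i)).+1.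
Proof.
move=> x0; rewrite /depth -!sum1_count big_mkcond [in RHS]big_mkcond /=.
rewrite (pos_big_al H _ _ i) /= form_al_lt0 x0 add1n; congr _.+1.
have form_srr y : '[y, x *m sr i] = '[y *m sr i, x].
  by rewrite -(form_refl symA cartA i) -mulmxA (refl_invol cartA) mulmx1.
under [RHS]eq_bigr => y _ do rewrite form_srr.
rewrite (pos_big_refl H _ (fun y => if '[y, x] < 0 then 1%N else 0%N)) /=.
by rewrite (formNl symA) oppr_lt0 ltNge ltW ?form_al_lt0.
Qed.

Lemma short_ind (Q : 'rV[rat]_r -> Prop) : Q th ->
  (forall x i, x \in SR -> pair A i x < 0 -> Q (x *m sr i) -> Q x) ->
  forall x, x \in SR -> Q x.
Proof.
move=> Qt Qs x xS; have [n] := ubnP (depth x); elim: n x xS => // n IH x xS xn.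
have [/existsP[i xi]|N] := boolP [exists i, pair A i x < 0].
  apply: (Qs _ i) => //; apply: IH; first by rewrite short_weyl ?(weyl_refl H).
  by rewrite (depth_refl xi) in xn.
rewrite (dom_short_th xS) // => i; rewrite leNgt; apply: contra N => xi.
by apply/existsP; exists i.
Qed.

(** Climbing proceeds by height one and keeps the sign, except for the single jump from $-\alpha_i$
    to $\alpha_i$ over the weight $0$. *)
Lemma short_cases x i : x \in SR -> pair A i x < 0 ->
  x = - al i \/ [/\ x != - al i, pair A i x = -1, x *m sr i = x + al i & (x *m sr i \in P) = (x \in P)].
Proof.
move=> xS x0; have [->|xi] := eqVneq x (- al i); [by left|right].
have [E1 E2] := short_step xS x0 xi; split=> //; apply: step_pos => //.
  exact: short_root.
by apply: contraTneq x0 => ->; rewrite pair_al (Aii cartA).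
Qed.

Lemma htD x y : ht (x + y) = ht x + ht y.
Proof. by rewrite /ht -big_split; apply: eq_bigr => i _; rewrite mxE. Qed.
Lemma htN x : ht (- x) = - ht x.
Proof. by rewrite /ht -sumrN; apply: eq_bigr => i _; rewrite mxE. Qed.
Lemma ht_al i : ht (al i) = 1.
Proof.
by rewrite /ht (bigD1 i) //= alE eqxx big1 ?addr0 // => j /negPf ji; rewrite alE ji.
Qed.

(** The correction for negative $x$ accounts for the jump over $0$, which gains height two in one
    step. *)
Lemma depthE x : x \in SR -> (depth x)%:R = ht th - ht x - (x \notin P)%:R.
Proof.
apply: (@short_ind (fun x => (depth x)%:R = ht th - ht x - (x \notin P)%:R)).
  rewrite th_pos subrr subr0 /depth (_ : count _ _ = 0%N) //.
  apply/eqP; rewrite -leqn0 leqNgt -has_count; apply/hasPn => y yP.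
  by rewrite -leNgt (dom_form_ge0 th_dom) // => j; apply: (pos_ge0 j yP).
move=> {}x i xS x0; rewrite (depth_refl x0) -natr1 => ->.
have [->|[_ _ E ->]] := short_cases xS x0.
  by rewrite mulNmx (al_refl H) opprK htN ht_al (pos_al H) (posN_F H) ?(pos_al H) //=; ring.
by rewrite E htD ht_al; ring.
Qed.

End Theta.
End ShortRoots.

(** * Alternating sums *)

Section Alternants.
Variables (r : nat) (A : 'M[int]_r) (d : 'I_r -> rat) (Wl : seq 'M[rat]_r).
Hypothesis H : cartan_datum A d Wl.
Implicit Types (x y : 'rV[rat]_r) (i j : 'I_r) (s : seq 'I_r) (w u v : 'M[rat]_r).
Local Notation al := (@simple_root r).
Local Notation sr := (refl A).
Local Notation P := (pos_roots Wl).
Local Notation SR := (short_roots A Wl d).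
Local Notation eps := (eps Wl).
Let cartA := datum_cartan H.

(** [G] and its target ring are left free: partition functions and exponentials are both
    antisymmetrized. *)
Definition alternant (R : pzRingType) (G : 'rV[rat]_r -> R) x : R :=
  \sum_(w <- Wl) (eps w)%:~R * G (x *m w).

Lemma eq_alternant (R : pzRingType) (G1 G2 : 'rV[rat]_r -> R) x :
  G1 =1 G2 -> alternant G1 x = alternant G2 x.
Proof. by move=> E; apply: eq_bigr => w _; rewrite E. Qed.

Lemma alternant_weyl (R : pzRingType) (G : 'rV[rat]_r -> R) x u : u \in Wl ->
  alternant G (x *m u) = (eps u)%:~R * alternant G x.
Proof.
move=> uW; rewrite {2}/alternant -(perm_big _ (perm_weylMl H uW)) big_map mulr_sumr.
apply: eq_big_seq => w wW; rewrite mulrA (epsM H) // -intrM mulrA eps_sqr mul1r.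
by rewrite mulmxA.
Qed.

Lemma alternant_refl (R : pzRingType) (G : 'rV[rat]_r -> R) x i :
  alternant G (x *m sr i) = - alternant G x.
Proof. by rewrite alternant_weyl ?(weyl_refl H) // (eps_sr H) rmorphN1 mulN1r. Qed.

Lemma alternant_reflr (R : pzRingType) (G : 'rV[rat]_r -> R) x i :
  alternant (fun y => G (y *m sr i)) x = - alternant G x.
Proof.
rewrite {2}/alternant -(perm_big _ (perm_weylMr H (weyl_refl H i))) big_map -sumrN.
apply: eq_big_seq => w wW; rewrite (eps_reflr H) // rmorphN mulNr opprK.
by rewrite mulmxA.
Qed.

Lemma self_opp0 (R : idomainType) (a : R) : 2%:R != 0 :> R -> a = - a -> a = 0.
Proof.
move=> two0 E; have : 2%:R * a = 0 by rewrite mulr_natl mulr2n {2}E subrr.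
by move/eqP; rewrite mulf_eq0 (negPf two0) => /eqP.
Qed.

Lemma al_inj : injective al.
Proof.
move=> i j /rowP/(_ i); rewrite !alE eqxx.
by case: eqP => // _ /eqP; rewrite oner_eq0.
Qed.

(* Only [x = th] and the negatives of the simple short roots contribute:
   every other [rho + x] is fixed by a simple reflection. *)
Lemma alternant_short (R : idomainType) (G : 'rV[rat]_r -> R) th :
  2%:R != 0 :> R -> th \in SR -> dominant A th ->
  alternant G (rho Wl + th) =
  (n_short_simple A Wl d)%:R * alternant G (rho Wl) +
  \sum_(w <- Wl) (eps w)%:~R * \sum_(x <- SR) G (rho Wl *m w + x).
Proof.
move=> two0 thS thd; set al0 := alternant G (rho Wl); set al1 := alternant G _.
(* Each $w$ permutes the short roots, so $x$ may be replaced by $xw$ before the sums are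
   exchanged. *)
have -> : \sum_(w <- Wl) (eps w)%:~R * (\sum_(x <- SR) G (rho Wl *m w + x)) =
    \sum_(x <- SR) alternant G (rho Wl + x).
  rewrite exchange_big /=; apply: eq_big_seq => w wW.
  rewrite -mulr_sumr -(perm_big _ (perm_short H wW)) big_map.
  by congr (_ * _); apply: eq_bigr => x _; rewrite mulmxDl.
have alE x : x \in SR -> alternant G (rho Wl + x) =
    (x == th)%:R * al1 - (\sum_i (x == - al i)%:R) * al0.
  move=> xS; have [/existsP[i xi]|N] := boolP [exists i, pair A i x < 0]; last first.
    have xth : x = th.
      apply: (dom_short_th H thS) => // i; rewrite leNgt; apply: contra N => xi.
      by apply/existsP; exists i.
    rewrite xth eqxx mul1r big1 ?mul0r ?subr0 // => i _.
    by case: eqP (th_pos H thS thd) => // ->; rewrite (posN_F H) ?(pos_al H).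
  have -> : (x == th) = false.
    by apply: contraTF xi => /eqP ->; rewrite -leNgt; apply: th_dom.
  rewrite mul0r sub0r; have [->|[xNi x1 xE _]] := short_cases H xS xi.
    rewrite (bigD1 i) //= eqxx big1 ?addr0 ?mul1r => [|j ji].
      by rewrite -(rho_refl H) alternant_refl.
    by rewrite eqr_opp (inj_eq al_inj) eq_sym (negPf ji).
  rewrite big1 ?mul0r ?oppr0 => [|j _].
    apply: self_opp0 => //; rewrite -(alternant_refl _ _ i) mulmxDl (rho_refl H) xE.
    by rewrite addrACA addNr addr0.
  case: eqP => // xj; case/negP: xNi; rewrite xj; apply/eqP; congr (- al _).
  apply/eqP; apply: contraTT xi => ji; rewrite xj -leNgt pairN pair_al oppr_ge0 lerz0.
  by rewrite cartA.2.1 // eq_sym.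
rewrite (eq_big_seq _ alE) sumrB -!mulr_suml.
have count_eq z : z \in SR -> \sum_(x <- SR) (x == z)%:R = 1 :> R.
  move=> zS; rewrite (bigD1_seq z) ?short_uniq //= eqxx big1 ?addr0 // => x.
  by move/negPf->.
rewrite count_eq // mul1r exchange_big /= (_ : \sum_i _ = (n_short_simple A Wl d)%:R) //.
  by rewrite addrCA addrN addr0.
rewrite /n_short_simple -sum1_card natr_sum [RHS]big_mkcond /=; apply: eq_bigr => i _.
rewrite inE; case: ifP => aS; first by rewrite count_eq // (shortN H).
rewrite big1_seq // => x /andP[_ xS]; case: eqP => // E.
by move: aS; rewrite -[al i]opprK -E (shortN H).
Qed.

(* Vectors [rho - sum of a set of positive roots], encoded by choosing one root
   out of each pair [{x, -x}]; in this form the Weyl group permutes them. *)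
Definition half_sum (f : 'rV[rat]_r -> 'rV[rat]_r) (c : pred 'rV[rat]_r) :=
  2^-1 *: \sum_(x <- roots Wl | c x) f x.

Definition root_choice (c : pred 'rV[rat]_r) := {in roots Wl, forall x, c (- x) = ~~ c x}.

Lemma half_sum_weyl f c w : w \in Wl ->
  (forall x, x \in roots Wl -> f (x *m w) = f x *m w) ->
  half_sum f c *m w = half_sum f (fun x => c (x *m invmx w)).
Proof.
move=> wW fw; rewrite /half_sum -scalemxAl mulmx_suml; congr (_ *: _).
rewrite -[RHS](perm_big _ (perm_roots H wW)) big_map /= [RHS]big_mkcond [LHS]big_mkcond /=.
by apply: eq_big_seq => x xR; rewrite mulmxK ?(weyl_unit H) // fw.
Qed.

Lemma root_choice_weyl c w : w \in Wl -> root_choice c ->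
  root_choice (fun x => c (x *m invmx w)).
Proof.
by move=> wW cc x xR; rewrite /= mulNmx cc // (root_weyl H) ?(weylV H).
Qed.

Lemma big_roots_pos (T : Type) (idx : T) (op : Monoid.com_law idx) (F : 'rV_r -> T) :
  \big[op/idx]_(x <- roots Wl) F x = \big[op/idx]_(x <- P) op (F x) (F (- x)).
Proof.
rewrite big_split /= -(big_map -%R xpredT) -big_cat; apply: perm_big.
apply: uniq_perm; first exact: roots_uniq.
  rewrite cat_uniq (pos_uniq Wl) map_inj_uniq ?(pos_uniq Wl) ?andbT; last exact: oppr_inj.
  by apply/hasPn => _ /mapP[x xP ->]; rewrite (posN_F H).
move=> x; rewrite mem_cat; apply/idP/orP => [xR|].
  have [|] := boolP (x \in P); first by left.
  rewrite (rootNpos H) // => xN; right; apply/mapP; exists (- x) => //.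
  by rewrite opprK.
case=> [/pos_root//|/mapP[y /pos_root yR ->]]; exact: (rootN H).
Qed.

Lemma root_choice_pos : root_choice (mem P).
Proof. by move=> x xR /=; rewrite -(rootNpos H). Qed.

Lemma half_sum_pos f : (forall x, f (- x) = - f x) ->
  half_sum f (mem P) = 2^-1 *: \sum_(x <- P) f x.
Proof.
move=> fN; rewrite /half_sum big_mkcond big_roots_pos /=; congr (_ *: _).
by apply: eq_big_seq => x xP; rewrite xP (posN_F H) ?addr0.
Qed.

(** Replacing a positive root by its negative changes the half sum by a full $f(x)$. *)
Lemma half_sum_sub f c : root_choice c -> (forall x, f (- x) = - f x) ->
  half_sum f c = half_sum f (mem P) - \sum_(x <- P | ~~ c x) f x.
Proof.
move=> cc fN; rewrite half_sum_pos // /half_sum big_mkcond big_roots_pos.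
rewrite [X in _ - X]big_mkcond /= -[X in _ - X]scale1r -[1](@mulVf _ 2%:R) // -scalerA -scalerBr.
congr (_ *: _); rewrite scaler_sumr -sumrB; apply: eq_big_seq => x /pos_root xR.
by rewrite cc // fN; case: (c x) => /=; rewrite ?scaler0 ?subr0 ?addr0 // scaler_nat mulr2n opprD addrA subrr !add0r.
Qed.

Lemma rho_half_sum : rho Wl = half_sum id (mem P).
Proof. by rewrite half_sum_pos. Qed.

Lemma rhov_half_sum : rhov A d Wl = half_sum (coroot A d) (mem P).
Proof. by rewrite half_sum_pos // => x; apply: (corootN H). Qed.

(** $\rho w$ is the half sum of another choice of roots, hence $\rho$ minus a sum of positive
    roots. *)
Lemma rho_weyl_sub w : w \in Wl -> forall j, 0 <= (rho Wl - rho Wl *m w) 0 j.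
Proof.
move=> wW j; rewrite {2}rho_half_sum half_sum_weyl //.
rewrite half_sum_sub //; last exact: (root_choice_weyl wW root_choice_pos).
rewrite -rho_half_sum opprB addrC subrK summxE big_seq_cond sumr_ge0 // => x /andP[xP _].
exact: (pos_ge0 j xP).
Qed.

End Alternants.

(** * Kostant's partition function *)

Section Partition.
Variables (r : nat) (A : 'M[int]_r) (d : 'I_r -> rat) (Wl : seq 'M[rat]_r).
Hypothesis H : cartan_datum A d Wl.
Implicit Types (x y : 'rV[rat]_r) (i j : 'I_r) (w u v : 'M[rat]_r).
Local Notation al := (@simple_root r).
Local Notation sr := (refl A).
Local Notation P := (pos_roots Wl).
Let cartA := datum_cartan H.
Local Notation n := (size P).

Definition kost_sum (N : nat) (k : {ffun 'I_n -> 'I_N.+1}) : 'rV[rat]_r :=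
  \sum_(a < n) P`_a *+ k a.

(** [Pq] bounds the multiplicities by the height of its argument; a common bound [N] makes different
    arguments comparable, and [Q] serves to exclude a simple root. *)
Definition kost (N : nat) (Q : pred {ffun 'I_n -> 'I_N.+1}) x : {poly int} :=
  \sum_(k : {ffun 'I_n -> 'I_N.+1} | (kost_sum k == x) && Q k) 'X^(\sum_(a < n) k a).

Lemma pos_nth (a : 'I_n) : P`_a \in P. Proof. exact: mem_nth. Qed.

Lemma ht_int x : x \in roots Wl -> ht x \is a Num.int.
Proof. by move=> xR; apply: rpred_sum => j _; apply: (root_int H). Qed.

Lemma ht_pos_ge1 x : x \in P -> 1 <= ht x.
Proof.
move=> xP; have := ht_pos_gt0 H xP; have /intrP[m ->] := ht_int (pos_root xP).
by rewrite ltr0z ler1z gtz0_ge1.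
Qed.

Lemma ht0 : ht (0 : 'rV[rat]_r) = 0.
Proof. by rewrite /ht big1 // => j _; rewrite mxE. Qed.

Lemma ht_kost_sum N (k : {ffun 'I_n -> 'I_N.+1}) :
  ht (kost_sum k) = \sum_(a < n) ht P`_a * (k a)%:R.
Proof.
rewrite /kost_sum (big_morph _ (@htD r) ht0); apply: eq_bigr => a _.
by rewrite mulr_natr; elim: (nat_of_ord (k a)) => [|m IH]; rewrite ?ht0 // !mulrS htD IH.
Qed.

Lemma kost_bound N (k : {ffun 'I_n -> 'I_N.+1}) a : (k a)%:R <= ht (kost_sum k).
Proof.
rewrite ht_kost_sum (bigD1 a) //= -[leLHS]addr0 lerD //.
  by rewrite ler_peMl ?ht_pos_ge1 ?pos_nth.
by rewrite sumr_ge0 // => b _; rewrite mulr_ge0 // ltW // (ht_pos_gt0 H) ?pos_nth.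
Qed.

Lemma kost_sum_Qplus N (k : {ffun 'I_n -> 'I_N.+1}) : in_Qplus (kost_sum k).
Proof.
apply/forallP => j; rewrite summxE rpred_sum // => a _; rewrite mulmxnE rpredMn //.
by rewrite natrEint (root_int H) ?pos_root ?pos_nth // (pos_ge0 j (pos_nth a)).
Qed.

Lemma Pq_kost N x : ht x <= N%:R -> Pq Wl x = kost (N := N) predT x.
Proof.
move=> xN; rewrite /Pq /kost; case: ifPn => [xQ|xQ]; last first.
  by rewrite big1 // => k /andP[/eqP kx _]; case/negP: xQ; rewrite -kx kost_sum_Qplus.
set M := Num.truncn (ht x).
have htx : 0 <= ht x by apply: sumr_ge0 => j _; apply/natr_ge0/(forallP xQ).
have MN : (M <= N)%N by rewrite -(ler_nat rat); apply: le_trans xN; rewrite truncn_le.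
pose f (k : {ffun 'I_n -> 'I_M.+1}) : {ffun 'I_n -> 'I_N.+1} := [ffun a => inord (k a)].
pose g (k : {ffun 'I_n -> 'I_N.+1}) : {ffun 'I_n -> 'I_M.+1} := [ffun a => inord (k a)].
have fE k a : f k a = k a :> nat.
  by rewrite ffunE inordK // ltnS (leq_trans _ MN) // -ltnS.
rewrite (reindex_onto f g) /= => [|k /andP[/eqP kx _]]; last first.
  apply/ffunP => a; apply/val_inj; rewrite /= fE ffunE inordK //.
  by rewrite ltnS /M truncn_ge_nat // -kx kost_bound.
apply: eq_big => [k|k _]; last by congr ('X^_); apply: eq_bigr => a _; rewrite fE.
rewrite andbT (_ : g (f k) == k) ?andbT; last first.
  by apply/eqP/ffunP => a; apply/val_inj; rewrite ffunE /= fE inord_val.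
by congr (_ == x); apply: eq_bigr => a _; rewrite fE.
Qed.

Section Simple.
Variable i : 'I_r.

Lemma index_al_lt : (index (al i) P < n)%N. Proof. by rewrite index_mem (pos_al H). Qed.
Let a0 : 'I_n := Ordinal index_al_lt.
Let P_a0 : P`_a0 = al i. Proof. by rewrite nth_index ?(pos_al H). Qed.

Lemma kost_rec N x : ht x <= N%:R ->
  kost (N := N) predT x = kost (N := N) (fun k => val (k a0) == 0%N) x
     + 'X * kost (N := N) predT (x - al i).
Proof.
move=> xN; rewrite /kost (bigID (fun k : {ffun 'I_n -> 'I_N.+1} => val (k a0) == 0%N)) /=.
congr (_ + _); first by apply: eq_bigl => k; rewrite andbT.
pose f (k : {ffun 'I_n -> 'I_N.+1}) : {ffun 'I_n -> 'I_N.+1} :=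
  [ffun a => inord (k a + (a == a0))].
pose g (k : {ffun 'I_n -> 'I_N.+1}) : {ffun 'I_n -> 'I_N.+1} :=
  [ffun a => inord (k a - (a == a0))].
rewrite (reindex_onto f g) /= => [|k /andP[_ k0]]; last first.
    have gE a : g k a = (k a - (a == a0))%N :> nat.
    by rewrite ffunE inordK // (leq_ltn_trans (leq_subr _ _)).
  apply/ffunP => a; apply/val_inj; rewrite ffunE /= gE.
  by rewrite subnK ?inordK //; case: eqP => // ->; rewrite lt0n.
rewrite mulr_sumr.
have fE (k : {ffun 'I_n -> 'I_N.+1}) a : (k a0 < N)%N -> f k a = (k a + (a == a0))%N :> nat.
  move=> k0; rewrite ffunE inordK //; case: eqP => [->|_]; first by rewrite addn1 ltnS.
  by rewrite addn0.
have fsum (k : {ffun 'I_n -> 'I_N.+1}) : (k a0 < N)%N -> kost_sum (f k) = kost_sum k + al i.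
  move=> k0; rewrite /kost_sum; under eq_bigr => a _ do rewrite fE // mulrnDr.
  rewrite big_split /=; congr (_ + _); rewrite (bigD1 a0) //= eqxx P_a0 big1 ?addr0 // => a.
  by move/negPf->; rewrite mulr0n.
rewrite big_mkcond [RHS]big_mkcond /=; apply: eq_bigr => k _.
have [k0|k0] := ltnP (k a0) N; last first.
  (* Here $k(a_0)=N$ and [inord] sends the overflow $N+1$ to $0$, so the left term is absent; the
     right one is absent because the height of $x-\alpha_i$ is at most $N-1$. *)
  have -> : f k a0 = 0 :> nat.
    rewrite ffunE eqxx addn1 /inord /insubd insubF //.
    by apply/negbTE; rewrite -leqNgt ltnS.
  rewrite eqxx !andbF /= andbT; case: (kost_sum k =P x - al i) => // kx.
  exfalso; have := kost_bound k a0; rewrite kx htD htN ht_al => kb.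
  have : (N%:R : rat) <= (k a0)%:R by rewrite ler_nat.
  move: xN kb; lra.
rewrite !andbT fsum // fE // eqxx addn1 /= andbT (_ : g (f k) == k); last first.
  by apply/eqP/ffunP => a; apply/val_inj; rewrite ffunE /= fE // addnK inord_val.
rewrite andbT eq_sym -subr_eq eq_sym.
case: ifP => // _; rewrite -exprS; congr ('X^_).
rewrite (bigD1 a0) //= fE // eqxx addn1 addSn [in RHS](bigD1 a0) //=; congr (_ + _).+1%N.
by apply: eq_bigr => a /negPf aa; rewrite fE // aa addn0.
Qed.

(** Coefficient after multiplication by $1-qe^{\alpha_i}$, which deletes the factor of $\alpha_i$
    from the product. *)
Definition without_al (x : 'rV[rat]_r) : {poly int} := Pq Wl x - 'X * Pq Wl (x - al i).

Lemma kost_without N x : ht x <= N%:R ->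
  without_al x = kost (N := N) (fun k => val (k a0) == 0%N) x.
Proof.
move=> xN; have xaN : ht (x - al i) <= N%:R.
  by rewrite htD htN ht_al; move: xN; lra.
by rewrite /without_al (Pq_kost xN) (Pq_kost xaN) (kost_rec xN) addrK.
Qed.

(** The permutation of positive roots induced by $s_i$, with the index of $\alpha_i$ held fixed. *)
Let sig (a : 'I_n) : 'I_n := if a == a0 then a0 else insubd a0 (index (P`_a *m sr i) P).

Let P_inj (a b : 'I_n) : P`_a = P`_b -> a = b.
Proof.
move=> E; apply/val_inj/eqP.
by rewrite /= -(nth_uniq 0 (ltn_ord a) (ltn_ord b) (pos_uniq Wl)) E.
Qed.

Let sig_a0 : sig a0 = a0. Proof. by rewrite /sig eqxx. Qed.

Let sig_nth a : a != a0 -> P`_(sig a) = P`_a *m sr i.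
Proof.
move=> aa; have sP : P`_a *m sr i \in P.
  apply: (pos_refl H); first exact: pos_nth.
  by apply: contra_neq aa; rewrite -P_a0; apply: P_inj.
by rewrite /sig (negPf aa) val_insubd index_mem sP nth_index.
Qed.

Let sigK : involutive sig.
Proof.
move=> a; have [->|aa] := eqVneq a a0; first by rewrite !sig_a0.
have sa : sig a != a0.
  apply: contraTneq (pos_nth a) => /(congr1 (fun b : 'I_n => P`_b *m sr i)).
  rewrite sig_nth // -mulmxA (refl_invol cartA) mulmx1 P_a0 => ->.
  exact: (al_refl_pos H).
by apply: P_inj; rewrite sig_nth // sig_nth // -mulmxA (refl_invol cartA) mulmx1.
Qed.

Lemma without_al_refl x : without_al (x *m sr i) = without_al x.
Proof.
have [N xN xsN] : exists2 N, ht x <= N%:R & ht (x *m sr i) <= N%:R.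
  have le_bound (a : rat) : a <= (Num.bound `|a|)%:R.
    by apply: le_trans (ler_norm a) _; apply/ltW/archi_boundP.
  exists (Num.bound `|ht x| + Num.bound `|ht (x *m sr i)|)%N; rewrite natrD.
    by rewrite -[ht x]addr0 lerD // addr0.
  by rewrite -[ht (x *m _)]add0r lerD // add0r.
rewrite (kost_without xN) (kost_without xsN) /kost.
pose h (k : {ffun 'I_n -> 'I_N.+1}) : {ffun 'I_n -> 'I_N.+1} := [ffun a => k (sig a)].
have hK : involutive h by move=> k; apply/ffunP => a; rewrite !ffunE sigK.
rewrite (reindex_inj (inv_inj hK)) /=.
have sumh (F : 'I_n -> nat) : (\sum_a F (sig a) = \sum_a F a)%N.
  by rewrite [RHS](reindex_inj (inv_inj sigK)).
apply: eq_big => [k|k _]; last first.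
  by rewrite -(sumh (fun a => k a : nat)); congr ('X^_); apply: eq_bigr => a _; rewrite ffunE.
rewrite ffunE sig_a0; have [k0|] := eqVneq (val (k a0)) 0%N; rewrite ?andbF ?andbT //.
rewrite -[RHS](inj_eq (can_inj (mulmxK (weyl_unit H (weyl_refl H i))))); congr (_ == _).
rewrite /kost_sum mulmx_suml (reindex_inj (inv_inj sigK)) /=; apply: eq_bigr => a _.
rewrite ffunE sigK.
have [->|aa] := eqVneq a a0; first by rewrite k0 !mulr0n mul0mx.
by rewrite sig_nth // -!scaler_nat scalemxAl.
Qed.

End Simple.
End Partition.

(** * The q-analogue on short roots *)

Section QAnalogue.
Variables (r : nat) (A : 'M[int]_r) (d : 'I_r -> rat) (Wl : seq 'M[rat]_r).
Hypothesis H : cartan_datum A d Wl.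
Implicit Types (x y lam mu : 'rV[rat]_r) (i j : 'I_r) (w u v : 'M[rat]_r).
Local Notation al := (@simple_root r).
Local Notation sr := (refl A).
Local Notation P := (pos_roots Wl).
Local Notation SR := (short_roots A Wl d).
Local Notation m_ := (mq A Wl).

Lemma polyint_two : 2%:R != 0 :> {poly int}.
Proof. by rewrite -(rmorph_nat polyC) polyC_eq0. Qed.

Lemma mq_alternant lam mu :
  m_ lam mu = alternant Wl (fun y => Pq Wl (y - (mu + rho Wl))) (lam + rho Wl).
Proof.
apply: eq_big_seq => w wW; rewrite (sgnE H) //.
by rewrite -{1}[eps Wl w]intz rmorph_int.
Qed.

(** Each side is an alternant of the $s_i$-invariant [without_al]. Reflecting its argument costs a
    sign, and $\rho s_i=\rho-\alpha_i$ turns $\mu$ into $\mu s_i-\alpha_i$. *)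
Lemma mq_refl lam mu i :
  m_ lam mu - 'X * m_ lam (mu + al i) =
  - (m_ lam (mu *m sr i - al i) - 'X * m_ lam (mu *m sr i)).
Proof.
have E nu : m_ lam nu - 'X * m_ lam (nu + al i) =
    alternant Wl (fun y => without_al Wl i (y - (nu + rho Wl))) (lam + rho Wl).
  rewrite !mq_alternant /alternant mulr_sumr -sumrB; apply: eq_bigr => w _.
  rewrite /without_al mulrBr mulrCA; congr (_ - _ * (_ * Pq _ _)).
  by rewrite [nu + _ + _]addrAC opprD addrA.
rewrite E -{2}[mu *m sr i](subrK (al i)) E -(alternant_reflr H _ _ i).
apply: eq_alternant => y; rewrite -(without_al_refl H); congr without_al.
by rewrite mulmxBl mulmxDl (rho_refl H) addrA [_ - al i + _]addrAC.
Qed.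

(** For this pairing $\mu s_i-\alpha_i=\mu$, so the expression in [mq_refl] is its own negative. *)
Lemma mq_step lam x i : pair A i x = -1 -> m_ lam x = 'X * m_ lam (x *m sr i).
Proof.
move=> x1; have xs : x *m sr i = x + al i by rewrite reflE x1 scaleN1r opprK.
apply/eqP; rewrite -subr_eq0; apply/eqP/(self_opp0 polyint_two).
by have := mq_refl lam x i; rewrite !xs addrK.
Qed.

Lemma mq_Nal lam i : m_ lam (- al i) = 'X * m_ lam (al i) + ('X - 1) * m_ lam 0.
Proof.
have := mq_refl lam (- al i) i; rewrite mulNmx (al_refl H) opprK addNr subrr => /eqP.
by rewrite subr_eq => /eqP ->; ring.
Qed.

Lemma Pq0 : Pq Wl 0 = 1.
Proof.
rewrite (Pq_kost H (N := 0)) ?ht0 // /kost (big_pred1 [ffun=> ord0]) => [|k].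
  by rewrite big1 // => a _; rewrite ffunE.
rewrite andbT; have -> : k = [ffun=> ord0] by apply/ffunP => a; rewrite ffunE ord1.
by rewrite /= !eqxx /kost_sum big1 ?eqxx // => a _; rewrite ffunE.
Qed.

(** $\rho w-\rho$ has no positive coordinate, so subtracting $\mu$ leaves $Q_+$. *)
Lemma mq0_eq0 mu j : 0 < mu 0 j -> m_ 0 mu = 0.
Proof.
move=> mj; rewrite /mq big1_seq // => w /andP[_ wW].
rewrite add0r /Pq ifF ?mulr0 //; apply/negP => /forallP/(_ j)/natr_ge0.
rewrite leNgt => /negP; apply; have := rho_weyl_sub H wW j.
by rewrite !mxE; move: mj; lra.
Qed.

Lemma mq00 : m_ 0 0 = 1.
Proof.
rewrite /mq (bigD1_seq 1%:M) ?(weyl1 H) ?(weyl_uniq H) //=.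
rewrite !add0r mulmx1 subrr Pq0 (sgnE H) ?(weyl1 H) // eps1 mulr1.
rewrite big1_seq ?addr0 // => w /andP[w1 wW]; rewrite /Pq ifF ?mulr0 //.
apply/negP => /forallP Q; case/negP: w1; apply/eqP/(rho_stab H) => //.
apply/rowP => j; apply/eqP; rewrite eq_le.
have := natr_ge0 (Q j); have := rho_weyl_sub H wW j; rewrite !mxE => a b.
by apply/andP; split; lra.
Qed.

Lemma pos_coord x : x \in P -> exists j, 0 < x 0 j.
Proof.
move=> xP; apply/existsP; apply: contraTT (ht_pos_gt0 H xP) => /existsPn N.
by rewrite -leNgt; apply: sumr_le0 => j _; rewrite leNgt.
Qed.

Definition abs_ht x : nat := Num.truncn `|ht x|.

Lemma abs_htN x : abs_ht (- x) = abs_ht x.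
Proof. by rewrite /abs_ht htN normrN. Qed.

Lemma abs_htE x : x \in P -> (abs_ht x)%:R = ht x.
Proof.
move=> xP; rewrite /abs_ht gtr0_norm ?(ht_pos_gt0 H) // truncnK //.
by rewrite natrEint (ht_int H) ?pos_root // ltW ?(ht_pos_gt0 H).
Qed.

Lemma abs_ht_gt0 x : x \in P -> (0 < abs_ht x)%N.
Proof. by move=> xP; rewrite -(ltr_nat rat) abs_htE ?(ht_pos_gt0 H). Qed.

Lemma abs_ht_add x i : x \in P -> x + al i \in P -> abs_ht (x + al i) = (abs_ht x).+1.
Proof.
by move=> xP yP; apply/eqP; rewrite -(eqr_nat rat) -natr1 !abs_htE // htD ht_al.
Qed.

Lemma abs_ht_sub x i : x \in roots Wl -> x \notin P -> x + al i \in roots Wl -> x + al i \notin P ->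
  abs_ht x = (abs_ht (x + al i)).+1.
Proof.
move=> xR xP yR yP; have E : - x = - (x + al i) + al i by rewrite opprD subrK.
have yN : - (x + al i) \in P by rewrite -(rootNpos H).
have := @abs_ht_add (- (x + al i)) i yN; rewrite -E !abs_htN; apply.
by rewrite -(rootNpos H).
Qed.

Lemma abs_ht_al i : abs_ht (al i) = 1%N.
Proof. by apply/eqP; rewrite -(eqr_nat rat) abs_htE ?(pos_al H) // ht_al. Qed.

Section Theta.
Variable th : 'rV[rat]_r.
Hypothesis thS : th \in SR.
Hypothesis thd : dominant A th.
Let thP := th_pos H thS thd.

Lemma mq0_short x : x \in SR ->
  m_ 0 x = if x \in P then 0 else ('X - 1) * 'X^((abs_ht x).-1).
Proof.
have pos0 y : y \in P -> m_ 0 y = 0 by move=> /pos_coord[j]; apply: mq0_eq0.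
move=> xS; have [/pos0//|] := boolP (x \in P); move: x xS.
apply: (short_ind H thS thd) => [|x i xS x0 IH]; first by rewrite thP.
have [-> _|[_ x1 E xyP] xP] := short_cases H xS x0.
  by rewrite mq_Nal pos0 ?(pos_al H) // mq00 abs_htN abs_ht_al; ring.
rewrite (mq_step _ x1) IH ?xyP // (@abs_ht_sub x i) ?(short_root xS) -?E ?xyP //; last first.
  by rewrite (root_refl H) ?(short_root xS).
have yP : - (x *m sr i) \in P by rewrite -(rootNpos H) ?xyP ?(root_refl H) ?(short_root xS).
by rewrite mulrCA -exprS prednK // -abs_htN abs_ht_gt0.
Qed.

(** Moving a weight $x$ from the numerator into the partition function shifts $\mu$ by $-x$;
    everything is reduced to the highest weight $0$. *)
Lemma mq_theta mu : m_ th mu =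
  (n_short_simple A Wl d)%:R * m_ 0 mu + \sum_(x <- SR) m_ 0 (mu - x).
Proof.
rewrite mq_alternant [th + _]addrC (alternant_short H _ polyint_two thS thd).
congr (_ * _ + _); first by rewrite mq_alternant add0r.
under eq_bigr => w _ do rewrite mulr_sumr.
rewrite exchange_big /=; apply: eq_bigr => x _; rewrite mq_alternant add0r.
by apply: eq_bigr => w _; congr (_ * Pq _ _); apply/rowP => j; rewrite !mxE; ring.
Qed.

Lemma big_short_neg (F : nat -> {poly int}) :
  \sum_(x <- SR | x \notin P) F (abs_ht x) = \sum_(x <- SR | x \in P) F (abs_ht x).
Proof.
rewrite -(perm_big _ (perm_shortN H)) big_map big_seq_cond [RHS]big_seq_cond.
apply: eq_big => [x|x _]; last by rewrite abs_htN.
have [xS|//] := boolP (x \in SR); rewrite /= (rootNpos H) ?opprK //.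
exact/(rootN H)/short_root/xS.
Qed.

Lemma mq_theta0 : m_ th 0 = (n_short_simple A Wl d)%:R +
  ('X - 1) * \sum_(x <- SR | x \in P) 'X^((abs_ht x).-1).
Proof.
rewrite mq_theta mq00 mulr1; congr (_ + _).
rewrite -(big_short_neg (fun k => 'X^(k.-1))) mulr_sumr [RHS]big_mkcond /=.
rewrite -(perm_big _ (perm_shortN H)) big_map; apply: eq_big_seq => x xS.
by rewrite sub0r opprK mq0_short //; case: ifP.
Qed.

Lemma mq_theta_theta : m_ th th = 1.
Proof.
rewrite mq_theta; have [j jt] := pos_coord thP; rewrite (mq0_eq0 jt) mulr0 add0r.
rewrite (bigD1_seq th) ?short_uniq //= subrr mq00 big1_seq ?addr0 // => x /andP[xth xS].
have /existsP[k kx] : [exists k, 0 < (th - x) 0 k].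
  apply: contraNT xth => /existsPn N; apply/eqP/(short_le_th H thS thd) => // k.
  by have := N k; rewrite -leNgt !mxE; lra.
exact: mq0_eq0 kx.
Qed.

(** The difference of heights is the [depth] of $x$, a natural number. *)
Lemma abs_ht_le x : x \in SR -> x \in P -> (abs_ht x <= abs_ht th)%N.
Proof.
move=> xS xP; have := depthE H thS thd xS; rewrite xP subr0 => E.
by rewrite -(ler_nat rat) !abs_htE // -subr_ge0 -E.
Qed.

Lemma mq_theta_short x : x \in SR -> m_ th x =
  if x \in P then 'X^(abs_ht th - abs_ht x)
  else 'X^((abs_ht x).-1) * (('X - 1) * m_ th 0 + 'X^(abs_ht th)).
Proof.
move: x; apply: (short_ind H thS thd) => [|x i xS x0 IH].
  by rewrite thP mq_theta_theta subnn.
have xR := short_root xS; have yS := short_weyl H (weyl_refl H i) xS.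
have yR := short_root yS.
have [xE|[_ x1 E xyP]] := short_cases H xS x0.
  (* The step over the weight $0$ is where $m^0$ enters. *)
  move: IH; rewrite xE mulNmx (al_refl H) opprK (pos_al H) (posN_F H) ?(pos_al H) //.
  rewrite mq_Nal abs_htN abs_ht_al => ->; rewrite expr0 mul1r addrC; congr (_ + _).
  by rewrite -exprS subn1 prednK // abs_ht_gt0.
rewrite (mq_step _ x1) IH xyP; case: ifPn => xP.
  rewrite -exprS E abs_ht_add -?E ?xyP // -subSn ?subSS //.
  by have := abs_ht_le yS; rewrite xyP E abs_ht_add -?E ?xyP //; apply.
have yP : - (x *m sr i) \in P by rewrite -(rootNpos H) ?xyP.
rewrite (@abs_ht_sub x i) -?E ?xyP //= mulrA -exprS prednK //.
by rewrite -abs_htN abs_ht_gt0.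
Qed.

Lemma sum_mq_theta :
  \sum_(x <- SR) m_ th x = \sum_(x <- SR | x \in P) 'X^(abs_ht th - abs_ht x) +
  (\sum_(x <- SR | x \in P) 'X^((abs_ht x).-1)) * (('X - 1) * m_ th 0 + 'X^(abs_ht th)).
Proof.
rewrite (bigID (mem P)) /=; congr (_ + _); rewrite ?mulr_suml.
  rewrite big_seq_cond [RHS]big_seq_cond; apply: eq_bigr => x /andP[xS xP].
  by rewrite mq_theta_short // xP.
rewrite -(big_short_neg (fun k => 'X^(k.-1) * _)) big_seq_cond [RHS]big_seq_cond.
by apply: eq_bigr => x /andP[xS /negPf xP]; rewrite mq_theta_short // xP.
Qed.

End Theta.
End QAnalogue.

(** * Denominator and Macdonald identities *)

Section PrincipalSpecialization.
Variables (r : nat) (A : 'M[int]_r) (d : 'I_r -> rat) (Wl : seq 'M[rat]_r).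
Hypothesis H : cartan_datum A d Wl.
Implicit Types (x y nu : 'rV[rat]_r) (i j : 'I_r) (w u v : 'M[rat]_r).
Local Notation "''[' x , y ]" := (form A d x y).
Local Notation al := (@simple_root r).
Local Notation P := (pos_roots Wl).
Local Notation "x ^v" := (coroot A d x) (at level 2, format "x ^v").
Local Notation rhov := (rhov A d Wl).
Let symA := datum_sym H.

Lemma pos_prod_even (K : comPzRingType) (f : 'rV[rat]_r -> K) u : u \in Wl ->
  (forall x, f (- x) = f x) -> \prod_(x <- P) f (x *m u) = \prod_(x <- P) f x.
Proof.
move=> uW fN; move: u uW; apply: (weyl_ind H) => [|i u uW IH].
  by apply: eq_bigr => x _; rewrite mulmx1.
under eq_bigr => x _ do rewrite mulmxA.
rewrite (pos_big_refl H _ (fun x => f (x *m u)) i) /= mulNmx fN -IH.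
by rewrite (pos_big_al H _ (fun x => f (x *m u)) i).
Qed.

Lemma pos_prod_odd (K : comPzRingType) (f : 'rV[rat]_r -> K) u : u \in Wl ->
  (forall x, f (- x) = - f x) ->
  \prod_(x <- P) f (x *m u) = (eps Wl u)%:~R * \prod_(x <- P) f x.
Proof.
move=> uW fN; move: u uW; apply: (weyl_ind H) => [|i u uW IH].
  by rewrite eps1 mul1r; apply: eq_bigr => x _; rewrite mulmx1.
under eq_bigr => x _ do rewrite mulmxA.
rewrite (pos_big_refl H _ (fun x => f (x *m u)) i) /= mulNmx fN (eps_refl H) //.
rewrite rmorphN !mulNr -IH.
by rewrite (pos_big_al H _ (fun x => f (x *m u)) i).
Qed.

Lemma coroot_form x y : '[x^v, y] = 2 * '[x, y] / '[x, x].
Proof. by rewrite (formZl symA) mulrAC. Qed.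

Lemma coroot_int_form x y : x \in roots Wl -> (forall i, pair A i y \is a Num.int) ->
  '[x^v, y] \is a Num.int.
Proof.
move=> xR yi; rewrite coroot_form {1}formE mulr_sumr mulr_suml rpred_sum // => i _.
rewrite (_ : _ / _ = (2 * d i * x 0 i / '[x, x]) * pair A i y); last by ring.
by rewrite rpredM ?(coroot_int H).
Qed.

(* If no root is orthogonal to [half_sum coroot c], its dominant conjugate is
   [rhov] minus a sum of positive coroots that is nonpositive on the simple
   roots, hence zero. *)
Lemma half_sum_regular c : root_choice Wl c ->
  (forall x, x \in roots Wl -> '[x, half_sum Wl (coroot A d) c] != 0) ->
  exists2 u, u \in Wl & half_sum Wl (coroot A d) c = rhov *m u.
Proof.
set z := half_sum _ _ _ => cc reg.
have [u uW ud] := dominant_conj H z.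
exists (invmx u); first exact: (weylV H).
apply: (can_inj (mulmxK (weyl_unit H uW))); rewrite mulmxKV ?(weyl_unit H) //.
have corw x : x \in roots Wl -> (x *m u)^v = x^v *m u by move=> _; apply: (coroot_weyl H).
have corN x : (- x)^v = - x^v by apply: (corootN H).
pose c' x := c (x *m invmx u).
have cc' : root_choice Wl c' by apply: (root_choice_weyl H).
have zE : z *m u = rhov - \sum_(x <- P | ~~ c' x) x^v.
  by rewrite (half_sum_weyl H) // (half_sum_sub H) // -(rhov_half_sum H).
set s := \sum_(x <- _ | _) _ in zE.
have s_le0 i : '[al i, s] <= 0.
  have s_int : '[al i, s] \is a Num.int.
    rewrite form_sumr big_seq_cond rpred_sum // => x /andP[/pos_root xR _].
    rewrite (formC symA); apply: coroot_int_form => // j.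
    by rewrite pair_al intr_int.
  have : 0 < '[al i, z *m u].
    rewrite lt_neqAle ud andbT eq_sym -(mulmxKV (weyl_unit H uW) (al i)) (form_weyl H) //.
    by rewrite reg // (root_weyl H) ?(root_al H) ?(weylV H).
  rewrite zE formBr (form_al_rhov H); move: s_int => /intrP[m ->].
  by rewrite subr_gt0 (ltr_int _ m 1) lerz0; lia.
have s_ge0 j : 0 <= s 0 j.
  rewrite summxE big_seq_cond sumr_ge0 // => x /andP[xP _]; rewrite mxE mulr_ge0 //.
    by rewrite divr_ge0 // ltW // (root_norm_gt0 H) ?pos_root.
  exact: (pos_ge0 j xP).
suff s0 : s = 0 by rewrite zE s0 subr0.
apply/eqP; apply: contraT => /(form_gt0 H); rewrite formE ltNge => /negP[].
by apply: sumr_le0 => i _; rewrite mulr_ge0_le0 // -form_al.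
Qed.

(** Translate by $u^{-1}$: the first choice then has half sum [rhov], so the positive coroots it
    omits add up to zero. Each pairs positively with [rhov], hence none is omitted. *)
Lemma half_sum_inj c c' : root_choice Wl c -> root_choice Wl c' ->
  half_sum Wl (coroot A d) c = half_sum Wl (coroot A d) c' ->
  (exists2 u, u \in Wl & {in roots Wl, c' =1 fun x => x *m invmx u \in P}) ->
  {in roots Wl, c =1 c'}.
Proof.
move=> cc cc' E [u uW c'E].
have corw w : w \in Wl -> forall x, x \in roots Wl -> (x *m w)^v = x^v *m w.
  by move=> wW x _; apply: (coroot_weyl H).
have corN x : (- x)^v = - x^v by apply: (corootN H).
have uV := weylV H uW.
pose b := fun x => c (x *m invmx (invmx u)).
have bc : root_choice Wl b by apply: (root_choice_weyl H).
have : half_sum Wl (coroot A d) b = rhov.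
  rewrite -(half_sum_weyl H _ uV (corw _ uV)) E (half_sum_weyl H _ uV (corw _ uV)).
  rewrite (rhov_half_sum H) /half_sum; congr (_ *: _); rewrite big_seq_cond [RHS]big_seq_cond.
  apply: eq_bigl => x; have [xR|//] := boolP (x \in roots Wl).
  by rewrite invmxK c'E ?(root_weyl H) //= mulmxK ?(weyl_unit H).
rewrite (half_sum_sub H) // -(rhov_half_sum H) => /eqP.
rewrite -subr_eq0 addrAC subrr add0r oppr_eq0 => /eqP s0.
have bP x : x \in P -> b x.
  move=> xP; apply: contraT => bx.
  have : '[rhov, \sum_(x <- P | ~~ b x) x^v] = 0 by rewrite s0 form0r.
  have pos z : z \in P -> 0 < '[rhov, z^v].
    move=> zP; rewrite formZr (form_rhov H) mulr_gt0 ?(ht_pos_gt0 H) //.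
    by rewrite divr_gt0 // (root_norm_gt0 H) ?pos_root.
  rewrite form_sumr big_mkcond (bigD1_seq x) ?(pos_uniq Wl) //= bx => /eqP.
  rewrite gt_eqF // ltr_wpDr ?pos // big_seq_cond sumr_ge0 // => z /andP[zP _].
  by case: ifP => // _; rewrite ltW ?pos.
move=> x xR; rewrite c'E //=; have [xP|] := boolP (x *m invmx u \in P).
  by have := bP _ xP; rewrite /b invmxK mulmxKV ?(weyl_unit H).
rewrite (rootNpos H) ?(root_weyl H) // => /bP; rewrite /b invmxK mulNmx mulmxKV ?(weyl_unit H) //.
by rewrite cc // => /negbTE.
Qed.

End PrincipalSpecialization.

(** * Macdonald's identity with one parameter per root *)

Section Macdonald.
Variables (r : nat) (A : 'M[int]_r) (d : 'I_r -> rat) (Wl : seq 'M[rat]_r).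
Hypothesis H : cartan_datum A d Wl.
Implicit Types (x y nu : 'rV[rat]_r) (i j : 'I_r) (w u v : 'M[rat]_r).
Local Notation "''[' x , y ]" := (form A d x y).
Local Notation sr := (refl A).
Local Notation P := (pos_roots Wl).
Local Notation "x ^v" := (coroot A d x) (at level 2, format "x ^v").
Local Notation rhov := (rhov A d Wl).
Local Notation n := (size P).
Let symA := datum_sym H.

Variables (K : realFieldType) (e : rat -> K).
Hypothesis eD : forall a b, e (a + b) = e a * e b.
Hypothesis e_gt0 : forall a, 0 < e a.
Hypothesis e_inj : injective e.

Lemma e0 : e 0 = 1.
Proof.
have := eD 0 0; rewrite addr0 => E; apply/(mulfI (lt0r_neq0 (e_gt0 0))).
by rewrite mulr1 -E.
Qed.

Lemma eN a : e (- a) = (e a)^-1.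
Proof.
apply: (mulfI (lt0r_neq0 (e_gt0 a))); rewrite -eD subrr e0 divff //.
exact/lt0r_neq0.
Qed.

Lemma e_sum (I : Type) (s : seq I) (F : I -> rat) :
  e (\sum_(a <- s) F a) = \prod_(a <- s) e (F a).
Proof. exact: (big_morph e eD e0). Qed.

Definition br a := e (a / 2) - e (- (a / 2)).

Lemma brN a : br (- a) = - br a.
Proof. by rewrite /br mulNr opprK opprB. Qed.

Lemma br_neq0 a : a != 0 -> br a != 0.
Proof. by move=> a0; rewrite subr_eq0 (inj_eq e_inj); apply: contra a0 => /eqP E; apply/eqP; lra. Qed.

(** Turns one sign per positive root into a choice from each pair of opposite roots; expanding a
    product over [P] is indexed by such signs. *)
Definition choice_of (k : {ffun 'I_n -> bool}) : pred 'rV[rat]_r := fun x =>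
  [exists a : 'I_n, (x == P`_a) && k a || (x == - P`_a) && ~~ k a].

Lemma pos_nth_inj (a b : 'I_n) : P`_a = P`_b -> a = b.
Proof.
move=> E; apply/val_inj/eqP.
by rewrite /= -(nth_uniq 0 (ltn_ord a) (ltn_ord b) (pos_uniq Wl)) E.
Qed.

Lemma choice_of_nth k (a : 'I_n) : choice_of k P`_a = k a.
Proof.
apply/existsP/idP => [[b /orP[]/andP[/eqP E]]|ka]; last by exists a; rewrite eqxx ka.
  by rewrite -(pos_nth_inj E).
by have := pos_nth a; rewrite E (posN_F H) // pos_nth.
Qed.

Lemma choice_of_nthN k (a : 'I_n) : choice_of k (- P`_a) = ~~ k a.
Proof.
apply/existsP/idP => [[b /orP[]/andP[/eqP E]]|ka]; last by exists a; rewrite eqxx ka orbT.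
  by have := pos_nth b; rewrite -E (posN_F H) // pos_nth.
by have := oppr_inj E => /pos_nth_inj ->.
Qed.

Lemma root_nth x : x \in roots Wl -> exists a : 'I_n, x = P`_a \/ x = - P`_a.
Proof.
have nthE z : z \in P -> exists a : 'I_n, z = P`_a.
  move=> zP; have zn : (index z P < n)%N by rewrite index_mem.
  by exists (Ordinal zn); rewrite /= nth_index.
move=> xR; have [/nthE[a ->]|] := boolP (x \in P); first by exists a; left.
by rewrite (rootNpos H) // => /nthE[a E]; exists a; right; rewrite -E opprK.
Qed.

Lemma root_choice_of k : root_choice Wl (choice_of k).
Proof.
move=> x /root_nth[a [->|->]]; first by rewrite choice_of_nthN choice_of_nth.
by rewrite opprK choice_of_nthN choice_of_nth negbK.
Qed.

Lemma half_sum_choice k : half_sum Wl (coroot A d) (choice_of k) =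
  \sum_(a < n) (if k a then 2^-1 *: (P`_a)^v else - (2^-1 *: (P`_a)^v)).
Proof.
rewrite /half_sum big_mkcond (big_roots_pos H) (big_nth 0) big_mkord scaler_sumr.
apply: eq_bigr => a _; rewrite /= choice_of_nth choice_of_nthN.
by case: (k a); rewrite /= ?addr0 ?add0r // (corootN H) scalerN.
Qed.

Definition weyl_choice u : {ffun 'I_n -> bool} := [ffun a : 'I_n => P`_a *m invmx u \in P].

Lemma weyl_choiceE u : u \in Wl ->
  {in roots Wl, choice_of (weyl_choice u) =1 fun x => x *m invmx u \in P}.
Proof.
move=> uW x /root_nth[a [->|->]]; first by rewrite choice_of_nth ffunE.
rewrite choice_of_nthN ffunE mulNmx (rootNpos H) //.
by rewrite (root_weyl H) ?(weylV H) // pos_root ?pos_nth.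
Qed.

Lemma half_sum_weyl_choice u : u \in Wl ->
  half_sum Wl (coroot A d) (choice_of (weyl_choice u)) = rhov *m u.
Proof.
move=> uW; rewrite (rhov_half_sum H) (half_sum_weyl H) // => [|x xR]; last exact: (coroot_weyl H).
rewrite /half_sum; congr (_ *: _); rewrite big_seq_cond [RHS]big_seq_cond.
by apply: eq_bigl => x; have [xR|//] := boolP (x \in roots Wl); rewrite weyl_choiceE.
Qed.

Lemma weyl_choice_inj : {in Wl &, injective weyl_choice}.
Proof.
move=> u v uW vW E.
suff : v *m invmx u = 1%:M.
  by move=> /(congr1 (mulmx^~ u)); rewrite mulmxKV ?(weyl_unit H) // mul1mx.
apply: (weyl_pos_id H); first by rewrite (weylM H) ?(weylV H).
move=> x xP; have xvR : x *m v \in roots Wl by rewrite (root_weyl H) ?pos_root.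
by rewrite mulmxA -weyl_choiceE // E weyl_choiceE // mulmxK ?(weyl_unit H).
Qed.

Definition alt_e nu := alternant Wl (fun z => e '[z, nu]).

Lemma K_two : 2%:R != 0 :> K. Proof. by rewrite pnatr_eq0. Qed.

(** If some root is orthogonal to the half sum, a conjugate is fixed by a simple reflection and the
    alternant is its own negative. Otherwise the half sum is regular, hence a translate of [rhov],
    and injectivity forces [k] to come from $W$. *)
Lemma alt_e_choice0 nu k : (forall u, u \in Wl -> k != weyl_choice u) ->
  alt_e nu (half_sum Wl (coroot A d) (choice_of k)) = 0.
Proof.
set z := half_sum _ _ _ => kN.
have [/hasP[x xR /eqP x0]|/hasPn reg] := boolP (has (fun x => '[x, z] == 0) (roots Wl)).
  have /rootsP[i [u uW xE]] := xR.
  have fixz : (z *m invmx u) *m sr i = z *m invmx u.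
    rewrite reflE (_ : pair A i _ = 0) ?scale0r ?subr0 //.
    rewrite (pairE H) (formC symA) -(form_weyl H _ _ uW) -xE mulmxKV ?(weyl_unit H) // x0.
    by rewrite mulr0 mul0r.
  have : alt_e nu (z *m invmx u) = 0.
    by apply: (self_opp0 K_two); rewrite -{1}fixz /alt_e (alternant_refl H).
  rewrite /alt_e (alternant_weyl H) ?(weylV H) // => /eqP; rewrite mulf_eq0.
  by rewrite intr_eq0 /eps signr_eq0 => /eqP.
have [u uW zu] := half_sum_regular H (@root_choice_of k) reg.
case/negP: (kN u uW); apply/eqP/ffunP => a.
rewrite -choice_of_nth -[RHS]choice_of_nth.
have aR : P`_a \in roots Wl by rewrite pos_root ?pos_nth.
apply: (half_sum_inj H) => //; try exact: root_choice_of.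
  by rewrite half_sum_weyl_choice // -zu.
by exists u => //; apply: weyl_choiceE.
Qed.

Lemma perm_weylV : perm_eq [seq invmx w | w <- Wl] Wl.
Proof.
apply: perm_map_uniq; first exact: (weyl_uniq H); last exact: (weylV H).
by move=> u v _ _ /(congr1 invmx); rewrite !invmxK.
Qed.

Lemma eps_prod w : (eps Wl w)%:~R = \prod_(x <- P) (if x *m w \in P then 1 else -1) :> K.
Proof.
rewrite /eps rmorphXn rmorphN1 inv_countE -prodrXr; apply: eq_bigr => x _.
by case: (_ \in P).
Qed.

Lemma eps_invmx w : w \in Wl -> eps Wl (invmx w) = eps Wl w.
Proof.
move=> wW; have := epsM H wW (weylV H wW); rewrite mulmxV ?(weyl_unit H) // eps1 => E.
by rewrite -[LHS]mul1r -(eps_sqr Wl w) -mulrA -E mulr1.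
Qed.

Section Weighted.
Variables (y : 'rV[rat]_r -> K) (nu : 'rV[rat]_r).

(** [y x] is, up to inversion, a square root of Macdonald's parameter for the root $x$; it need not
    be constant on $W$-orbits. With $y=1$ this is a denominator factor. *)
Definition wfactor x z := y x * e ('[z, nu] / 2) - (y x)^-1 * e (- ('[z, nu] / 2)).

Definition wcoef (k : {ffun 'I_n -> bool}) :=
  \prod_(a < n) (if k a then y P`_a else - (y P`_a)^-1).

Lemma wfactor_expand w : \prod_(x <- P) wfactor x (x^v *m w) =
  \sum_(k : {ffun 'I_n -> bool})
     wcoef k * e '[half_sum Wl (coroot A d) (choice_of k) *m w, nu].
Proof.
rewrite (big_nth 0) big_mkord.
rewrite (eq_bigr (fun a : 'I_n => \sum_(b : bool)
   (if b then y P`_a else - (y P`_a)^-1) *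
    e (if b then '[(P`_a)^v *m w, nu] / 2 else - ('[(P`_a)^v *m w, nu] / 2)))); last first.
  by move=> a _; rewrite big_bool /wfactor mulNr.
rewrite bigA_distr_bigA /=; apply: eq_bigr => k _; rewrite big_split /=; congr (_ * _).
rewrite half_sum_choice mulmx_suml (formC symA) form_sumr e_sum; apply: eq_bigr => a _.
have E x : '[nu, (2^-1 *: x) *m w] = '[x *m w, nu] / 2.
  by rewrite -scalemxAl formZr (formC symA) mulrC.
by congr e; case: (k a); rewrite ?mulNmx ?formNr E.
Qed.

(** After expanding the products, only the $|W|$ choices given by translates of the positive system
    survive antisymmetrization, each contributing the denominator up to sign. *)
Lemma macdonald_sum :
  \sum_(w <- Wl) (eps Wl w)%:~R * \prod_(x <- P) wfactor x (x^v *m w) =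
  alt_e nu rhov * \sum_(w <- Wl) \prod_(x <- P) (if x *m w \in P then y x else (y x)^-1).
Proof.
under eq_bigr => w _ do rewrite wfactor_expand mulr_sumr.
rewrite exchange_big /= (eq_bigr (fun k => wcoef k *
    alt_e nu (half_sum Wl (coroot A d) (choice_of k)))); last first.
  by move=> k _; rewrite mulr_sumr; apply: eq_bigr => w _; rewrite mulrCA.
rewrite (bigID (fun k => k \in map weyl_choice Wl)) /= [X in _ + X]big1 ?addr0; last first.
  move=> k kN; rewrite alt_e_choice0 ?mulr0 // => u uW.
  by apply: contraNneq kN => ->; apply: map_f.
rewrite -big_uniq /=; last by rewrite map_inj_in_uniq ?(weyl_uniq H) //; apply: weyl_choice_inj.
rewrite big_map -(perm_big _ perm_weylV) big_map mulr_sumr; apply: eq_big_seq => w wW.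
have wV := weylV H wW; rewrite half_sum_weyl_choice // /alt_e (alternant_weyl H) //.
rewrite eps_invmx // mulrA mulrC; congr (_ * _).
rewrite eps_prod /wcoef (big_nth 0) big_mkord [RHS](big_nth 0) big_mkord -big_split /=.
apply: eq_bigr => a _; rewrite ffunE invmxK.
by case: ifP => _; rewrite ?mulr1 // mulrN1 opprK.
Qed.

End Weighted.

Definition denom nu := \prod_(x <- P) br '[x^v, nu].

(** Macdonald's identity at $y=1$: every term of either sum over $W$ is the same, and $|W|$
    cancels. *)
Lemma weyl_denominator nu : alt_e nu rhov = denom nu.
Proof.
have sW : (size Wl)%:R != 0 :> K.
  by rewrite pnatr_eq0; have := weyl1 H; case: (Wl).
have sumc (c : K) : \sum_(w <- Wl) c = c * (size Wl)%:R.
  by rewrite big_const_seq count_predT iter_addr_0 mulr_natr.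
apply: (mulIf sW); rewrite -[X in alt_e _ _ * X]mul1r -!sumc.
have -> : \sum_(w <- Wl) 1 =
    \sum_(w <- Wl) \prod_(x <- P) (if x *m w \in P then 1 else (1 : K)^-1).
  by apply: eq_bigr => w _; rewrite big1 // => x _; rewrite invr1; case: ifP.
rewrite -[LHS](macdonald_sum (fun _ => 1) nu) [LHS]/=; apply: eq_big_seq => w wW.
rewrite (eq_bigr (fun x => br '[(x *m w)^v, nu])) => [|x _]; last first.
  by rewrite /wfactor invr1 !mul1r (coroot_weyl H).
rewrite (@pos_prod_odd _ _ _ _ H _ (fun x => br '[x^v, nu])) //.
  by rewrite mulrA -intrM eps_sqr mul1r.
by move=> x; rewrite (corootN H) (formNl symA) brN.
Qed.

End Macdonald.

(** * Duality *)

Section Duality.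
Variables (r : nat) (A : 'M[int]_r) (d : 'I_r -> rat) (Wl : seq 'M[rat]_r).
Hypothesis H : cartan_datum A d Wl.
Implicit Types (x y nu : 'rV[rat]_r) (i j : 'I_r) (w u v : 'M[rat]_r).
Local Notation "''[' x , y ]" := (form A d x y).
Local Notation al := (@simple_root r).
Local Notation sr := (refl A).
Local Notation P := (pos_roots Wl).
Local Notation SR := (short_roots A Wl d).
Local Notation "x ^v" := (coroot A d x) (at level 2, format "x ^v").
Local Notation rhov := (rhov A d Wl).
Local Notation rho := (rho Wl).
Let symA := datum_sym H.
Let cartA := datum_cartan H.

Variable th : 'rV[rat]_r.
Hypothesis thS : th \in SR.
Hypothesis thd : dominant A th.
Let thP := th_pos H thS thd.
Let thR := short_root thS.

(* It turns out to be the Coxeter number. *)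
Definition dual_height : rat := '[th^v, rho] + 1.

Lemma dual_height_nat : exists2 g : nat, g%:R = dual_height & (1 < g)%N.
Proof.
have gi : '[th^v, rho] \is a Num.int.
  by apply: (coroot_int_form H) => // i; rewrite (pair_rho H).
have g0 : 0 < '[th^v, rho].
  by rewrite (formZl symA) mulr_gt0 ?(rho_pos_gt0 H) // divr_gt0 // (root_norm_gt0 H).
have /natrP[k kE] : '[th^v, rho] \is a Num.nat by rewrite natrEint gi ltW.
exists k.+1; first by rewrite /dual_height kE natr1.
by move: g0; rewrite kE ltr0n.
Qed.

Lemma short_transitive x : x \in SR -> exists2 w, w \in Wl & x = th *m w.
Proof.
move: x; apply: (short_ind H thS thd) => [|x i xS _ [w wW E]].
  by exists 1%:M; rewrite ?mulmx1 ?(weyl1 H).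
exists (w *m sr i); first by rewrite (weylM H) ?(weyl_refl H).
by rewrite mulmxA -E -mulmxA (refl_invol cartA) mulmx1.
Qed.

Variables (K : realFieldType) (e : rat -> K).
Hypothesis eD : forall a b, e (a + b) = e a * e b.
Hypothesis e_gt0 : forall a, 0 < e a.
Hypothesis e_inj : injective e.
Let eN := eN eD e_gt0.

(** The Weyl character formula of $V_{\theta_s}$ specialized at $q^{\rho^\vee}$; [altE] uses the
    dual denominator formula to make products of the numerator and of the denominator. *)
Lemma denom_shift : denom A d Wl e (rho + th) =
  denom A d Wl e rho * ((n_short_simple A Wl d)%:R + \sum_(x <- SR) e (ht x)).
Proof.
have altE nu : alternant Wl (fun z => e '[z, rhov]) nu = denom A d Wl e nu.
  rewrite -(weyl_denominator H eD e_gt0) /alt_e /alternant.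
  rewrite -(perm_big _ (perm_weylV H)) big_map; apply: eq_big_seq => w wW.
  by rewrite (eps_invmx H) // (form_weylV H) ?(weylV H) // invmxK (formC symA).
rewrite -!altE (alternant_short H _ (K_two K) thS thd) mulrDr.
congr (_ + _); first by rewrite mulrC.
rewrite [in RHS]/alternant [RHS]mulr_suml; apply: eq_bigr => w _; rewrite -mulrA.
congr (_ * _); rewrite mulr_sumr.
by apply: eq_bigr => x _; rewrite (formDl symA) eD (formC symA x) (form_rhov H).
Qed.

(** $q^{1/2}$, $1$ or $q^{-1/2}$ according to the sign of $(x,y)$. Being equivariant and trivial on
    the roots orthogonal to $y$, it reduces Macdonald's sum to the orbit of $y$. *)
Definition sgn_weight (y x : 'rV[rat]_r) : K :=
  if 0 < '[x, y] then e (1 / 2) else if '[x, y] < 0 then (e (1 / 2))^-1 else 1.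

Lemma sgn_weightN y x : sgn_weight y (- x) = (sgn_weight y x)^-1.
Proof.
rewrite /sgn_weight (formNl symA) oppr_gt0 oppr_lt0.
by case: ltgtP => _; rewrite ?invrK ?invr1.
Qed.

Lemma sgn_weight_weyl y x w : w \in Wl -> sgn_weight (y *m w) (x *m w) = sgn_weight y x.
Proof. by move=> wW; rewrite /sgn_weight (form_weyl H). Qed.

Lemma sgn_weight_gt0 y x : 0 < sgn_weight y x.
Proof. by rewrite /sgn_weight; do 2?case: ifP => _; rewrite ?invr_gt0 ?ltr01. Qed.

Definition short_weight y : K := \prod_(x <- P) sgn_weight y x.

Definition theta_factor x := wfactor A d e (sgn_weight th) rho x x^v.

Lemma theta_term w : w \in Wl ->
  (eps Wl w)%:~R * \prod_(x <- P) wfactor A d e (sgn_weight th) rho x (x^v *m w) =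
  (th *m w == th)%:R * \prod_(x <- P) theta_factor x.
Proof.
move=> wW; have [thw|thw] := eqVneq (th *m w) th; last first.
  rewrite mul0r; have twS : th *m w \in SR by rewrite (short_weyl H).
  have /existsP[i xi] : [exists i, pair A i (th *m w) < 0].
    apply: contraNT thw => /existsPn N; apply/eqP/(dom_short_th H thS thd) => // i.
    by rewrite leNgt N.
  (* The factor of this positive root vanishes: its weight is $q^{1/2}$, while $(x^\vee
     w,\rho)=-1$. *)
  pose x := - (al i *m invmx w).
  have xth : 0 < '[x, th].
    rewrite (formNl symA) (form_weylV H) ?(weylV H) // invmxK oppr_gt0.
    by rewrite (form_al_lt0 H).
  have xR : x \in roots Wl by rewrite (rootN H) ?(root_weyl H) ?(root_al H) ?(weylV H).
  have xP : x \in P.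
    apply: contraTT xth; rewrite (rootNpos H) // -leNgt -oppr_ge0 -(formNl symA) => xN.
    by apply: (dom_form_ge0 H (th_dom thd)) => j; apply: (pos_ge0 j xN).
  rewrite (bigD1_seq x) ?(pos_uniq Wl) //= /wfactor {1 2}/sgn_weight xth.
  rewrite -(coroot_weyl H) // /x mulNmx mulmxKV ?(weyl_unit H) // (corootN H).
  rewrite (formNl symA) (coroot_form H) (form_al_rho H) (form_alal H).
  rewrite divff; last by rewrite mulf_neq0 ?gt_eqF // (d_gt0 symA).
  rewrite mulNr opprK eN divff ?lt0r_neq0 // mulVf ?lt0r_neq0 //.
  by rewrite subrr mul0r mulr0.
rewrite mul1r (eq_bigr (fun x => theta_factor (x *m w))) => [|x _].
  rewrite (@pos_prod_odd _ _ _ _ H _ theta_factor) // => [|x].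
    by rewrite mulrA -intrM eps_sqr mul1r.
  rewrite /theta_factor /wfactor (corootN H) sgn_weightN invrK (formNl symA) mulNr.
  by rewrite opprK opprB.
by rewrite /theta_factor /wfactor (coroot_weyl H) // -{3 4}thw sgn_weight_weyl.
Qed.

Lemma weight_term w : w \in Wl ->
  \prod_(x <- P) (if x *m w \in P then sgn_weight th x else (sgn_weight th x)^-1) =
  short_weight (th *m w).
Proof.
(* [h] extends the weight evenly from [P] to all roots, which makes its product over [P]
   invariant. *)
move=> wW; pose h z := if z \in P then sgn_weight (th *m w) z else
   if - z \in P then sgn_weight (th *m w) (- z) else 1.
rewrite (eq_big_seq (fun x => h (x *m w))) => [|x xP]; last first.
  have xR : x *m w \in roots Wl by rewrite (root_weyl H) ?pos_root.
  rewrite /h; case: ifPn => [_|]; first by rewrite sgn_weight_weyl.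
  by rewrite (rootNpos H) // => ->; rewrite sgn_weightN sgn_weight_weyl.
rewrite (@pos_prod_even _ _ _ _ H _ h) //.
  by apply: eq_big_seq => x xP; rewrite /h xP.
move=> x; rewrite /h opprK; case: (boolP (x \in P)) => xP; last by [].
by rewrite (posN_F H).
Qed.

Lemma theta_product : \prod_(x <- P) theta_factor x =
  denom A d Wl e rho * \sum_(x <- SR) short_weight x.
Proof.
(* The order of the stabilizer of [th], which is the size of every fibre of $w\mapsto\theta_sw$. *)
pose c : K := \sum_(w <- Wl) (th *m w == th)%:R.
have c0 : c != 0.
  rewrite gt_eqF // /c (bigD1_seq 1%:M) ?(weyl1 H) ?(weyl_uniq H) //= mulmx1 eqxx.
  by rewrite ltr_wpDr // sumr_ge0 // => w _; apply: ler0n.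
have fiber x : x \in SR -> \sum_(w <- Wl) (th *m w == x)%:R = c.
  move=> /short_transitive[u uW ->]; rewrite -(perm_big _ (perm_weylMr H uW)) big_map.
  apply: eq_bigr => w _; rewrite mulmxA.
  by rewrite (inj_eq (can_inj (mulmxK (weyl_unit H uW)))).
apply: (mulfI c0).
have := macdonald_sum H eD e_gt0 (sgn_weight th) rho.
rewrite (eq_big_seq _ theta_term) -mulr_suml -/c => ->.
rewrite (weyl_denominator H eD e_gt0) mulrCA; congr (_ * _).
rewrite (eq_big_seq _ weight_term) mulr_sumr.
rewrite (eq_big_seq (fun w => \sum_(x <- SR) (th *m w == x)%:R * short_weight x)).
  rewrite exchange_big /=; apply: eq_big_seq => x xS.
  by rewrite -mulr_suml fiber.
move=> w wW; have twS : th *m w \in SR by rewrite (short_weyl H).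
rewrite (bigD1_seq (th *m w)) ?short_uniq //= eqxx mul1r big1 ?addr0 // => x.
by rewrite eq_sym => /negPf->; rewrite mul0r.
Qed.

Lemma short_weight_refl x i : pair A i x < 0 ->
  short_weight x = short_weight (x *m sr i) * e (- 1).
Proof.
move=> x0; have alx : '[al i, x] < 0 by rewrite (form_al_lt0 H).
rewrite /short_weight.
rewrite [in RHS](eq_bigr (fun y => sgn_weight x (y *m sr i))) => [|y _]; last first.
  rewrite -[in RHS](sgn_weight_weyl _ _ (weyl_refl H i)) -mulmxA.
  by rewrite (refl_invol cartA) mulmx1.
rewrite (pos_big_refl H _ (sgn_weight x)) (pos_big_al H _ _ i) /= sgn_weightN.
rewrite {1 3}/sgn_weight alx ltNge ltW //= invrK mulrAC; congr (_ * _).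
by rewrite -eN -eD; congr e; lra.
Qed.

Lemma short_weight_depth x : x \in SR ->
  short_weight x = short_weight th * e (- (depth A d Wl x)%:R).
Proof.
have e0 := e0 eD e_gt0.
move: x; apply: (short_ind H thS thd) => [|x i xS x0].
  have := depthE H thS thd thS; rewrite thP subrr subr0 => ->.
  by rewrite oppr0 e0 mulr1.
rewrite (short_weight_refl x0) => ->; rewrite (depth_refl H x0) -mulrA -eD.
by rewrite -natr1 opprD.
Qed.

(** Comparing $\theta_s$ with $-\theta_s$ avoids counting roots: their weights are inverse, while
    the depth of $-\theta_s$ is $2\,\mathrm{ht}(\theta_s)-1$. This gives the square, and positivity
    the value. *)
Lemma short_weight_th : short_weight th = e (ht th - 1 / 2).
Proof.
have thN : - th \in SR by rewrite (shortN H).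
have := short_weight_depth thN; rewrite (depthE H thS thd thN) (posN_F H) // htN.
rewrite {1}/short_weight (eq_bigr (fun x => (sgn_weight th x)^-1)); last first.
  by move=> x _; rewrite -sgn_weightN /sgn_weight formNr (formNl symA).
rewrite prodfV -/(short_weight th) => E.
have w0 : 0 < short_weight th by apply: prodr_gt0 => x _; apply: sgn_weight_gt0.
apply/eqP; rewrite -(@eqrXn2 _ 2) ?ltW //; apply/eqP.
have -> : short_weight th ^+ 2 = short_weight th * (short_weight th)^-1^-1.
  by rewrite invrK.
rewrite E invfM mulVKf ?lt0r_neq0 // -eN expr2 -eD; congr e; rewrite /=; lra.
Qed.

Lemma short_weightE x : x \in SR -> short_weight x = e (ht x - 1 / 2 + (x \notin P)%:R).
Proof.
move=> xS; rewrite short_weight_depth // short_weight_th -eD; congr e.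
by rewrite (depthE H thS thd xS); ring.
Qed.

(** For a positive root $x\ne\theta_s$ the integer $(x^\vee,\theta_s)$ is $0$ or $1$, and the weight
    is exactly what shifts $\rho$ to $\rho+\theta_s$. At $\theta_s$ the integer is $2$ but the
    weight is still $q^{1/2}$; this one mismatch gives the quotient of brackets. *)
Lemma theta_factor_denom : \prod_(x <- P) theta_factor x * br e (dual_height + 1) =
  denom A d Wl e (rho + th) * br e dual_height.
Proof.
have thn := root_norm_gt0 H thR.
have tv : '[th^v, th] = 2 by rewrite (coroot_form H) mulfK ?gt_eqF.
have fE x a : '[x^v, th] = a -> sgn_weight th x = e (a / 2) ->
    theta_factor x = br e '[x^v, rho + th].
  move=> xa sx; rewrite /theta_factor /wfactor sx -eN -!eD /br formDr xa.
  by congr (e _ - e _); lra.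
rewrite !(bigD1_seq th thP (pos_uniq Wl)) /denom /=.
rewrite [in RHS](bigD1_seq th thP (pos_uniq Wl)) /=.
have -> : theta_factor th = br e dual_height.
  rewrite /theta_factor /wfactor /sgn_weight thn /dual_height /br -eN -!eD.
  by congr (e _ - e _); lra.
rewrite mulrAC [RHS]mulrC !mulrA; congr (_ * _ * _).
  by congr br; rewrite formDr tv /dual_height; lra.
rewrite big_seq_cond [RHS]big_seq_cond; apply: eq_bigr => x /andP[xP xth].
have xR := pos_root xP; have xn := root_norm_gt0 H xR.
have x0 : 0 <= '[x, th].
  by apply: (dom_form_ge0 H (th_dom thd)) => j; apply: (pos_ge0 j xP).
have xth' : th != x by rewrite eq_sym.
have xNth : th != - x.
  by apply/eqP => E; have := posN_F H xP; rewrite -E thP.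
have := short_pair_lt2 H thS xR xth' xNth => /int_lt2[].
- by apply: (root_pair_int H) => // j; apply: (root_int H).
- rewrite (formC symA) -(coroot_form H) => E; apply: (fE _ _ E).
  rewrite mul0r (e0 eD e_gt0) /sgn_weight; move/eqP: E.
  rewrite (coroot_form H) !mulf_eq0 invr_eq0 (gt_eqF xn) orbF /= => /eqP ->.
  by rewrite ltxx.
- rewrite (formC symA) -(coroot_form H) => E; apply: (fE _ _ E).
  rewrite /sgn_weight ifT //; rewrite lt_neqAle x0 andbT.
  apply: contra_eq_neq E => E0; rewrite (coroot_form H) -E0 mulr0 mul0r.
  by rewrite eq_sym oner_neq0.
- rewrite (formC symA) -(coroot_form H) => E.
  have : 0 <= '[x^v, th] by rewrite (coroot_form H) divr_ge0 ?mulr_ge0 // ltW.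
  by rewrite E.
Qed.

Lemma specialization_identity :
  ((n_short_simple A Wl d)%:R + \sum_(x <- SR) e (ht x)) * br e dual_height =
  (\sum_(x <- SR) short_weight x) * br e (dual_height + 1).
Proof.
have D0 : denom A d Wl e rho != 0.
  rewrite /denom prodf_seq_neq0; apply/allP => x xP /=.
  apply: (br_neq0 e_inj); rewrite (coroot_form H) gt_eqF //.
  by rewrite divr_gt0 ?(root_norm_gt0 H) ?pos_root // mulr_gt0 ?(rho_pos_gt0 H).
apply: (mulfI D0); rewrite !mulrA -denom_shift -theta_product.
by rewrite theta_factor_denom.
Qed.

End Duality.

(** Here $b=q^{1/2}$, $G=q^{g/2}$ and [qH] is $q^H$; the two equations differ by the factor
    $-q^HG$. *)
Lemma duality_algebra (K : fieldType) (l S Sb G b qH : K) : b != 0 -> G != 0 ->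
  (l + (S + Sb)) * (G - G^-1) = (S / b + Sb * b) * (G * b - (G * b)^-1) ->
  (l + (b * b - 1) * (S / (b * b))) * qH = G * G * (l * qH + (1 - b * b) * (qH * Sb)).
Proof.
move=> b0 G0 E.
have E3 : (l + (b * b - 1) * (S / (b * b))) * qH - G * G * (l * qH + (1 - b * b) * (qH * Sb)) =
   - (qH * G) * ((l + (S + Sb)) * (G - G^-1) - (S / b + Sb * b) * (G * b - (G * b)^-1)).
  by field; rewrite G0 b0.
by apply/eqP; rewrite -subr_eq0 E3 E subrr mulr0.
Qed.

(** * Duality as an identity of integer polynomials *)

Section PolynomialDuality.
Variables (r : nat) (A : 'M[int]_r) (d : 'I_r -> rat) (Wl : seq 'M[rat]_r).
Hypothesis H : cartan_datum A d Wl.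
Implicit Types (x y nu : 'rV[rat]_r).
Local Notation P := (pos_roots Wl).
Local Notation SR := (short_roots A Wl d).

Variable th : 'rV[rat]_r.
Hypothesis thS : th \in SR.
Hypothesis thd : dominant A th.

Lemma evaluated_duality (K : realFieldType) (e : rat -> K) (g : nat) :
  (forall a b, e (a + b) = e a * e b) -> (forall a, 0 < e a) -> injective e ->
  g%:R = dual_height A d Wl th ->
  ((n_short_simple A Wl d)%:R +
     (e 1 - 1) * \sum_(x <- SR | x \in P) e 1 ^+ (abs_ht x).-1) * e 1 ^+ abs_ht th =
  e 1 ^+ g * ((n_short_simple A Wl d)%:R * e 1 ^+ abs_ht th +
     (1 - e 1) * \sum_(x <- SR | x \in P) e 1 ^+ (abs_ht th - abs_ht x)).
Proof.
move=> eD e_gt0 e_inj gE; have eN := eN eD e_gt0.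
have e_neq0 a : e a != 0 by rewrite gt_eqF.
have e_nat k : e k%:R = e 1 ^+ k.
  by elim: k => [|k IH]; rewrite ?(e0 eD e_gt0) // -natr1 eD IH exprSr.
pose S := \sum_(x <- SR | x \in P) e 1 ^+ abs_ht x.
pose Sb := \sum_(x <- SR | x \in P) (e 1 ^+ abs_ht x)^-1.
have split_sum (f : 'rV[rat]_r -> K) : \sum_(x <- SR) f x =
    \sum_(x <- SR | x \in P) f x + \sum_(x <- SR | x \in P) f (- x).
  rewrite (bigID (mem P)) /=; congr (_ + _).
  rewrite -(perm_big _ (perm_shortN H)) big_map big_seq_cond [RHS]big_seq_cond.
  apply: eq_bigl => x; have [xS|//] := boolP (x \in SR).
  by rewrite /= (rootNpos H) ?opprK // (rootN H) // (short_root xS).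
have FE : \sum_(x <- SR) e (ht x) = S + Sb.
  rewrite split_sum; congr (_ + _); rewrite big_seq_cond [RHS]big_seq_cond;
    apply: eq_bigr => x /andP[xS xP]; rewrite ?htN -(abs_htE H xP) ?eN e_nat //.
set b := e (1 / 2).
have bE : e 1 = b * b by rewrite -eD; congr e; lra.
have YE : \sum_(x <- SR) short_weight A d Wl e x = S / b + Sb * b.
  rewrite split_sum !mulr_suml; congr (_ + _); rewrite big_seq_cond [RHS]big_seq_cond;
    apply: eq_bigr => x /andP[xS xP].
    rewrite (short_weightE H thS thd eD e_gt0) // xP addr0 eD eN.
    by rewrite -(abs_htE H xP) e_nat.
  rewrite (short_weightE H thS thd eD e_gt0) ?(shortN H) // (posN_F H) //=.
  rewrite htN -(abs_htE H xP) (_ : _ + _ = - (abs_ht x)%:R + 1 / 2); last by lra.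
  by rewrite eD eN e_nat.
have := specialization_identity H thS thd eD e_gt0 e_inj.
rewrite FE YE -gE /br.
set G := e (g%:R / 2).
have GE : e 1 ^+ g = G * G by rewrite -e_nat -eD; congr e; lra.
have -> : e (- (g%:R / 2)) = G^-1 by rewrite eN.
have -> : e ((g%:R + 1) / 2) = G * b by rewrite -eD; congr e; lra.
have -> : e (- ((g%:R + 1) / 2)) = (G * b)^-1 by rewrite -eD -eN; congr e; lra.
have -> : \sum_(x <- SR | x \in P) e 1 ^+ (abs_ht x).-1 = S / e 1.
  rewrite mulr_suml big_seq_cond [RHS]big_seq_cond; apply: eq_bigr => x /andP[_ xP].
  by rewrite -{2}(prednK (abs_ht_gt0 H xP)) exprSr mulfK.
have -> : \sum_(x <- SR | x \in P) e 1 ^+ (abs_ht th - abs_ht x) = e 1 ^+ abs_ht th * Sb.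
  rewrite mulr_sumr big_seq_cond [RHS]big_seq_cond; apply: eq_bigr => x /andP[xS xP].
  rewrite -{2}(subnK (abs_ht_le H thS thd xS xP)) exprD mulfK //.
  by rewrite expf_neq0.
rewrite GE; have b0 : b != 0 by exact: e_neq0.
have G0 : G != 0 by exact: e_neq0.
set l := (n_short_simple A Wl d)%:R; set qH := e 1 ^+ abs_ht th; rewrite bE.
exact: duality_algebra.
Qed.

(** $c=1,2,\dots$ gives infinitely many values of $q$ at which every rational power is defined,
    enough to identify polynomials. *)
Definition expR_rat (c : nat) (a : rat) : R := exp (Rmult (ratr a) c%:R).

Lemma expR_ratD c a b : expR_rat c (a + b) = expR_rat c a * expR_rat c b.
Proof. by rewrite /expR_rat -[RHS]exp_plus -Rmult_plus_distr_r rmorphD. Qed.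

Lemma expR_rat_gt0 c a : 0 < expR_rat c a.
Proof. by apply/RltP/exp_pos. Qed.

Lemma expR_rat_inj c : injective (expR_rat c.+1).
Proof.
move=> a b /exp_inv E; apply: (fmorph_inj (@ratr R)).
have c0 : (c.+1%:R : R) != 0 by rewrite pnatr_eq0.
exact: (mulIf c0 E).
Qed.

Lemma poly_eq_expR (p q : {poly int}) :
  (forall c, (map_poly intr p).[expR_rat c.+1 1] = (map_poly intr q).[expR_rat c.+1 1]) -> p = q.
Proof.
move=> E; apply/eqP; rewrite -subr_eq0.
have inj : injective (intr : int -> R) by apply: intr_inj.
suff : map_poly (intr : int -> R) (p - q) = 0.
  by move=> E0; apply/eqP/(map_inj_poly inj) => //; rewrite E0 rmorph0.
set f := map_poly _ _.
apply: (@roots_geq_poly_eq0 _ f [seq expR_rat c.+1 1 | c <- iota 0 (size f)]).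
- by apply/allP => _ /mapP[c _ ->]; rewrite /root /f rmorphB hornerD hornerN E subrr.
- rewrite map_inj_uniq ?iota_uniq // => c c' /exp_inv.
  rewrite rmorph1 !Rmult_1_l => /eqP.
  by rewrite eqr_nat => /eqP[].
- by rewrite size_map size_iota.
Qed.

(** The bracket is $q^Hm^0(1/q)$ with $H=\mathrm{ht}(\theta_s)$, written without negative
    exponents. *)
Lemma duality (g : nat) : g%:R = dual_height A d Wl th ->
  mq A Wl th 0 * 'X^(abs_ht th) =
  'X^g * ((n_short_simple A Wl d)%:R * 'X^(abs_ht th) +
     (1 - 'X) * \sum_(x <- SR | x \in P) 'X^(abs_ht th - abs_ht x)).
Proof.
move=> gE; apply: poly_eq_expR => c.
have := evaluated_duality (expR_ratD c.+1) (expR_rat_gt0 c.+1) (@expR_rat_inj c) gE.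
rewrite (mq_theta0 H thS thd); set q := expR_rat _ _ => E.
pose ev : {rmorphism {poly int} -> R} := (@horner_eval R q \o map_poly (intr : int -> R))%FUN.
have evE p : (map_poly intr p).[q] = ev p by [].
have evX k : ev 'X^k = q ^+ k by rewrite -evE map_polyXn !hornerE.
rewrite !evE; clearbody ev.
have evX1 : ev 'X = q by rewrite -['X]expr1 evX.
rewrite !(rmorphM, rmorphD, rmorphB, rmorphN, rmorph1, rmorph_nat, rmorph_sum) !evX1 !evX.
by rewrite (eq_bigr _ (fun x _ => evX _)) [in RHS](eq_bigr _ (fun x _ => evX _)).
Qed.

End PolynomialDuality.

(** * Coxeter elements *)

Section DynkinGraph.
Variables (r : nat) (A : 'M[int]_r) (d : 'I_r -> rat) (Wl : seq 'M[rat]_r).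
Hypothesis H : cartan_datum A d Wl.
Implicit Types (x y : 'rV[rat]_r) (i j : 'I_r) (s t : seq 'I_r) (w u v : 'M[rat]_r).
Local Notation al := (@simple_root r).
Local Notation sr := (refl A).
Local Notation word := (word_mx A).
Let cartA := datum_cartan H.

Definition adjacent i j := (i != j) && (A i j != 0).

Lemma adjacentC i j : adjacent i j = adjacent j i.
Proof. by rewrite /adjacent eq_sym cartA.2.2. Qed.

(* A W-invariant sum of squares: unlike [form], it stays positive definite
   over any ordered field extension by its very shape. *)
Definition orbit_form x y : rat := \sum_(w <- Wl) \sum_k (x *m w) 0 k * (y *m w) 0 k.

Lemma orbit_formC x y : orbit_form x y = orbit_form y x.
Proof. by apply: eq_bigr => w _; apply: eq_bigr => k _; rewrite mulrC. Qed.

Lemma orbit_formBl x y (a : rat) (z : 'rV[rat]_r) :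
  orbit_form (x - a *: y) z = orbit_form x z - a * orbit_form y z.
Proof.
rewrite /orbit_form mulr_sumr -sumrB; apply: eq_bigr => w _.
rewrite mulr_sumr -sumrB; apply: eq_bigr => k _.
by rewrite mulmxBl -scalemxAl !mxE mulrBl mulrA.
Qed.

Lemma orbit_formNl x y : orbit_form (- x) y = - orbit_form x y.
Proof.
rewrite -sumrN; apply: eq_bigr => w _; rewrite -sumrN; apply: eq_bigr => k _.
by rewrite mulNmx mxE mulNr.
Qed.

Lemma orbit_form_refl x y i : orbit_form (x *m sr i) y = orbit_form x (y *m sr i).
Proof.
rewrite {1}/orbit_form -(perm_big _ (perm_weylMl H (weyl_refl H i))) big_map.
apply: eq_bigr => w _; apply: eq_bigr => k _.
by rewrite !mulmxA -(mulmxA x) (refl_invol cartA) mulmx1.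
Qed.

Lemma orbit_form_al i j :
  2 * orbit_form (al i) (al j) = (A i j)%:~R * orbit_form (al i) (al i).
Proof.
have := orbit_form_refl (al j) (al i) i; rewrite (al_refl H) reflE pair_al orbit_formBl.
rewrite (orbit_formC (al j) (- _)) orbit_formNl (orbit_formC (al j)); lra.
Qed.

Lemma orbit_form_gt0 i : 0 < orbit_form (al i) (al i).
Proof.
rewrite /orbit_form (bigD1_seq 1%:M) ?(weyl1 H) ?(weyl_uniq H) //=.
rewrite ltr_wpDr ?sumr_ge0 // => [w _|]; first by apply: sumr_ge0 => k _; apply: sqr_ge0.
rewrite mulmx1 (bigD1 i) //= !alE eqxx mulr1 ltr_wpDr ?ltr01 // sumr_ge0 // => k _.
exact: sqr_ge0.
Qed.

(** Normalize the simple roots to unit vectors for [orbit_form]; adjacent ones then have product at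
    most $-1/2$, and other distinct ones at most $0$. If every vertex of $T$ had two neighbours in
    $T$, the sum over $T$ of these unit vectors would have squared norm at most $0$. *)
Lemma leaf_exists (T : {set 'I_r}) : T != set0 ->
  exists2 i, i \in T & (#|[set j in T | adjacent i j]| <= 1)%N.
Proof.
move=> T0; apply/exists_inP; apply: contraT; rewrite negb_exists_in => /forall_inP deg.
pose K := Rdefinitions.R : rcfType.
pose c i : K := (Num.sqrt (ratr (orbit_form (al i) (al i))))^-1.
have c_gt0 i : 0 < c i by rewrite invr_gt0 sqrtr_gt0 ltr0q orbit_form_gt0.
have cE i : c i * c i * ratr (orbit_form (al i) (al i)) = 1.
  have o0 : 0 < ratr (orbit_form (al i) (al i)) :> K by rewrite ltr0q orbit_form_gt0.
  rewrite /c -[X in _ * X](sqr_sqrtr (ltW o0)) expr2 mulrACA mulVf ?mulr1 //.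
  by rewrite gt_eqF // sqrtr_gt0.
pose F i j : K := c i * c j * ratr (orbit_form (al i) (al j)).
have FC i j : F i j = F j i by rewrite /F orbit_formC (mulrC (c i)).
have Fii i : F i i = 1 by apply: cE.
have F2 i j : 2 * F i j = c i * c j * (A i j)%:~R * ratr (orbit_form (al i) (al i)).
  have := congr1 (ratr : rat -> K) (orbit_form_al i j).
  rewrite !rmorphM /= rmorph_nat ratr_int => E.
  by rewrite /F mulrCA E mulrA.
have F_le0 i j : i != j -> F i j <= 0.
  move=> ij; suff : 2 * F i j <= 0 by lra.
  rewrite F2 pmulr_lle0 ?ltr0q ?orbit_form_gt0 // pmulr_rle0 ?mulr_gt0 //.
  by rewrite lerz0 cartA.2.1.
have F_adj i j : adjacent i j -> F i j <= - (1 / 2).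
  move=> /andP[ij Aij]; have Fl := F_le0 _ _ ij.
  (* The normalizations cancel, leaving the integer $A_{ij}A_{ji}\ge1$. *)
  have sq : (2 * F i j) * (2 * F j i) = (A i j)%:~R * (A j i)%:~R.
    transitivity ((A i j)%:~R * (A j i)%:~R *
       ((c i * c i * ratr (orbit_form (al i) (al i))) *
        (c j * c j * ratr (orbit_form (al j) (al j))))); last by rewrite !cE !mulr1.
    by rewrite !F2; ring.
  have : 1 <= (2 * F i j) * (2 * F j i).
    rewrite sq -intrM (_ : 1 = 1%:~R) // ler_int.
    have := cartA.2.1 _ _ ij; have := cartA.2.1 j i; rewrite eq_sym => /(_ ij).
    by have : A j i != 0; [rewrite -cartA.2.2 | move: Aij; nia].
  by rewrite (FC j i); nra.
have pos : 0 < \sum_(i in T) \sum_(j in T) F i j.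
  have sqE : \sum_(i in T) \sum_(j in T) F i j =
      \sum_(w <- Wl) \sum_k (\sum_(i in T) c i * ratr ((al i *m w) 0 k)) ^+ 2.
    rewrite (eq_bigr (fun i => \sum_(w <- Wl) \sum_k \sum_(j in T)
       (c i * ratr ((al i *m w) 0 k)) * (c j * ratr ((al j *m w) 0 k)))); last first.
      move=> i _; rewrite (eq_bigr (fun j => \sum_(w <- Wl) \sum_k
        (c i * ratr ((al i *m w) 0 k)) * (c j * ratr ((al j *m w) 0 k)))).
        by rewrite exchange_big; apply: eq_bigr => w _; rewrite exchange_big.
      move=> j _; rewrite /F /orbit_form rmorph_sum mulr_sumr; apply: eq_bigr => w _.
      rewrite rmorph_sum mulr_sumr; apply: eq_bigr => k _.
      by rewrite rmorphM mulrACA.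
    rewrite exchange_big /=; apply: eq_bigr => w _.
    rewrite exchange_big /=; apply: eq_bigr => k _.
    by rewrite expr2 mulr_suml; apply: eq_bigr => i _; rewrite mulr_sumr.
  rewrite sqE (bigD1_seq 1%:M) ?(weyl1 H) ?(weyl_uniq H) //=.
  rewrite ltr_wpDr ?sumr_ge0 // => [w _|].
    by apply: sumr_ge0 => k _; apply: sqr_ge0.
  have [i iT] := set0Pn _ T0; rewrite (bigD1 i) //= ltr_wpDr //.
    by apply: sumr_ge0 => k _; apply: sqr_ge0.
  rewrite (bigD1 i iT) /= mulmx1 alE eqxx rmorph1 mulr1 big1 ?addr0 ?exprn_gt0 // => j /andP[_ ji].
  by rewrite mulmx1 alE eq_sym (negPf ji) rmorph0 mulr0.
suff : \sum_(i in T) \sum_(j in T) F i j <= 0 by rewrite leNgt pos.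
apply: sumr_le0 => i iT; rewrite (bigD1 i) //= Fii.
rewrite (bigID (adjacent i)) /=.
have E1 : \sum_(j in T | (j != i) && ~~ adjacent i j) F i j <= 0.
  by apply: sumr_le0 => j /and3P[_ ji _]; rewrite F_le0 // eq_sym.
have E2 : \sum_(j in T | (j != i) && adjacent i j) F i j <= - 1.
  have := deg i iT; rewrite -ltnNge => dg.
  apply: (@le_trans _ _ (\sum_(j in T | (j != i) && adjacent i j) (- (1 / 2)))).
    by apply: ler_sum => j /and3P[_ _]; apply: F_adj.
  rewrite (eq_bigl (mem [set j in T | adjacent i j])) => [|j]; last first.
    by rewrite /= inE /adjacent [i == j]eq_sym; case: (j == i); rewrite ?andbF.
  rewrite sumr_const.
  rewrite mulNrn lerN2 -[(1 / 2) *+ _]mulr_natr.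
  have : (2%:R : K) <= #|[set j in T | adjacent i j]|%:R by rewrite ler_nat.
  lra.
under eq_bigl => j do rewrite -andbA.
under [X in _ + (_ + X)]eq_bigl => j do rewrite -andbA.
lra.
Qed.

(** Moves under which the product of reflections stays in its conjugacy class
    ([word_equiv_conj]). *)
Inductive word_equiv : seq 'I_r -> seq 'I_r -> Prop :=
| WordRefl s : word_equiv s s
| WordSym s t : word_equiv s t -> word_equiv t s
| WordTrans s t t' : word_equiv s t -> word_equiv t t' -> word_equiv s t'
| WordRot a s : word_equiv (a :: s) (rcons s a)
| WordSwap s1 a b s2 : ~~ adjacent a b ->
    word_equiv (s1 ++ a :: b :: s2) (s1 ++ b :: a :: s2).

Lemma word_equiv_perm s t : word_equiv s t -> perm_eq s t.
Proof.
elim=> // {s t} [s t _|s t t' _ + _|a s|s1 a b s2 _].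
- by rewrite perm_sym.
- exact: perm_trans.
- by rewrite perm_sym perm_rcons.
by rewrite perm_cat2l; apply/permPl/(perm_catCA [:: a] [:: b]).
Qed.

Lemma word_equiv_rot k s : word_equiv s (rot k s).
Proof.
have [ks|sk] := leqP k (size s); last by rewrite rot_oversize ?(ltnW sk) //; apply: WordRefl.
elim: k ks => [|k IH] ks; first by rewrite rot0; apply: WordRefl.
rewrite rotS //; apply: WordTrans (IH (ltnW ks)) _.
case: (rot k s) => [|a t]; first by apply: WordRefl.
by rewrite rot1_cons; apply: WordRot.
Qed.

Lemma word_equiv_slide p i s q : {in s, forall b, ~~ adjacent i b} ->
  word_equiv (p ++ i :: s ++ q) (p ++ s ++ i :: q).
Proof.
elim: s p => [|b s IH] p sN; first exact: WordRefl.
apply: WordTrans (WordSwap p (s ++ q) (sN b (mem_head _ _))) _.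
have /(_ (rcons p b)) := IH; rewrite !cat_rcons; apply.
by move=> c cs; apply: sN; rewrite inE cs orbT.
Qed.

Definition leaf_of i s :=
  i \notin s /\ {in s &, forall a b, adjacent i a -> adjacent i b -> a = b}.

Lemma leaf_of_perm i s t : perm_eq s t -> leaf_of i s -> leaf_of i t.
Proof.
move=> /perm_mem st [iN ii]; split; first by rewrite -st.
by move=> a b; rewrite -!st; apply: ii.
Qed.

(** Only a rotation of [a :: s] needs care. If $i$ commutes with $a$, swap them and rotate $a$ away.
    Otherwise $a$ is the one neighbour of $i$: rotate $i$ to the end, slide it back through $s$,
    then rotate $a$. *)
Lemma word_equiv_cons i s t : uniq s -> leaf_of i s -> word_equiv s t ->
  word_equiv (i :: s) (i :: t).
Proof.
move=> us ls st; elim: st us ls => {s t} [s|s t st IH|s t t' st IH1 tt' IH2|a s|s1 a b s2 ab] us ls.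
- exact: WordRefl.
- have p := word_equiv_perm st; apply/WordSym/IH; first by rewrite (perm_uniq p).
  by apply: leaf_of_perm ls; rewrite perm_sym.
- have p := word_equiv_perm st; apply: WordTrans (IH1 us ls) (IH2 _ _).
    by rewrite -(perm_uniq p).
  exact: leaf_of_perm ls.
- have [ia|ia] := boolP (adjacent i a); last first.
    apply: WordTrans (WordSwap [::] s ia) _.
    by rewrite -rcons_cons; apply: WordRot.
  apply: WordTrans (WordRot i (a :: s)) _.
  have sN : {in s, forall b, ~~ adjacent i b}.
    move=> b bs; apply: contraL us => ib /=.
    have -> : a = b by apply: ls.2 => //; rewrite inE ?eqxx ?bs ?orbT.
    by rewrite bs.
  have := WordSym (word_equiv_slide [:: a] [::] sN); rewrite cats0 /= -cats1 => E.
  by apply: WordTrans E _; rewrite -rcons_cons; apply: WordRot.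
by rewrite -!cat_cons; apply: WordSwap.
Qed.

Lemma leaf_word s : s != [::] -> exists2 i, i \in s & leaf_of i (rem i s) \/ ~~ uniq s.
Proof.
move=> s0; have [us|] := boolP (uniq s); last first.
  by case: s s0 => // a s _ nu; exists a; rewrite ?mem_head //; right.
have [|i iT c1] := @leaf_exists [set i in s].
  by case: s s0 us => // a s _ _; apply/set0Pn; exists a; rewrite inE mem_head.
rewrite inE in iT; exists i => //; left; split; first by rewrite mem_rem_uniqF.
move=> a b /mem_rem as_ /mem_rem bs ia ib; apply/eqP; apply: contraTT c1 => ab.
rewrite -ltnNge; have -> : 2%N = #|[set a; b]| by rewrite cards2 ab.
by apply/subset_leq_card/subsetP => c; rewrite !inE => /orP[]/eqP->; rewrite ?as_ ?bs.
Qed.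

(** Rotate a leaf to the front of both words and compare the remainders by induction. *)
Lemma word_equiv_uniq s t : uniq s -> perm_eq s t -> word_equiv s t.
Proof.
have [k] := ubnP (size s); elim: k s t => // k IH s t sk us st.
have [s0|s0] := eqVneq s [::].
  by move: st; rewrite s0 perm_sym => /perm_nilP->; apply: WordRefl.
have [i is_ [ls|]] := leaf_word s0; last by rewrite us.
have toFront z : uniq z -> i \in z -> exists2 z', word_equiv z (i :: z') & perm_eq z' (rem i z).
  move=> uz iz; have /rot_to[m z' E] := iz.
  exists z'; first by rewrite -E; apply: word_equiv_rot.
  rewrite -(perm_cons i) -E perm_rot; exact: perm_to_rem.
have it : i \in t by rewrite -(perm_mem st).
have ut : uniq t by rewrite -(perm_uniq st).
have [s' ss' s'p] := toFront s us is_; have [t' tt' t'p] := toFront t ut it.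
have ust : perm_eq s' t'.
  rewrite (permPl s'p) perm_sym (permPl t'p) perm_sym.
  by rewrite -(perm_cons i) -(permPl (perm_to_rem is_)) -(permPr (perm_to_rem it)).
have us' : uniq s' by rewrite (perm_uniq s'p) rem_uniq.
apply: WordTrans ss' (WordTrans _ (WordSym tt')).
apply: word_equiv_cons => //.
  by apply: leaf_of_perm ls; rewrite perm_sym.
apply: IH => //; rewrite (perm_size s'p) size_rem //.
by rewrite prednK // lt0n size_eq0.
Qed.

Lemma refl_comm i j : ~~ adjacent i j -> sr i *m sr j = sr j *m sr i.
Proof.
rewrite negb_and !negbK; have [->//|ij] := eqVneq i j => /= /eqP Aij.
have Aji : A j i = 0 by apply/eqP; rewrite cartA.2.2 Aij.
apply/row_matrixP => k; rewrite !rowE !mulmxA !reflE !pairB !pairZ !pair_al Aij Aji.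
by apply/rowP => l; rewrite !mxE; ring.
Qed.

Lemma word_equiv_conj s t : word_equiv s t ->
  exists2 u, u \in Wl & word s *m u = u *m word t.
Proof.
elim=> {s t} [s|s t _ [u uW E]|s t t' _ [u uW E] _ [v vW E']|a s|s1 a b s2 ab].
- by exists 1%:M; rewrite ?(weyl1 H) // mulmx1 mul1mx.
- exists (invmx u); first exact: (weylV H).
  by rewrite -[LHS](mulKmx (weyl_unit H uW)) [u *m (_ *m _)]mulmxA -E mulmxK ?(weyl_unit H).
- by exists (u *m v); rewrite ?(weylM H) // mulmxA E -mulmxA E' mulmxA.
- by exists (sr a); rewrite ?(weyl_refl H) // -cats1 word_cat /= mulmx1 mulmxA.
exists 1%:M; rewrite ?(weyl1 H) // mulmx1 mul1mx !word_cat /=.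
by rewrite !(mulmxA (sr _) (sr _)) refl_comm.
Qed.

Lemma colouring : exists col : 'I_r -> bool, forall i j, adjacent i j -> col i != col j.
Proof.
suff P (s : seq 'I_r) : uniq s -> exists col : 'I_r -> bool,
    {in s &, forall i j, adjacent i j -> col i != col j}.
  have [col cP] := P _ (enum_uniq 'I_r); exists col => i j.
  by apply: cP; rewrite mem_enum.
have [k] := ubnP (size s); elim: k s => // k IH s sk us.
have [->|s0] := eqVneq s [::]; first by exists xpred0.
have [i is_ [[_ li]|]] := leaf_word s0; last by rewrite us.
have [||col cP] := IH (rem i s); last 1 first.
(* The leaf receives the colour opposite to that of its only neighbour, if it has one. *)
- exists (fun j => if j == i then ~~ has (fun a => adjacent i a && col a) (rem i s) else col j).
  have nb a : a \in s -> a != i -> adjacent i a ->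
      has (fun a => adjacent i a && col a) (rem i s) = col a.
    move=> as_ ai ia; have ar : a \in rem i s by rewrite mem_rem_uniq // inE ai.
    apply/hasP/idP => [[b br /andP[ib cb]]|ca]; last by exists a; rewrite ?ia.
    by rewrite (li a b).
  move=> a b as_ bs ab; have anb : a != b by case/andP: ab.
  have [ai|ai] := eqVneq a i.
    have bi : b != i by rewrite -ai eq_sym.
    by rewrite (negPf bi) (nb b) // -?ai //; case: (col b).
  have [bi|bi] := eqVneq b i.
    by rewrite (nb a) // -?bi 1?adjacentC //; case: (col a).
  by apply: cP => //; rewrite mem_rem_uniq // inE ?ai ?bi.
- by rewrite size_rem // prednK // lt0n size_eq0.
- exact: rem_uniq.
Qed.

End DynkinGraph.

(** * Perron-Frobenius vectors *)

Section PerronFrobenius.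
Variables (C : numClosedFieldType) (n : nat) (S : 'M[C]_n).
Hypothesis n_gt0 : (0 < n)%N.
Hypothesis S_ge0 : forall i j, 0 <= S i j.
Hypothesis S_sym : forall i j, S i j = S j i.
Hypothesis S_irr : forall T : {set 'I_n}, T != set0 -> T != setT ->
  exists i j, [/\ i \in T, j \notin T & S i j != 0].
Local Notation "M ^t*" := (map_mx Num.conj (M^T)) (at level 30).
Local Notation U := (spectralmx S).
Local Notation sp := (spectral_diag S).

Lemma S_herm : S \is hermsymmx.
Proof.
apply/is_hermitianmxP; rewrite expr0 scale1r; apply/matrixP => i j.
by rewrite !mxE S_sym conj_Creal // ger0_real.
Qed.

Lemma S_spectral : S = U ^t* *m diag_mx sp *m U.
Proof.
rewrite -(invmx_unitary (spectral_unitarymx S)).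
exact/orthomx_spectralP/hermitian_normalmx/S_herm.
Qed.

Lemma U_unitary : U *m U ^t* = 1%:M.
Proof. exact/unitarymxP/spectral_unitarymx. Qed.

Lemma U_unitary' : U ^t* *m U = 1%:M.
Proof. exact: mulmx1C U_unitary. Qed.

Lemma sp_real k : sp 0 k \is Num.real.
Proof. by have /mxOverP := hermitian_spectral_diag_real S_herm; apply. Qed.

Lemma quad_spectral (x : 'rV[C]_n) : (x *m S *m x ^t*) 0 0 =
  \sum_k sp 0 k * `|(x *m U ^t*) 0 k| ^+ 2.
Proof.
have -> : x *m S *m x ^t* = (x *m U ^t*) *m diag_mx sp *m (x *m U ^t*) ^t*.
  rewrite {1}S_spectral !mulmxA trmx_mul map_mxM !mulmxA; congr (_ *m _ *m _).
  exact/esym/trmxCK.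
rewrite mxE; apply: eq_bigr => k _.
by rewrite mul_mx_diag !mxE normCK mulrAC mulrC.
Qed.

Lemma norm_spectral (x : 'rV[C]_n) :
  \sum_i `|x 0 i| ^+ 2 = \sum_k `|(x *m U ^t*) 0 k| ^+ 2.
Proof.
have nE (y : 'rV[C]_n) : \sum_i `|y 0 i| ^+ 2 = (y *m y ^t*) 0 0.
  by rewrite mxE; apply: eq_bigr => i _; rewrite !mxE normCK.
rewrite !nE trmx_mul map_mxM -!mulmxA; congr ((_ *m _) 0 0).
rewrite !mulmxA (_ : _ *m _ = 1%:M) ?mul1mx //.
rewrite -[RHS]U_unitary'; congr (_ *m _).
exact: trmxCK.
Qed.

Lemma quadE (x : 'rV[C]_n) :
  (x *m S *m x ^t*) 0 0 = \sum_j \sum_i x 0 i * S i j * Num.conj (x 0 j).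
Proof.
by rewrite mxE; apply: eq_bigr => j _; rewrite !mxE mulr_suml.
Qed.

(* The top eigenvector u may be replaced by |u|, whose Rayleigh quotient is at
   least as large. *)
Lemma perron_frobenius : exists lam, exists u : 'rV[C]_n,
  (forall i, 0 < u 0 i) /\ u *m S = lam *: u.
Proof.
pose k1 := Ordinal n_gt0.
have [k0 _ kmax] := @real_arg_maxP _ _ k1 xpredT (fun k => sp 0 k) isT (fun k _ => sp_real k).
pose lam := sp 0 k0; pose u := row k0 U; exists lam.
have uS : u *m S = lam *: u.
  have US : U *m S = diag_mx sp *m U by rewrite {2}S_spectral !mulmxA U_unitary mul1mx.
  by rewrite -row_mul US row_mul row_diag_mx -scalemxAl -rowE.
have lam_real : lam \is Num.real by apply: sp_real.
pose v : 'rV[C]_n := \row_i `|u 0 i|; exists v.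
have v_ge0 i : 0 <= v 0 i by rewrite mxE.
have norm_uv : \sum_i `|v 0 i| ^+ 2 = \sum_i `|u 0 i| ^+ 2.
  by apply: eq_bigr => i _; rewrite mxE normr_id.
have quad_le : lam * \sum_i `|v 0 i| ^+ 2 <= (v *m S *m v ^t*) 0 0.
  have uE : (u *m S *m u ^t*) 0 0 = lam * \sum_i `|v 0 i| ^+ 2.
    rewrite norm_uv uS -scalemxAl !mxE; congr (_ * _).
    by apply: eq_bigr => i _; rewrite !mxE normCK.
  have q_ge0 : 0 <= (v *m S *m v ^t*) 0 0.
    rewrite quadE; do 2 apply: sumr_ge0 => ? _.
    by rewrite !mulr_ge0 // conjC_ge0.
  have : `|(u *m S *m u ^t*) 0 0| <= (v *m S *m v ^t*) 0 0.
    rewrite !quadE; apply: le_trans (ler_norm_sum _ _ _) _; apply: ler_sum => j _.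
    apply: le_trans (ler_norm_sum _ _ _) _; apply: ler_sum => i _.
    by rewrite !normrM norm_conjC !mxE (ger0_norm (S_ge0 i j)) conj_normC.
  rewrite uE; apply: le_trans; apply: real_ler_norm.
  by rewrite realM // ger0_real // sumr_ge0 // => i _; rewrite exprn_ge0.
(* The Rayleigh quotient of $v$ reaches the largest eigenvalue, so $v$ has no component on smaller
   ones. *)
have vk0 k : (lam - sp 0 k) * `|(v *m U ^t*) 0 k| ^+ 2 = 0.
  have ge0 j : 0 <= (lam - sp 0 j) * `|(v *m U ^t*) 0 j| ^+ 2.
    rewrite mulr_ge0 ?exprn_ge0 // subr_ge0; exact: kmax.
  have : \sum_j (lam - sp 0 j) * `|(v *m U ^t*) 0 j| ^+ 2 == 0.
    rewrite eq_le sumr_ge0 ?andbT //.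
    under eq_bigr => j _ do rewrite mulrBl.
    by rewrite sumrB -mulr_sumr -norm_spectral -quad_spectral subr_le0.
  by rewrite psumr_eq0 // => /allP/(_ k (mem_index_enum k))/eqP.
have vS : v *m S = lam *: v.
  have E : (v *m U ^t*) *m diag_mx sp = lam *: (v *m U ^t*).
    apply/rowP => k; rewrite mul_mx_diag !mxE -/(v *m U ^t*).
    have /eqP := vk0 k; rewrite mulf_eq0 subr_eq0 expf_eq0 normr_eq0 /= mxE.
    by case/orP => /eqP ->; rewrite ?mul0r ?mulr0 // mulrC.
  by rewrite {1}S_spectral !mulmxA E -scalemxAl -mulmxA U_unitary' mulmx1.
split=> // i.
(* A proper support would have a nonzero entry of $S$ leading to a coordinate where $v$ vanishes,
   contradicting $vS=\lambda v$ there. *)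
pose T := [set i | 0 < v 0 i].
have T0 : T != set0.
  apply/eqP => TE.
  have v0 j : v 0 j = 0.
    have : j \notin T by rewrite TE inE.
    by rewrite inE lt_neqAle v_ge0 andbT negbK => /eqP.
  have : \sum_j `|u 0 j| ^+ 2 = 1.
    have := congr1 (fun M : 'M[C]_n => M k0 k0) U_unitary; rewrite !mxE eqxx /= => E.
    by apply: etrans E; apply: eq_bigr => j _; rewrite !mxE normCK.
  rewrite -norm_uv big1 => [/esym/eqP|j _]; first by rewrite oner_eq0.
  by rewrite v0 normr0 expr0n.
have [TT|TT] := eqVneq T setT; first by have := in_setT i; rewrite -TT inE.
have [a [b [aT bT Sab]]] := S_irr T0 TT.
have vb : v 0 b = 0 by move: bT; rewrite inE lt_neqAle v_ge0 andbT negbK => /eqP.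
have := congr1 (fun M : 'rV[C]_n => M 0 b) vS; rewrite [RHS]mxE vb mulr0 mxE => /eqP.
rewrite psumr_eq0 => [/allP/(_ a (mem_index_enum a))|j _]; last by rewrite mulr_ge0.
by rewrite /= mulf_eq0 (negPf Sab) orbF gt_eqF //; move: aT; rewrite inE.
Qed.

End PerronFrobenius.

Section MatrixPower.
Variables (R : pzRingType) (n : nat).
Implicit Types M N : 'M[R]_n.

Definition mpow M k : 'M[R]_n := iter k (mulmx M) 1%:M.

Lemma mpowS M k : mpow M k.+1 = M *m mpow M k. Proof. by []. Qed.

Lemma mpowD M k l : mpow M (k + l) = mpow M k *m mpow M l.
Proof. by elim: k => [|k IH]; rewrite ?mul1mx // addSn !mpowS IH mulmxA. Qed.

Lemma mpowSr M k : mpow M k.+1 = mpow M k *m M.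
Proof. by rewrite -addn1 mpowD mpowS mulmx1. Qed.

Lemma mpow_shift M N k : M *m mpow (N *m M) k = mpow (M *m N) k *m M.
Proof.
elim: k => [|k IH]; first by rewrite mulmx1 mul1mx.
by rewrite !mpowS !mulmxA -!mulmxA -IH !mulmxA.
Qed.

Lemma mpow_conj M N U k : M *m U = U *m N ->
  mpow M k *m U = U *m mpow N k.
Proof.
move=> E; elim: k => [|k IH]; first by rewrite mulmx1 mul1mx.
by rewrite !mpowS -mulmxA IH !mulmxA E.
Qed.

End MatrixPower.

(** * The bipartite Coxeter element and the longest element *)

Section Bipartite.
Variables (r : nat) (A : 'M[int]_r) (d : 'I_r -> rat) (Wl : seq 'M[rat]_r).
Hypothesis H : cartan_datum A d Wl.
Implicit Types (x y : 'rV[rat]_r) (i j : 'I_r) (s t : seq 'I_r) (w u : 'M[rat]_r) (b : bool).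
Local Notation al := (@simple_root r).
Local Notation sr := (refl A).
Local Notation word := (word_mx A).
Local Notation P := (pos_roots Wl).
Let symA := datum_sym H.
Let cartA := datum_cartan H.

(** $2-A$ is nonnegative and irreducible; conjugation by the diagonal matrix of $\sqrt{d_i}$ makes
    it symmetric. *)
Lemma perron_cartan (C : numClosedFieldType) : (0 < r)%N ->
  exists lam, exists v : 'I_r -> C, (forall i, 0 < v i) /\
    forall j, \sum_i v i * ((i == j)%:R * 2 - (A i j)%:~R) = lam * v j.
Proof.
move=> r0; pose B i j : C := (i == j)%:R * 2 - (A i j)%:~R.
pose D i : C := sqrtC (ratr (d i)).
have D_gt0 i : 0 < D i by rewrite sqrtC_gt0 ltr0q (d_gt0 symA).
have DD i : D i * D i = ratr (d i) by rewrite -expr2 sqrtCK.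
have Bij i j : i != j -> B i j = - (A i j)%:~R.
  by move=> /negPf ij; rewrite /B ij mul0r sub0r.
have Bii i : B i i = 0 by rewrite /B eqxx mul1r cartA.1 subrr.
have B_ge0 i j : 0 <= B i j.
  have [->|ij] := eqVneq i j; first by rewrite Bii.
  by rewrite Bij // oppr_ge0 lerz0 cartA.2.1.
have B_sym i j : D i * D i * B i j = D j * D j * B j i.
  have [->//|ij] := eqVneq i j; have ji : j != i by rewrite eq_sym.
  rewrite (Bij _ _ ij) (Bij _ _ ji) !mulrN !DD; congr (- _).
  by have := congr1 (ratr : rat -> C) (symA.2 i j); rewrite !rmorphM /= !ratr_int.
have [||||lam [u [u0 uE]]] := @perron_frobenius C r (\matrix_(i, j) (D i * B i j / D j)).
- by [].
- by move=> i j; rewrite mxE divr_ge0 ?mulr_ge0 // ltW.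
- move=> i j; rewrite !mxE; apply/eqP; rewrite eqr_div ?lt0r_neq0 //; apply/eqP.
  by rewrite mulrAC B_sym mulrAC.
- move=> T T0 T1; have [i [j [iT jT Aij]]] := datum_indec H T0 T1; exists i, j; split=> //.
  have ij : i != j by apply: contraNneq jT => <-.
  have D0 k : D k != 0 by apply: lt0r_neq0.
  by rewrite mxE Bij // mulf_eq0 mulf_eq0 invr_eq0 oppr_eq0 intr_eq0 !(negPf (D0 _)) (negPf Aij).
exists lam, (fun i => u 0 i * D i); split=> [i|j]; first by rewrite mulr_gt0.
have := congr1 (fun M : 'rV[C]_r => M 0 j) uE; rewrite !mxE => E.
rewrite mulrA -E mulr_suml; apply: eq_bigr => i _.
by rewrite mxE !mulrA divfK ?lt0r_neq0.
Qed.

Variable col : 'I_r -> bool.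
Hypothesis colP : forall i j, adjacent A i j -> col i != col j.

Definition colour_class b := [seq i <- enum 'I_r | col i == b].
Local Notation cx b := (word (colour_class b)).

Lemma colour_A i j : i != j -> col i = col j -> A i j = 0.
Proof.
move=> ij ci; apply/eqP; apply: contraT => Aij.
by have := @colP i j; rewrite /adjacent ij Aij ci eqxx => /(_ isT).
Qed.

Lemma colour_class_col b i : i \in colour_class b -> col i = b.
Proof. by rewrite mem_filter => /andP[/eqP]. Qed.

Lemma colour_class_uniq b : uniq (colour_class b).
Proof. exact/filter_uniq/enum_uniq. Qed.

Lemma word_colour s b x : uniq s -> {in s, forall i, col i = b} ->
  x *m word s = x - \sum_(i <- s) pair A i x *: al i.
Proof.
elim: s x => [|a s IH] x; first by rewrite big_nil subr0 mulmx1.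
move=> /= /andP[as_ us] sb; rewrite mulmxA IH // => [|i is_]; last by rewrite sb // inE is_ orbT.
rewrite big_cons reflE opprD addrA; congr (_ - _).
apply: eq_big_seq => i is_; congr (_ *: _); rewrite pairB pairZ pair_al colour_A.
- by rewrite mulr0 subr0.
- by apply: contraNneq as_ => <-.
by rewrite !sb // inE ?eqxx ?is_ ?orbT.
Qed.

Lemma cxE b x : x *m cx b = x - \sum_(i | col i == b) pair A i x *: al i.
Proof.
rewrite (@word_colour _ b) ?colour_class_uniq //; last exact: colour_class_col.
by rewrite big_filter big_enum_cond.
Qed.

Lemma al_cx b i : col i = b -> al i *m cx b = - al i.
Proof.
move=> ib; rewrite cxE (bigD1 i) /= ?ib ?eqxx // big1 => [|j /andP[/eqP jb ji]].
  by rewrite pair_al (Aii cartA) addr0; apply/rowP => k; rewrite !mxE; ring.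
by rewrite pair_al colour_A ?scale0r // jb ib.
Qed.

Lemma cx_weyl b : cx b \in Wl. Proof. exact: (weyl_word H). Qed.

Lemma pair_cx b i x : col i = b -> pair A i (x *m cx b) = - pair A i x.
Proof.
move=> ib; rewrite cxE pairB (big_morph _ (@pairD _ A i) (@pair0 _ A i)).
rewrite (bigD1 i) /= ?ib ?eqxx // pairZ pair_al (Aii cartA) big1 => [|j /andP[/eqP jb ji]].
  by rewrite addr0; ring.
by rewrite pairZ pair_al colour_A ?mulr0 // 1?eq_sym // jb.
Qed.

Lemma cx_invol b : cx b *m cx b = 1%:M.
Proof.
apply/row_matrixP => k; rewrite !rowE mulmxA mulmx1 cxE.
rewrite (eq_bigr (fun i => - (pair A i (delta_mx 0 k) *: al i))) => [|i /eqP ib]; last first.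
  by rewrite pair_cx // scaleNr.
by rewrite sumrN opprK cxE subrK.
Qed.

Section Sign.
Variables (C : numClosedFieldType) (lam : C) (v : 'I_r -> C).
Hypothesis v_gt0 : forall i, 0 < v i.
Hypothesis vE : forall j, \sum_i v i * ((i == j)%:R * 2 - (A i j)%:~R) = lam * v j.

(* When [v] is the Perron-Frobenius vector, these forms make up a plane stable
   under both colours. *)
Definition plane_form (X : bool -> C) x : C := \sum_j ratr (x 0 j) * (X (col j) * v j).

(** The action of the colour [b] on the plane in the coordinates [X]; [lam] couples the two
    colours. *)
Definition plane_refl b (X : bool -> C) : bool -> C :=
  fun c => if c == b then - X b else X c + lam * X b.

Lemma colour_sum b j : \sum_(i | col i == b) (A i j)%:~R * v i =
  if col j == b then 2 * v j else - (lam * v j).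
Proof.
case: ifPn => [jb|jb].
  rewrite (bigD1 j) //= cartA.1 big1 ?addr0 // => i /andP[/eqP ib ij].
  by rewrite colour_A ?mul0r // ib (eqP jb).
rewrite -vE [in RHS](bigID (fun i => col i == b)) /= [X in _ + X]big1 ?addr0; last first.
  move=> i ib; have [->|ij] := eqVneq i j.
    by rewrite /= cartA.1 mul1r subrr mulr0.
  rewrite colour_A //; last by move: ib jb; case: (col i); case: (col j); case: b.
  by rewrite /= mul0r subr0 mulr0.
rewrite -sumrN; apply: eq_bigr => i ib.
have ij : i != j by apply: contraNneq jb => <-.
by rewrite (negPf ij) mul0r sub0r mulrN opprK mulrC.
Qed.

Lemma plane_form_cx b X x : plane_form X (x *m cx b) = plane_form (plane_refl b X) x.
Proof.
have -> : plane_form X (x *m cx b) = plane_form X x -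
    \sum_(i | col i == b) ratr (pair A i x) * (X b * v i).
  rewrite cxE /plane_form.
  rewrite (eq_bigr (fun j => ratr (x 0 j) * (X (col j) * v j) -
     \sum_(i | col i == b) ratr (pair A i x) * (j == i)%:R * (X (col j) * v j))).
    rewrite sumrB; congr (_ - _); rewrite exchange_big; apply: eq_bigr => i ib /=.
    rewrite (bigD1 i) //= eqxx mulr1 big1 ?addr0 ?(eqP ib) // => j /negPf->.
    by rewrite mulr0 mul0r.
  move=> j _; rewrite !mxE rmorphB /= mulrBl summxE rmorph_sum mulr_suml; congr (_ - _).
  by apply: eq_bigr => i _; rewrite !mxE rmorphM /= rmorph_nat.
rewrite (eq_bigr (fun i => \sum_j ratr (x 0 j) * ((A i j)%:~R * v i * X b))); last first.
  move=> i _; rewrite /pair rmorph_sum mulr_suml; apply: eq_bigr => j _.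
  by rewrite rmorphM /= ratr_int; ring.
rewrite exchange_big /= /plane_form -sumrB; apply: eq_bigr => j _.
rewrite -mulr_sumr -mulrBr -mulr_suml colour_sum /plane_refl; congr (_ * _).
by case: ifP => [/eqP ->|_]; ring.
Qed.

(** Pulling the positive form back by $w$ stays in the plane, so its values on simple roots have
    signs depending on the colour alone. *)
Definition uniform w := exists X, forall x, plane_form (fun=> 1) (x *m w) = plane_form X x.

Lemma uniform1 : uniform 1%:M.
Proof. by exists (fun=> 1) => x; rewrite mulmx1. Qed.

Lemma uniform_cx b w : uniform w -> uniform (cx b *m w).
Proof.
case=> X XE; exists (plane_refl b X) => x.
by rewrite mulmxA XE plane_form_cx.
Qed.

Lemma plane_form_pos x : x \in P -> 0 < plane_form (fun=> 1) x.
Proof.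
move=> xP; have ge0 j : 0 <= ratr (x 0 j) * (1 * v j) :> C.
  by rewrite mul1r mulr_ge0 ?ler0q ?(pos_ge0 j xP) // ltW.
rewrite lt_neqAle sumr_ge0 // andbT eq_sym psumr_eq0 //; apply/allPn.
have /existsP[j xj] : [exists j, 0 < x 0 j].
  apply: contraTT (ht_pos_gt0 H xP) => /existsPn N.
  by rewrite -leNgt; apply: sumr_le0 => j _; rewrite leNgt.
exists j; rewrite ?mem_index_enum //= mul1r mulf_neq0 ?lt0r_neq0 //.
by rewrite ltr0q.
Qed.

(** The form takes the value $X(c)v_k$ on $\alpha_kw$, where $c$ is the colour of $k$; it is
    positive on positive roots and $v_k>0$, so its sign decides that of $\alpha_kw$. *)
Lemma uniform_sign w i j : w \in Wl -> uniform w -> col i = col j ->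
  al i *m w \in P -> al j *m w \in P.
Proof.
move=> wW [X XE] cij iP.
have valE k : plane_form (fun=> 1) (al k *m w) = X (col k) * v k.
  rewrite XE /plane_form (bigD1 k) //= alE eqxx rmorph1 mul1r big1 ?addr0 // => l lk.
  by rewrite alE (negPf lk) rmorph0 mul0r.
have Xj : 0 < X (col j).
  by have := plane_form_pos iP; rewrite valE pmulr_lgt0 // cij.
apply: contraT; rewrite (rootNpos H) ?(root_weyl H) ?(root_al H) // => /plane_form_pos.
rewrite -mulNmx XE /plane_form.
rewrite (eq_bigr (fun k => - (ratr (al j 0 k) * (X (col k) * v k)))); last first.
  by move=> k _; rewrite mxE rmorphN mulNr.
rewrite sumrN -/(plane_form X (al j)) -XE valE oppr_gt0 => /lt_trans/(_ (mulr_gt0 Xj (v_gt0 j))).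
by rewrite ltxx.
Qed.

End Sign.

Section Count.
Variable Z : pred 'rV[rat]_r.
Hypothesis Z_refl : forall x i, Z (x *m sr i) = Z x.
Hypothesis ZN : forall x, Z (- x) = Z x.

(** Counting inside an invariant set of roots: all roots serve to bound lengths, the short roots to
    compute them. *)
Definition inv_countZ w : nat := count (fun x => Z x && (x *m w \notin P)) P.
Definition colour_size b : nat := \sum_(i | col i == b) Z (al i).

Lemma inv_countZE w : inv_countZ w = (\sum_(x <- P) (Z x && (x *m w \notin P)))%N.
Proof. by rewrite /inv_countZ -sum1_count big_mkcond. Qed.

Lemma inv_countZ1 : inv_countZ 1%:M = 0%N.
Proof.
rewrite inv_countZE big1_seq // => x /andP[_ xP].
by rewrite mulmx1 xP andbF.
Qed.

Lemma inv_countZ_sr i w :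
  inv_countZ (sr i *m w) = ((Z (al i) && (- (al i *m w) \notin P)) +
    \sum_(x <- rem (al i) P) (Z x && (x *m w \notin P)))%N.
Proof.
rewrite inv_countZE -mulNmx -ZN.
rewrite -(pos_big_refl H _ (fun x => (Z x && (x *m w \notin P)) : nat)).
by apply: eq_bigr => x _; rewrite mulmxA Z_refl.
Qed.

Lemma inv_countZ_al i w :
  inv_countZ w = ((Z (al i) && (al i *m w \notin P)) +
    \sum_(x <- rem (al i) P) (Z x && (x *m w \notin P)))%N.
Proof. by rewrite inv_countZE (pos_big_al H _ _ i). Qed.

Lemma inv_countZ_refl i w : al i *m w \in P ->
  inv_countZ (sr i *m w) = (Z (al i) + inv_countZ w)%N.
Proof.
move=> aP; rewrite inv_countZ_sr (inv_countZ_al i w) aP andbF add0n.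
by rewrite (posN_F H) // andbT.
Qed.

Lemma inv_countZ_refl_le i w : (inv_countZ (sr i *m w) <= Z (al i) + inv_countZ w)%N.
Proof.
rewrite inv_countZ_sr (inv_countZ_al i w) addnA leq_add2r.
by apply: leq_trans (leq_addr _ _); case: (Z _) => //=; apply: leq_b1.
Qed.

Lemma inv_countZ_word_le s : (inv_countZ (word s) <= \sum_(i <- s) Z (al i))%N.
Proof.
elim: s => [|i s IH]; first by rewrite inv_countZ1.
by rewrite big_cons; apply: leq_trans (inv_countZ_refl_le _ _) _; rewrite leq_add2l.
Qed.

Lemma inv_countZ_colour b w : (forall i, col i = b -> al i *m w \in P) ->
  inv_countZ (cx b *m w) = (colour_size b + inv_countZ w)%N.
Proof.
move=> wP.
suff E s : uniq s -> {in s, forall i, col i = b} ->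
    inv_countZ (word s *m w) = (\sum_(i <- s) Z (al i) + inv_countZ w)%N.
  rewrite E ?colour_class_uniq //; last exact: colour_class_col.
  by rewrite big_filter big_enum_cond.
elim: s => [|a s IH] /=; first by rewrite big_nil mul1mx.
move=> /andP[as_ us] sb; have sb' : {in s, forall i, col i = b}.
  by move=> i is_; rewrite sb // inE is_ orbT.
rewrite -mulmxA inv_countZ_refl ?IH ?big_cons ?addnA // mulmxA (@word_colour _ b) //.
rewrite big1_seq ?subr0 ?wP ?sb ?mem_head // => i /andP[_ is_].
rewrite pair_al colour_A ?scale0r //; first by apply: contraNneq as_ => <-.
by rewrite !sb // inE ?eqxx ?is_ ?orbT.
Qed.

End Count.

(** The rightmost factor has colour [b]; further factors are added on the left, where they act first
    on row vectors. *)
Fixpoint alternate b k : 'M[rat]_r :=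
  if k is k'.+1 then cx (b (+) odd k') *m alternate b k' else 1%:M.

Lemma alternate_weyl b k : alternate b k \in Wl.
Proof. by elim: k => [|k IH] /=; rewrite ?(weyl1 H) // (weylM H) ?cx_weyl. Qed.

Lemma alternate_even b k : alternate b k.*2 = mpow (cx (~~ b) *m cx b) k.
Proof.
elim: k => [|k IH] //; rewrite doubleS /= odd_double addbF addbT -/(alternate b k.*2) IH.
by rewrite mulmxA.
Qed.

Lemma alternate_odd b k : alternate b k.*2.+1 = cx b *m mpow (cx (~~ b) *m cx b) k.
Proof. by rewrite /= odd_double addbF -/(alternate b k.*2) alternate_even. Qed.

Lemma sum_alternate (F : bool -> nat) b k :
  (\sum_(l < k.*2) F (b (+) odd l) = k * (F true + F false))%N.
Proof.
elim: k => [|k IH]; first by rewrite big_ord0.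
rewrite doubleS !big_ord_recr /= IH odd_double addbF addbT.
by rewrite mulSn -addnA addnC; congr (_ + _)%N; case: (b); rewrite // addnC.
Qed.

Lemma sum_alternate_odd (F : bool -> nat) b k :
  (\sum_(l < k.*2.+1) F (b (+) odd l) = k * (F true + F false) + F b)%N.
Proof. by rewrite big_ord_recr /= sum_alternate odd_double addbF. Qed.

Lemma alternate_uniform (C : numClosedFieldType) (lam : C) v :
  (forall j, \sum_i v i * ((i == j)%:R * 2 - (A i j)%:~R) = lam * v j) ->
  forall b k, uniform v (alternate b k).
Proof.
move=> vE b; elim=> [|k IH] /=; first exact: uniform1.
exact: uniform_cx vE _ _ IH.
Qed.

(** Add factors as long as the next colour consists of simple roots still sent to positive ones;
    each factor then adds its full size to the count. At the first failure every simple root is sent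
    to a negative one. *)
Lemma alternate_longest (C : numClosedFieldType) b : (0 < r)%N ->
  exists k, (forall x, x \in P -> x *m alternate b k \notin P) /\
    forall Z : pred 'rV[rat]_r, (forall x i, Z (x *m sr i) = Z x) -> (forall x, Z (- x) = Z x) ->
      inv_countZ Z (alternate b k) = (\sum_(l < k) colour_size Z (b (+) odd l))%N.
Proof.
move=> r0; have [lam [v [v0 vE]]] := perron_cartan C r0.
have unif := alternate_uniform vE b.
pose bad k := [exists i, (col i == b (+) odd k) && (al i *m alternate b k \notin P)].
have count k : (forall l, (l < k)%N -> ~~ bad l) -> forall Z : pred 'rV[rat]_r,
    (forall x i, Z (x *m sr i) = Z x) -> (forall x, Z (- x) = Z x) ->
    inv_countZ Z (alternate b k) = (\sum_(l < k) colour_size Z (b (+) odd l))%N.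
  move=> + Z Zr ZN; elim: k => [|k IH] good; first by rewrite big_ord0 inv_countZ1.
  rewrite big_ord_recr /= inv_countZ_colour // => [|i ib].
    by rewrite IH 1?addnC // => l lk; apply: good; apply: ltnW.
  apply: contraT => iN; have /negP[] := good k (ltnSn k).
  by apply/existsP; exists i; rewrite ib eqxx.
have ex_bad : exists k, bad k.
  (* Without a failure, $2(|P|+1)$ factors would produce $(|P|+1)r$ inversions, more than the $|P|$
     positive roots allow. *)
  have [/hasP[k _ kb]|/hasPn N] := boolP (has bad (iota 0 (size P).+1.*2)); first by exists k.
  have good l : (l < (size P).+1.*2)%N -> ~~ bad l by move=> lk; apply: N; rewrite mem_iota.
  have := count _ good predT (fun _ _ => erefl) (fun _ => erefl).
  rewrite sum_alternate => E.
  have : (inv_countZ predT (alternate b (size P).+1.*2) <= size P)%N by apply: count_size.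
  rewrite E (_ : (_ + _)%N = r).
    by move=> /(leq_trans (leq_pmulr _ r0)); rewrite ltnn.
  rewrite /colour_size -[RHS]card_ord -sum1_card [RHS](bigID (fun i => col i == true)) /=.
  by congr (_ + _)%N; apply: eq_bigl => i; case: (col i).
have [k kbad kmin] := ex_minnP ex_bad; exists k; split; last first.
  by apply: count => l lk; apply: contraL lk => /kmin; rewrite -leqNgt.
have good l : (l < k)%N -> ~~ bad l by apply: contraL => /kmin; rewrite -leqNgt.
apply: (simple_neg H); first exact: alternate_weyl.
(* The colour due next is negative as a whole because one of its roots is; the other colour was just
   reversed by the last factor. No failure occurs at $k=0$. *)
move=> i; have [ci|ci] := eqVneq (col i) (b (+) odd k).
  have /existsP[j /andP[/eqP cj]] := kbad; apply: contra => iP.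
  apply: (uniform_sign v0 (alternate_weyl b k) (unif k) _ iP).
  by rewrite ci cj.
case: k kbad kmin good ci => [kbad _ _ _|k _ _ good ci].
  have /existsP[j /andP[_]] := kbad; rewrite /= mulmx1 => /negP[].
  exact: (pos_al H).
have ck : col i = b (+) odd k by move: ci; rewrite /= addbN; case: (col i); case: (b (+) odd k).
rewrite /= mulmxA -ck al_cx // mulNmx -(rootNpos H) ?negbK; last first.
  by rewrite (root_weyl H) ?(root_al H) ?alternate_weyl.
apply: contraT => iN; have /negP[] := good k (ltnSn k).
by apply/existsP; exists i; rewrite ck eqxx.
Qed.

(* The two alternating products of longest length both equal the longest
   element; comparing them with the number of roots in Z gives the order. *)
Lemma bipartite_power (C : numClosedFieldType) (Z : pred 'rV[rat]_r) (g : nat) : (0 < r)%N ->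
  (forall x i, Z (x *m sr i) = Z x) -> (forall x, Z (- x) = Z x) ->
  (0 < colour_size Z true + colour_size Z false)%N ->
  (2 * count Z P = g * (colour_size Z true + colour_size Z false))%N ->
  mpow (cx true *m cx false) g = 1%:M.
Proof.
move=> r0 Zr ZN L0 gE; set L := (_ + _)%N in L0 gE.
have [m [mN mC]] := alternate_longest C true r0.
have [m' [mN' mC']] := alternate_longest C false r0.
have all_count b k : (forall x, x \in P -> x *m alternate b k \notin P) ->
    inv_countZ Z (alternate b k) = count Z P.
  by move=> kN; apply: eq_in_count => x /kN ->; rewrite andbT.
have {mC} mC := mC Z Zr ZN; rewrite (all_count _ _ mN) in mC.
have {mC'} mC' := mC' Z Zr ZN; rewrite (all_count _ _ mN') in mC'.
have mm := weyl_neg_uniq H (alternate_weyl _ _) (alternate_weyl _ _) mN mN.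
have mm' := weyl_neg_uniq H (alternate_weyl _ _) (alternate_weyl _ _) mN mN'.
have mm'' := weyl_neg_uniq H (alternate_weyl _ _) (alternate_weyl _ _) mN' mN'.
have even_case k : (count Z P = k * L)%N -> (k + k)%N = g.
  move=> E; apply/eqP; rewrite -(eqn_pmul2r L0) -gE E; apply/eqP; lia.
rewrite -(odd_double_half m) in mC mm mm' mN.
rewrite -(odd_double_half m') in mC' mm' mm'' mN'.
(* A longest product of even length has length exactly $g$, and its square is the required power. *)
case: (odd m) in mC mm mm' mN; last first.
  rewrite add0n in mC mm; rewrite sum_alternate in mC; rewrite -(even_case _ mC).
  move: mm; rewrite alternate_even -mpowD => /= E.
  have := mpow_shift (cx true) (cx false) (m./2 + m./2); rewrite E mulmx1 => E'.
  by rewrite -[LHS]mulmx1 -(cx_invol true) mulmxA -E' cx_invol.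
case: (odd m') in mC' mm' mm'' mN'; last first.
  rewrite add0n in mC' mm''; rewrite sum_alternate in mC'; rewrite -(even_case _ mC').
  by move: mm''; rewrite alternate_even -mpowD.
rewrite !add1n in mC mC' mm'; rewrite !alternate_odd /= in mm'.
rewrite sum_alternate_odd -/L in mC; rewrite sum_alternate_odd -/L in mC'.
(* With both lengths odd, each single count depends on the size of one colour; in their sum the two
   colours occur equally often. *)
have <- : (m./2 + m'./2.+1)%N = g.
  apply/eqP; rewrite -(eqn_pmul2r L0) -gE; apply/eqP.
  by rewrite mulnDl mulSn mul2n -addnn {1}mC mC' /L /=; lia.
by rewrite mpowD mpowS -mm' mpow_shift !mulmxA.
Qed.

End Bipartite.

(** * The Coxeter number *)

Section CoxeterNumber.
Variables (r : nat) (A : 'M[int]_r) (d : 'I_r -> rat) (Wl : seq 'M[rat]_r).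
Hypothesis H : cartan_datum A d Wl.
Hypothesis r_gt0 : (0 < r)%N.
Implicit Types (x y : 'rV[rat]_r) (i : 'I_r) (j k : nat) (s t : seq 'I_r) (w u : 'M[rat]_r).
Local Notation al := (@simple_root r).
Local Notation sr := (refl A).
Local Notation word := (word_mx A).
Local Notation P := (pos_roots Wl).
Local Notation SR := (short_roots A Wl d).
Local Notation l := (n_short_simple A Wl d).
Local Notation cox := (word (enum 'I_r)).
Let cartA := datum_cartan H.

Variable th : 'rV[rat]_r.
Hypothesis thS : th \in SR.
Hypothesis thd : dominant A th.

Let Z : pred 'rV[rat]_r := mem SR.

Lemma Z_refl x i : Z (x *m sr i) = Z x.
Proof.
apply/idP/idP => xS; last by apply: (short_weyl H) => //; apply: (weyl_refl H).
rewrite -[x]mulmx1 -(refl_invol cartA i) mulmxA.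
by apply: (short_weyl H) => //; apply: (weyl_refl H).
Qed.

Lemma ZN x : Z (- x) = Z x.
Proof. by apply/idP/idP => /(shortN H); rewrite ?opprK. Qed.

Lemma l_sum : l = (\sum_i Z (al i))%N.
Proof.
by rewrite /n_short_simple -sum1_card big_mkcond; apply: eq_bigr => i _; rewrite inE /Z /=; case: (_ \in _).
Qed.

Lemma l_gt0 : (0 < l)%N.
Proof.
have /rootsP[i [w wW E]] := short_root thS.
rewrite l_sum (bigD1 i) //= /Z /= (_ : al i \in SR) //.
by rewrite -[al i](mulmxK (weyl_unit H wW)) -E (short_weyl H) ?(weylV H).
Qed.

Lemma count_short_pos : count (mem P) SR = count Z P.
Proof.
rewrite -!size_filter; apply: perm_size; apply: uniq_perm.
- exact/filter_uniq/short_uniq.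
- exact/filter_uniq/pos_uniq.
by move=> x; rewrite [LHS]mem_filter [RHS]mem_filter andbC.
Qed.

Lemma size_short : size SR = (2 * count Z P)%N.
Proof.
rewrite -count_short_pos -(count_predC (mem P)) mul2n -addnn; congr (_ + _)%N.
rewrite -(permP (perm_shortN H)) count_map; apply: eq_in_count => x xS /=.
by rewrite (rootNpos H) ?opprK // (rootN H) // (short_root xS).
Qed.

(** At $q=1$ the duality only says $l=l$; its derivative there reads $n+lH=gl+lH-n$, with $n$ the
    number of positive short roots. *)
Lemma short_count g : g%:R = dual_height A d Wl th -> (2 * count Z P = g * l)%N.
Proof.
move=> gE; have := congr1 (fun p : {poly int} => p^`().[1]) (duality H thS thd gE).
rewrite (mq_theta0 H thS thd).
set S1 := \sum_(x <- SR | _) _; set S2 := \sum_(x <- SR | _) _.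
have S1E : S1.[1] = (count Z P)%:R.
  rewrite horner_sum -count_short_pos -sum1_count natr_sum; apply: eq_bigr => x _.
  by rewrite hornerXn expr1n.
have S2E : S2.[1] = (count Z P)%:R.
  rewrite horner_sum -count_short_pos -sum1_count natr_sum; apply: eq_bigr => x _.
  by rewrite hornerXn expr1n.
clearbody S1 S2; rewrite -!polyC_natr !derivE !hornerE !hornerMn !hornerE !expr1n.
by rewrite S1E S2E /= !natz => E; nia.
Qed.

Lemma word_coord i s x : i \notin s -> (x *m word s) 0 i = x 0 i.
Proof.
elim: s x => [|a s IH] x; first by rewrite mulmx1.
rewrite inE negb_or => /andP[ia is_] /=; rewrite mulmxA IH // reflE !mxE.
by rewrite (negPf ia) mulr0 subr0.
Qed.

(** The letters are distinct, so the coordinate of the first letter is changed by that letter alone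
    and its pairing must vanish. *)
Lemma word_fixed s x : uniq s -> x *m word s = x -> {in s, forall i, pair A i x = 0}.
Proof.
elim: s x => // a s IH x /= /andP[as_ us]; rewrite mulmxA => E.
have := word_coord (x *m sr a) as_; rewrite E reflE !mxE eqxx mulr1 => Ea.
have pa : pair A a x = 0 by lra.
have xa : x *m sr a = x by rewrite reflE pa scale0r subr0.
move=> i; rewrite inE => /orP[/eqP->//|]; apply: IH => //.
by rewrite -{1}xa.
Qed.

Lemma cox_fixed x : x *m cox = x -> x = 0.
Proof.
move=> /(word_fixed (enum_uniq _)) fx; apply/eqP; apply: contraT => /(form_gt0 H).
rewrite formE big1 ?ltxx // => i _.
by rewrite fx ?mem_enum // !mulr0.
Qed.

Lemma cox_mpow_weyl k : mpow cox k \in Wl.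
Proof.
elim: k => [|k IH]; first exact: (weyl1 H).
by rewrite mpowS (weylM H) ?(weyl_word H).
Qed.

(** The sum of $x$ over $k$ successive powers is fixed by the Coxeter element, hence zero. So the
    heights cannot all have the same sign, and the cyclic sequence must descend somewhere. *)
Lemma cox_orbit k x : (0 < k)%N -> mpow cox k = 1%:M -> x \in SR ->
  exists2 j, (j < k)%N & (x *m mpow cox j \in P) && (x *m mpow cox j.+1 \notin P).
Proof.
move=> k0 ck xS; pose y j := x *m mpow cox j.
have cW j := cox_mpow_weyl j.
have yR j : y j \in roots Wl by rewrite (root_weyl H) ?(short_root xS).
have sum0 : \sum_(j < k) y j = 0.
  apply: cox_fixed; rewrite mulmx_suml.
  rewrite (eq_bigr (fun j : 'I_k => y j.+1)) => [|j _]; last by rewrite /y mpowSr mulmxA.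
  case: k k0 ck => // k _ ck; rewrite big_ord_recr /= big_ord_recl addrC; congr (_ + _).
  by rewrite /y ck.
have ht_sum : \sum_(j < k) ht (y j) = 0.
  by rewrite -(big_morph _ (@htD r) (ht0 r)) sum0 ht0.
have [/existsP[j /andP[yj yj1]]|/existsPn N] :=
    boolP [exists j : 'I_k, (y j \in P) && (y j.+1 \notin P)].
  by exists j => //; rewrite yj.
have step j : (j < k)%N -> y j \in P -> y j.+1 \in P.
  by move=> jk yj; have := N (Ordinal jk); rewrite /= yj negbK.
have up j m : (j + m <= k)%N -> y j \in P -> y (j + m)%N \in P.
  elim: m => [|m IH] jm yj; first by rewrite addn0.
  have jm' : (j + m < k)%N by rewrite -addnS.
  by rewrite addnS step // IH // ltnW.
have y0 : y 0%N = x by rewrite /y mulmx1.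
have [xP|xP] := boolP (x \in P).
  have yP j : (j <= k)%N -> y j \in P.
    by move=> jk; apply: (up 0%N); rewrite // y0.
  have : 0 < \sum_(j < k) ht (y j).
    rewrite (bigD1 (Ordinal k0)) //= ltr_wpDr //.
      by rewrite sumr_ge0 // => j _; rewrite ltW // (ht_pos_gt0 H) // yP // ltnW.
    by rewrite (ht_pos_gt0 H) //= y0.
  by rewrite ht_sum ltxx.
have yN j : (j < k)%N -> y j \notin P.
  move=> jk; apply: contra xP => /(up _ (k - j)%N); rewrite subnKC ?(ltnW jk) // => /(_ (leqnn k)).
  by rewrite /y ck mulmx1.
have : 0 < \sum_(j < k) - ht (y j).
  have neg j : (j < k)%N -> 0 < - ht (y j).
    by move=> jk; rewrite -htN (ht_pos_gt0 H) // -(rootNpos H) ?yN.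
  rewrite (bigD1 (Ordinal k0)) //= ltr_wpDr ?neg // sumr_ge0 // => j _.
  by rewrite ltW ?neg.
by rewrite sumrN ht_sum oppr0 ltxx.
Qed.

(** A short root is recovered from the element of [B] at which its orbit turns negative and from the
    time $j<k$ of that passage. *)
Lemma cox_lower k : (0 < k)%N -> mpow cox k = 1%:M -> (size SR <= l * k)%N.
Proof.
move=> k0 ck; pose B := [seq x <- P | Z x && (x *m cox \notin P)].
have cU j : mpow cox j \in unitmx := weyl_unit H (cox_mpow_weyl j).
have sB : (size B <= l)%N.
  rewrite size_filter -/(inv_countZ Wl Z cox).
  apply: leq_trans (inv_countZ_word_le H Z_refl ZN _) _.
  by rewrite big_enum l_sum.
apply: (@leq_trans (size B * k)); last by rewrite leq_mul2r sB orbT.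
rewrite -[X in (_ <= _ * X)%N](size_iota 0) -(size_allpairs (fun x j => x *m invmx (mpow cox j))).
apply: uniq_leq_size; first exact: short_uniq.
move=> x xS; have [j jk /andP[xP xN]] := cox_orbit k0 ck xS.
apply/allpairsP; exists (x *m mpow cox j, j); rewrite /= mem_iota jk mulmxK //; split=> //.
rewrite mem_filter xP andbT -mulmxA -mpowSr xN andbT.
exact: (short_weyl H (cox_mpow_weyl j) xS).
Qed.

Lemma coxeter_numberE g : g%:R = dual_height A d Wl th -> coxeter_number A = g.
Proof.
move=> gE; have cnt := short_count gE.
have g0 : (0 < g)%N.
  have [g' g'E g1] := dual_height_nat H thS thd.
  by move: gE; rewrite -g'E => /eqP; rewrite eqr_nat => /eqP->; apply: ltnW.
have cg : mpow cox g = 1%:M.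
  have [col colP] := colouring H.
  have cs : (colour_size col Z true + colour_size col Z false = l)%N.
    rewrite l_sum (bigID (fun i => col i == true)) /=; congr (_ + _)%N.
    by apply: eq_bigl => i; case: (col i).
  have bg := @bipartite_power _ _ _ _ H _ colP algC Z g r_gt0 Z_refl ZN.
  rewrite cs l_gt0 in bg; have {}bg := bg isT cnt.
  have pe : perm_eq (enum 'I_r) (colour_class col true ++ colour_class col false).
    rewrite perm_sym /colour_class (_ : [seq i <- _ | _ == false] =
       filter (predC (fun i => col i == true)) (enum 'I_r)).
      exact/permPl/perm_filterC.
    by apply: eq_filter => i /=; case: (col i).
  have [u uW uE] := word_equiv_conj H (word_equiv_uniq H (enum_uniq _) pe).
  rewrite word_cat in uE; have := mpow_conj g uE; rewrite bg mulmx1 => E.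
  by rewrite -[LHS](mulmxK (weyl_unit H uW)) E mulmxV ?(weyl_unit H).
pose Q k := (0 < k)%N && (mpow cox k == 1%:M).
have Qg : Q g by rewrite /Q g0 cg eqxx.
apply/eqP; rewrite eqn_leq; apply/andP; split; first exact: (least_min (Q := Q) Qg).
have /andP[h0 /eqP ch] : Q (coxeter_number A) by apply: (leastP (Q := Q) Qg).
have := cox_lower h0 ch; rewrite size_short cnt mulnC leq_pmul2l //.
exact: l_gt0.
Qed.

End CoxeterNumber.

(** * Assembling the identity *)

Lemma graded_identity (g N : nat) (m l p S T : {poly int}) :
  m = l + ('X - 1) * S -> p = l * 'X^N + (1 - 'X) * T -> m * 'X^N = 'X^g * p ->
  m + (T + S * (('X - 1) * m + 'X^N)) = m * (m - l + 1) + p * \sum_(i < g) 'X^i.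
Proof.
move=> mE pE dual; have X1 : 'X - 1 != 0 :> {poly int}.
  by rewrite -polyC1 polyXsubC_eq0.
have geo : ('X - 1) * \sum_(i < g) 'X^i = 'X^g - 1 :> {poly int} by rewrite subrX1.
have mS : ('X - 1) * S = m - l by rewrite mE [l + _]addrC addrK.
have pT : ('X - 1) * T = l * 'X^N - p by rewrite pE; ring.
move: ('X - 1) 'X^N 'X^g (\sum_(i < g) 'X^i) X1 geo mS pT dual => Y U V G Y0 geo mS pT dual.
(* Multiplied by $q-1$, the sums $S$, $T$ and the geometric sum become expressions in $m$, $l$, $p$
   and powers of $q$, and the duality finishes. *)
apply: (mulfI Y0).
transitivity (Y * m + Y * T + Y * S * (Y * m + U)); first by ring.
transitivity (Y * (m * (m - l + 1)) + p * (Y * G)); last by ring.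
rewrite geo mS pT; transitivity (Y * m + m * U - p + (m - l) * (Y * m)); first by ring.
by rewrite dual; ring.
Qed.

Theorem theorem2p5 (r : nat) (A : 'M[int]_r) (d : 'I_r -> rat)
    (Wl : seq 'M[rat]_r) (theta_s : 'rV[rat]_r) :
  (0 < r)%N ->
  is_cartan_matrix A -> indecomposable A ->
  symmetrizes A d -> pos_def_form A d ->
  enumerates_weyl A Wl ->
  theta_s \in short_roots A Wl d -> dominant A theta_s ->
  let h := coxeter_number A in
  let m0 := mq A Wl theta_s 0 in
  let l := n_short_simple A Wl d in
  exists2 k : nat, k%:R = h%:R - ht theta_s &
  exists p : {poly int},
    m0 = p * 'X^k /\
    \sum_(mu <- 0 :: short_roots A Wl d) mq A Wl theta_s mu
      = m0 * (m0 - l%:R + 1) + p * \sum_(i < h) 'X^i.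
Proof.
move=> r0 cA iA sA pA eW thS thd h m0 l.
have H : cartan_datum A d Wl by [].
have thP := th_pos H thS thd.
have [g gE _] := dual_height_nat H thS thd.
have hg : h = g := coxeter_numberE H r0 thS thd gE.
have dual := duality H thS thd gE; rewrite -/m0 -/l in dual.
have m0E := mq_theta0 H thS thd; rewrite -/m0 -/l in m0E.
set P := pos_roots Wl in thP dual m0E; set SR := short_roots A Wl d in thS dual m0E *.
set N := abs_ht theta_s in dual.
set Sr := \sum_(x <- SR | x \in P) 'X^(N - abs_ht x) in dual.
(* [p] is $q^Nm^0(1/q)$, the quotient named in the theorem. *)
set p := _ + _ * Sr in dual.
have N0 : (0 < N)%N by apply: (abs_ht_gt0 H thP).
(* [theta_s] itself contributes $q^0$ to [Sr], and no other term contributes negatively in degree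
   $0$. *)
have p0 : p`_0 != 0.
  rewrite /p coefD coefMXn N0 add0r mulrBl mul1r coefB coefXM /= subr0.
  rewrite /Sr coef_sum big_mkcond (bigD1_seq theta_s) ?short_uniq //= thP subnn coefXn eqxx.
  rewrite gt_eqF // ltr_wpDr // sumr_ge0 // => x _; case: ifP => // _.
  by rewrite coefXn; case: eqP.
(* If $g<N$, the duality would make $p$ divisible by $q^{N-g}$; thus the exponent
   $h-\mathrm{ht}(\theta_s)$ is a natural number. *)
have Ng : (N <= g)%N.
  rewrite leqNgt; apply: contra p0 => gN; apply/eqP.
  move: dual; rewrite -{1}(subnK (ltnW gN)) exprD mulrA mulrC.
  move=> /(mulfI (monic_neq0 (monicXn _ g))) <-.
  by rewrite coefMXn subn_gt0 gN.
have m0p : m0 = p * 'X^(g - N).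
  apply: (mulIf (monic_neq0 (monicXn _ N))).
  have XE : 'X^g = 'X^(g - N) * 'X^N :> {poly int} by rewrite -exprD subnK.
  by rewrite dual XE mulrC mulrA.
exists (g - N)%N; first by rewrite hg natrB // (abs_htE H thP).
exists p; split=> //.
rewrite big_cons (sum_mq_theta H thS thd) -/m0 -/N -/Sr hg.
set S := \sum_(x <- SR | x \in P) 'X^((abs_ht x).-1) in m0E *.
have pE : p = l%:R * 'X^N + (1 - 'X) * Sr by [].
clearbody m0 p S Sr N.
exact: (graded_identity m0E pE dual).
Qed.
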